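(* Let $n\ge 2$, let $\mathbb{E}\in GL_n(\Bbbk)$, and let $A:=A(n,\mathbb{E})=\Bbbk\langle v_1,\dots,v_n\rangle/(\sum_{1\le i,j\le n}e_{ij}v_iv_j)$ be the corresponding Artin–Schelter regular algebra of global dimension $2$. The following statements are equivalent: (a) $A$ is Noetherian. (b) $A$ has finite Gelfand–Kirillov dimension. (c) $\mathcal{O}_A(SL/S^2)$, $\mathcal{O}_A(GL/S^2)$, $\mathcal{O}_A(SL)$, and $\mathcal{O}^c_A(GL)$ are Noetherian. (d) $\mathcal{O}_A(SL/S^2)$, $\mathcal{O}_A(GL/S^2)$, $\mathcal{O}_A(SL)$, and $\mathcal{O}^c_A(GL)$ have finite Gelfand–Kirillov dimension. (e) $n=2$.
   Context: $\Bbbk$ is an algebraically closed field of characteristic zero; $\otimes=\otimes_\Bbbk$; $\mathbb{E}=(e_{ij})$; $r=\sum_{i,j}e_{ij}v_iv_j$. Let $\mathcal{F}$ be the free algebra on $a_{ij}$ ($1\le i,j\le n$), a bialgebra with $\Delta(a_{ij})=\sum_s a_{is}\otimes a_{sj}$, $\epsilon(a_{ij})=\delta_{ij}$. $\mathcal{O}_A(M)$ is the bialgebra quotient of $\mathcal{F}$ by the ideal generated by all elements $\sum_{i,j,k,l}e_{ij}d_{kl}a_{ki}a_{lj}$ with $(d_{kl})\in M_n(\Bbbk)$ such that $\sum_{i,j}d_{ij}e_{ij}=0$. $\mathcal{O}_A(GL)$ is the Hopf envelope of $\mathcal{O}_A(M)$, i.e. the Hopf algebra with a bialgebra map from $\mathcal{O}_A(M)$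 through which every bialgebra map from $\mathcal{O}_A(M)$ to a Hopf algebra factors uniquely by a Hopf algebra map. It coacts on $A$ by $\rho(v_i)=\sum_s v_s\otimes a_{si}$; the homological codeterminant is the group-like element $\mathsf{D}$ with $\rho(r)=r\otimes\mathsf{D}^{-1}$ (coaction on the free algebra). Let $S$ denote antipodes. Define the Hopf quotients: - $\mathcal{O}^c_A(GL)$: the quotient of $\mathcal{O}_A(GL)$ by the Hopf ideal generated by $\{a\mathsf{D}-\mathsf{D}a : a\in\mathcal{O}_A(GL)\}$; - $\mathcal{O}_A(SL)=\mathcal{O}_A(GL)/(\mathsf{D}-1)$; - $\mathcal{O}_A(GL/S^2)$: the quotient of $\mathcal{O}_A(GL)$ by the Hopf ideal generated by $\{S^2(a)-a\}$; - $\mathcal{O}_A(SL/S^2)$: the quotient of $\mathcal{O}_A(SL)$ by the Hopf ideal generated by $\{S^2(a)-a\}$. *)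

(* Defs.v *)
From HB Require Import structures.
From mathcomp Require Import all_boot all_order all_algebra generic_quotient.
From mathcomp Require Import finmap.
From mathcomp Require Import all_classical all_reals all_analysis.
From mathcomp Require Import -(notations) monalg.

Set Implicit Arguments.
Unset Strict Implicit.
Unset Printing Implicit Defensive.

Import GRing.Theory.

Local Open Scope classical_set_scope.
Local Open Scope ring_scope.
Local Open Scope quotient_scope.

Section Span.
Variables (k : fieldType) (V : lmodType k).
Implicit Types (U X : set V).

Definition is_subspace U :=
  U 0 /\ forall a u v, U u -> U v -> U (a *: u + v).

Definition lspan X : set V :=
  [set v | forall U, is_subspace U -> X `<=` U -> U v].

Lemma lspan_subspace X : is_subspace (lspan X).
Proof.
split=> [U [U0 _] _ // | a u v hu hv U hU hX].
by apply: hU.2; [apply: hu | apply: hv].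
Qed.

Lemma sub_lspan X : X `<=` lspan X.
Proof. by move=> x Xx U _; apply. Qed.

Lemma subspaceZ U a u : is_subspace U -> U u -> U (a *: u).
Proof. by move=> [U0 UD] Uu; rewrite -[_ *: _]addr0; apply: UD. Qed.

Lemma subspaceD U u v : is_subspace U -> U u -> U v -> U (u + v).
Proof. by move=> [U0 UD] Uu Uv; rewrite -[u]scale1r; apply: UD. Qed.

Lemma subspaceN U u : is_subspace U -> U u -> U (- u).
Proof. by move=> hU Uu; rewrite -scaleN1r; apply: subspaceZ. Qed.

Definition span_eq X (u v : V) : bool := `[< lspan X (u - v) >].

Lemma span_eq_equiv X : equiv_class_of (span_eq X).
Proof.
have hS := lspan_subspace X.
split=> [u | u v | v u w].
- by apply/asboolP; rewrite subrr; apply: hS.1.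
- by apply/idP/idP => /asboolP h; apply/asboolP; rewrite -opprB;
    exact: (subspaceN hS).
- move=> /asboolP huv /asboolP hvw; apply/asboolP.
  by have := subspaceD hS huv hvw; rewrite addrA subrK.
Qed.

Canonical span_eq_equivRel X := EquivRelPack (span_eq_equiv X).

Definition quot_mod X := {eq_quot (span_eq X)}.

End Span.

HB.lock Definition quot_add (k : fieldType) (V : lmodType k) (X : set V)
  (x y : quot_mod X) : quot_mod X := \pi_(quot_mod X) (repr x + repr y).
HB.lock Definition quot_opp (k : fieldType) (V : lmodType k) (X : set V)
  (x : quot_mod X) : quot_mod X := \pi_(quot_mod X) (- repr x).
HB.lock Definition quot_scale (k : fieldType) (V : lmodType k) (X : set V)
  (a : k) (x : quot_mod X) : quot_mod X := \pi_(quot_mod X) (a *: repr x).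
HB.lock Definition quot_pi (k : fieldType) (V : lmodType k) (X : set V)
  (x : V) : quot_mod X := \pi_(quot_mod X) x.

Section QuotMod.
Variables (k : fieldType) (V : lmodType k) (X : set V).
Local Notation Q := (quot_mod X).
HB.instance Definition _ := Choice.on Q.
HB.instance Definition _ := EqQuotient.on Q.

Let hS := lspan_subspace X.

Lemma quot_ind (P : Q -> Prop) : (forall u, P (\pi_Q u)) -> forall x, P x.
Proof. by move=> Pu x; rewrite -[x]reprK. Qed.

Lemma quot_eqP (u v : V) : (\pi_Q u = \pi_Q v) <-> lspan X (u - v).
Proof. by split=> [/eqmodP/asboolP // | h]; apply/eqmodP/asboolP. Qed.

Lemma repr_piP (v : V) : lspan X (repr (\pi_Q v) - v).
Proof. by apply/quot_eqP; rewrite reprK. Qed.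

Local Notation quot_add := (@quot_add k V X).
Local Notation quot_opp := (@quot_opp k V X).
Local Notation quot_scale := (@quot_scale k V X).

Lemma quot_addE u v : quot_add (\pi_Q u) (\pi_Q v) = \pi_Q (u + v).
Proof.
rewrite quot_add.unlock; apply/quot_eqP; rewrite opprD addrACA.
by apply: (subspaceD hS); apply: repr_piP.
Qed.
Lemma quot_oppE u : quot_opp (\pi_Q u) = \pi_Q (- u).
Proof. by rewrite quot_opp.unlock; apply/quot_eqP; rewrite -opprD; apply: (subspaceN hS); apply: repr_piP. Qed.
Lemma quot_scaleE a u : quot_scale a (\pi_Q u) = \pi_Q (a *: u).
Proof. by rewrite quot_scale.unlock; apply/quot_eqP; rewrite -scalerBr; apply: (subspaceZ _ hS); apply: repr_piP. Qed.

Lemma quot_addA : associative quot_add.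
Proof. by elim/quot_ind=> u; elim/quot_ind=> v; elim/quot_ind=> w; rewrite !quot_addE addrA. Qed.
Lemma quot_addC : commutative quot_add.
Proof. by elim/quot_ind=> u; elim/quot_ind=> v; rewrite !quot_addE addrC. Qed.
Lemma quot_add0 : left_id (\pi_Q 0) quot_add.
Proof. by elim/quot_ind=> u; rewrite !quot_addE add0r. Qed.
Lemma quot_addN : left_inverse (\pi_Q 0) quot_opp quot_add.
Proof. by elim/quot_ind=> u; rewrite quot_oppE !quot_addE addNr. Qed.
HB.instance Definition _ :=
  GRing.isZmodule.Build Q quot_addA quot_addC quot_add0 quot_addN.

Lemma quot_piD u v : \pi_Q (u + v) = \pi_Q u + \pi_Q v.
Proof. by rewrite -quot_addE. Qed.

Lemma quot_scaleA a b (x : Q) : quot_scale a (quot_scale b x) = quot_scale (a * b) x.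
Proof. by elim/quot_ind: x => u; rewrite !quot_scaleE scalerA. Qed.
Lemma quot_scale1 : left_id 1 quot_scale.
Proof. by elim/quot_ind=> u; rewrite quot_scaleE scale1r. Qed.
Lemma quot_scaleDr : right_distributive quot_scale +%R.
Proof.
move=> a; elim/quot_ind=> u; elim/quot_ind=> v.
by rewrite -quot_piD !quot_scaleE scalerDr quot_piD.
Qed.
Lemma quot_scaleDl (x : Q) : {morph quot_scale^~ x : a b / a + b}.
Proof. by move=> a b; elim/quot_ind: x => u; rewrite !quot_scaleE scalerDl quot_piD. Qed.
HB.instance Definition _ := GRing.Zmodule_isLmodule.Build k Q
  quot_scaleA quot_scale1 quot_scaleDr quot_scaleDl.

Lemma quot_piE u : \pi_Q u = quot_pi X u.
Proof. by rewrite quot_pi.unlock. Qed.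
Lemma quot_pi_linear : linear (quot_pi X).
Proof. by move=> a u v; rewrite -!quot_piE quot_piD -quot_scaleE. Qed.
HB.instance Definition _ := GRing.isLinear.Build k V Q _ (quot_pi X) quot_pi_linear.

End QuotMod.

HB.lock Definition free_lift (k : fieldType) (T : choiceType) (U : lmodType k)
  (f : T -> U) (g : malg T k) : U := \sum_(t <- msupp g) mcoeff t g *: f t.

Lemma mkmalgUZ (k : fieldType) (T : choiceType) (t : T) (c : k) :
  mkmalgU t c = c *: mkmalgU t 1.
Proof. by apply/malgP => t'; rewrite mcoeffZ !mcoeffU mulr_natr. Qed.

Section FreeModule.
Variables (k : fieldType) (T : choiceType) (U : lmodType k).
Implicit Types (f : T -> U) (g : malg T k).

Lemma free_liftEw f g (d : {fset T}%fset) : fsubset (msupp g) d ->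
  free_lift f g = \sum_(t <- d) mcoeff t g *: f t.
Proof.
move=> le; rewrite free_lift.unlock [LHS](big_fset_incl _ le) => //= x xd /mcoeff_outdom ->.
by rewrite scale0r.
Qed.

Lemma free_lift_linear f : linear (free_lift f).
Proof.
move=> a g h.
set d := fsetU (fsetU (msupp g) (msupp h)) (msupp (a *: g + h)).
rewrite !(@free_liftEw _ _ d); first last.
- by apply: fsubsetUr.
- by rewrite /d -fsetUA; apply: fsubsetUl.
- by rewrite /d -fsetUA fsetUCA; apply: fsubsetUl.
rewrite scaler_sumr -big_split /=; apply: eq_bigr => t _.
by rewrite mcoeffD mcoeffZ scalerDl scalerA.
Qed.
HB.instance Definition _ f :=
  GRing.isLinear.Build k (malg T k) U _ (free_lift f) (free_lift_linear f).

Lemma free_liftU f t : free_lift f (mkmalgU t 1) = f t.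
Proof.
rewrite (@free_liftEw _ _ [fset t]%fset) ?msuppU_le // big_seq_fset1.
by rewrite mcoeffUU scale1r.
Qed.

End FreeModule.

Definition is_bilinear (k : fieldType) (V W U : lmodType k) (f : V -> W -> U) :=
  (forall w, linear (f^~ w)) /\ (forall v, linear (f v)).

Section TensorDef.
Variables (k : fieldType) (V W : lmodType k).

Local Notation e v w := (mkmalgU (v : V, w : W) (1 : k)).

(* [tensor V W] is the free vector space on the set [V * W] modulo the span of
   the bilinearity relators. *)
Definition tensor_relators : set (malg (V * W)%type k) :=
  [set g | exists a v v' w, g = e (a *: v + v') w - (a *: e v w + e v' w)] `|`
  [set g | exists a v w w', g = e v (a *: w + w') - (a *: e v w + e v w')].

Definition tensor := quot_mod tensor_relators.
HB.instance Definition _ := GRing.Lmodule.on tensor.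

End TensorDef.
Arguments tensor {k} V W.

HB.lock Definition tens (k : fieldType) (V W : lmodType k) (v : V) (w : W) :
  tensor V W := quot_pi (@tensor_relators k V W) (mkmalgU (v, w) 1).
Arguments tens {k V W} v w.
Notation "v *t w" := (tens v w) (at level 40) : ring_scope.

(* Meaningful for bilinear [f]: see [tensor_liftE] and [tensor_lift_linear]. *)
HB.lock Definition tensor_lift (k : fieldType) (V W U : lmodType k)
  (f : V -> W -> U) (t : tensor V W) : U :=
  free_lift (fun p => f p.1 p.2) (repr t).

Section TensorTheory.
Variables (k : fieldType) (V W : lmodType k).
Local Notation T := (tensor V W).

Lemma tens_bilinear : is_bilinear (@tens k V W).
Proof.
split=> [w a v v' | v a w w']; rewrite tens.unlock -linearP /= -!quot_piE;
  apply/quot_eqP.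
  by apply: sub_lspan; left; exists a, v, v', w.
by apply: sub_lspan; right; exists a, v, w, w'.
Qed.

Lemma tensDl (v v' : V) (w : W) : (v + v') *t w = v *t w + v' *t w.
Proof. by rewrite -[v]scale1r tens_bilinear.1 !scale1r. Qed.
Lemma tensDr (v : V) (w w' : W) : v *t (w + w') = v *t w + v *t w'.
Proof. by rewrite -[w]scale1r tens_bilinear.2 !scale1r. Qed.
Lemma tens0l (w : W) : (0 : V) *t w = 0.
Proof. by apply: (addrI (0 *t w)); rewrite -tensDl !addr0. Qed.
Lemma tens0r (v : V) : v *t (0 : W) = 0.
Proof. by apply: (addrI (v *t 0)); rewrite -tensDr !addr0. Qed.
Lemma tensZl a (v : V) (w : W) : (a *: v) *t w = a *: (v *t w).
Proof. by rewrite -[a *: v]addr0 tens_bilinear.1 tens0l addr0. Qed.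
Lemma tensZr a (v : V) (w : W) : v *t (a *: w) = a *: (v *t w).
Proof. by rewrite -[a *: w]addr0 tens_bilinear.2 tens0r addr0. Qed.

Lemma tensor_ind (P : T -> Prop) :
  P 0 -> (forall v w, P (v *t w)) -> (forall x y, P x -> P y -> P (x + y)) ->
  forall t, P t.
Proof.
move=> P0 Pt PD t; rewrite -(reprK t) quot_piE.
rewrite (monalgE (repr t)) raddf_sum /=; elim/big_ind: _ => //= -[v w] _.
rewrite mkmalgUZ linearZ /=; have := Pt (mcoeff (v, w) (repr t) *: v) w.
by rewrite tensZl tens.unlock.
Qed.

Section Lift.
Variables (U : lmodType k) (f : V -> W -> U).
Hypothesis hf : is_bilinear f.

Lemma tensor_lift_pi g :
  tensor_lift f (quot_pi _ g) = free_lift (fun p => f p.1 p.2) g.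
Proof.
rewrite tensor_lift.unlock -quot_piE.
apply/eqP; rewrite -subr_eq0 -linearB; apply/eqP.
apply: (repr_piP g (U := [set g | free_lift (fun p => f p.1 p.2) g = 0])).
  split=> [|a u v /= hu hv]; first exact: linear0.
  by rewrite linearP /= hu hv scaler0 addr0.
move=> _ [[a [v [v' [w ->]]]] | [a [v [w [w' ->]]]]] /=.
  by rewrite linearB /= linearP /= !free_liftU /= hf.1 subrr.
by rewrite linearB /= linearP /= !free_liftU /= hf.2 subrr.
Qed.

Lemma tensor_liftE v w : tensor_lift f (v *t w) = f v w.
Proof. by rewrite tens.unlock tensor_lift_pi free_liftU. Qed.

Lemma tensor_lift_linear : linear (tensor_lift f).
Proof.
move=> a; elim/quot_ind=> u; elim/quot_ind=> v.
by rewrite !quot_piE -linearP !tensor_lift_pi linearP.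
Qed.

Lemma tensor_liftD : {morph tensor_lift f : x y / x + y}.
Proof. by move=> x y; rewrite -[x]scale1r tensor_lift_linear !scale1r. Qed.
Lemma tensor_lift0 : tensor_lift f 0 = 0.
Proof. by apply: (addrI (tensor_lift f 0)); rewrite -tensor_liftD !addr0. Qed.
End Lift.

Lemma tensor_lift_unique (U : lmodType k) (f : V -> W -> U) (h : {linear T -> U}) :
  is_bilinear f -> (forall v w, h (v *t w) = f v w) -> h =1 tensor_lift f.
Proof.
move=> hf hh; elim/tensor_ind => [|v w|x y hx hy].
- by rewrite linear0 tensor_lift0.
- by rewrite hh tensor_liftE.
- by rewrite linearD tensor_liftD // hx hy.
Qed.

End TensorTheory.

Section Functional.
Variables (k : fieldType) (V : lmodType k) (v0 : V).
Hypothesis v0_neq0 : v0 != 0.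

Lemma exists_functional : exists f : V -> k, scalar f /\ f v0 = 1.
Proof.
pose P (U : set V) := (forall a u v, U u -> U v -> U (a *: u + v)) /\ ~ U v0.
have [F FP tot|U [[UD Uv0] Umax]] := @Zorn_bigcup V P.
  split=> [a u v [X FX Xu] [Y FY Yv] | [X FX]]; last exact: (FP _ FX).2.
  have [XY|YX] := tot _ _ FX FY.
    by exists Y => //; apply: (FP _ FY).1 => //; apply: XY.
  by exists X => //; apply: (FP _ FX).1 => //; apply: YX.
have U0 : U 0.
  apply: contrapT => nU0; apply: (Umax [set 0]).
    split; first by case: (pselect (exists x, U x)) => [[x Ux]|nU] x' Ux';
      have := UD (-1) _ _ Ux' Ux'; rewrite scaleN1r addNr => /nU0.
    by move=> /(_ 0 erefl).
  by split=> [a u v -> -> | /eqP]; rewrite ?scaler0 ?addr0 //; apply/negP.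
have US : is_subspace U by split.
have dec v : exists c, U (v - c *: v0).
  have [Uv|nUv] := pselect (U v); first by exists 0; rewrite scale0r subr0.
  pose U' : set V := [set u | exists c, U (u - c *: v)].
  have sUU' : U `<` U'.
    split; first by move=> u Uu; exists 0; rewrite scale0r subr0.
    by move=> /(_ v) h; apply: nUv; apply: h; exists 1; rewrite scale1r subrr.
  have U'D a u w : U' u -> U' w -> U' (a *: u + w).
    move=> [c hc] [d hd]; exists (a * c + d).
    have := UD a _ _ hc hd; rewrite scalerBr scalerA scalerDl.
    by rewrite addrACA -opprD.
  have [c hc] : U' v0.
    by apply: contrapT => nU'; apply: (Umax U' sUU').
  have c0 : c != 0.
    by apply: contra_notN Uv0 => /eqP c0; move: hc; rewrite c0 scale0r subr0.
  exists c^-1; have := subspaceZ (- c^-1) US hc.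
  by rewrite scalerBr scalerA mulNr mulVf // scaleN1r opprK addrC scaleNr.
have uniq v c d : U (v - c *: v0) -> U (v - d *: v0) -> c = d.
  move=> hc hd; apply/eqP; apply: contra_notT Uv0 => cd.
  have := subspaceZ (d - c)^-1 US (subspaceD US hc (subspaceN US hd)).
  rewrite opprB [X in _ *: X]addrC addrA subrK -scalerBl scalerA mulVf ?scale1r //.
  by rewrite subr_eq0 eq_sym.
pose f v := sval (cid (dec v)).
have fP v : U (v - f v *: v0) by rewrite /f; case: cid.
exists f; split=> [a u v|]; last first.
  by apply: uniq (fP _) _; rewrite scale1r subrr.
apply: uniq (fP _) _; have := UD a _ _ (fP u) (fP v).
by rewrite scalerBr scalerA scalerDl addrACA -opprD.
Qed.

End Functional.

HB.lock Definition tensor_mul (k : fieldType) (A B : algType k)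
  (s t : tensor A B) : tensor A B :=
  tensor_lift (fun a b => tensor_lift (fun a' b' => (a * a') *t (b * b')) t) s.

Section TensorAlgebra.
Variables (k : fieldType) (A B : algType k).
Local Notation T := (tensor A B).

Local Notation tensor_mul := (@tensor_mul k A B).

Let inner_bil a b : is_bilinear (fun (a' : A) (b' : B) => (a * a') *t (b * b')).
Proof.
split=> [b' c u v | a' c u v] /=.
  by rewrite mulrDr tensDl -scalerAr tensZl.
by rewrite mulrDr tensDr -scalerAr tensZr.
Qed.

Let outer_bil (t : T) :
  is_bilinear (fun a b => tensor_lift (fun a' b' => (a * a') *t (b * b')) t).
Proof.
split=> [b c u v | a c u v] /=; elim/tensor_ind: t => [|a' b'|x y hx hy].
- by rewrite !tensor_lift0 // scaler0 addr0.
- by rewrite !tensor_liftE // mulrDl tensDl -scalerAl tensZl.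
- by rewrite !tensor_liftD // hx hy scalerDr addrACA.
- by rewrite !tensor_lift0 // scaler0 addr0.
- by rewrite !tensor_liftE // mulrDl tensDr -scalerAl tensZr.
- by rewrite !tensor_liftD // hx hy scalerDr addrACA.
Qed.

Lemma tensor_mulE a b a' b' :
  tensor_mul (a *t b) (a' *t b') = (a * a') *t (b * b').
Proof. by rewrite tensor_mul.unlock !tensor_liftE. Qed.

Lemma tensor_mulP c s s' t :
  tensor_mul (c *: s + s') t = c *: tensor_mul s t + tensor_mul s' t.
Proof. by rewrite tensor_mul.unlock tensor_lift_linear. Qed.

Lemma tensor_mulDl : left_distributive tensor_mul +%R.
Proof. by move=> s s' t; rewrite -[s]scale1r tensor_mulP !scale1r. Qed.

Lemma tensor_mul0l t : tensor_mul 0 t = 0.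
Proof. by rewrite tensor_mul.unlock tensor_lift0. Qed.

Lemma tensor_mulDr : right_distributive tensor_mul +%R.
Proof.
move=> s t t'; elim/tensor_ind: s => [|a b|x y hx hy].
- by rewrite !tensor_mul0l addr0.
- by rewrite tensor_mul.unlock !tensor_liftE // tensor_liftD.
- by rewrite !tensor_mulDl hx hy addrACA.
Qed.

Lemma tensor_mul0r s : tensor_mul s 0 = 0.
Proof. by apply: (addrI (tensor_mul s 0)); rewrite -tensor_mulDr !addr0. Qed.

Lemma tensor_mulA : associative tensor_mul.
Proof.
move=> s t u; elim/tensor_ind: s => [|a b|x y hx hy]; last first.
- by rewrite !tensor_mulDl hx hy.
- elim/tensor_ind: t => [|a' b'|x y hx hy]; last first.
  + by rewrite !(tensor_mulDl, tensor_mulDr) hx hy.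
  + elim/tensor_ind: u => [|a'' b''|x y hx hy]; last first.
    * by rewrite !tensor_mulDr hx hy.
    * by rewrite !tensor_mulE !mulrA.
    * by rewrite !tensor_mul0r.
  + by rewrite !(tensor_mul0l, tensor_mul0r).
- by rewrite !tensor_mul0l.
Qed.

Lemma tensor_mul1l : left_id (1 *t 1) tensor_mul.
Proof.
elim/tensor_ind => [|a b|x y hx hy]; rewrite ?tensor_mul0r //.
  by rewrite tensor_mulE !mul1r.
by rewrite tensor_mulDr hx hy.
Qed.

Lemma tensor_mul1r : right_id (1 *t 1) tensor_mul.
Proof.
elim/tensor_ind => [|a b|x y hx hy]; rewrite ?tensor_mul0l //.
  by rewrite tensor_mulE !mulr1.
by rewrite tensor_mulDl hx hy.
Qed.

Lemma tens11_neq0 : (1 : A) *t (1 : B) != 0.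
Proof.
have [f [flin f1]] := exists_functional (oner_neq0 A).
have [g [glin g1]] := exists_functional (oner_neq0 B).
pose h (a : A) (b : B) : k^o := f a * g b.
have hbil : is_bilinear h.
  split=> [b c u v | a c u v]; rewrite /h.
    by rewrite flin mulrDl -mulrA.
  by rewrite glin mulrDr mulrCA.
apply/eqP => /(congr1 (tensor_lift h)).
rewrite tensor_liftE // tensor_lift0 // /h f1 g1 mulr1.
by move/eqP; rewrite oner_eq0.
Qed.

HB.instance Definition _ := GRing.Zmodule_isNzRing.Build T
  tensor_mulA tensor_mul1l tensor_mul1r tensor_mulDl tensor_mulDr tens11_neq0.

Lemma tensor_scalerAl c (s t : T) : c *: (s * t) = (c *: s) * t.
Proof. by rewrite -[c *: s]addr0 [RHS]tensor_mulP tensor_mul0l addr0. Qed.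
HB.instance Definition _ := GRing.Lmodule_isLalgebra.Build k T tensor_scalerAl.

Lemma tensor_scalerAr c (s t : T) : c *: (s * t) = s * (c *: t).
Proof.
elim/tensor_ind: s => [|a b|x y hx hy]; rewrite ?mul0r ?scaler0 //.
  elim/tensor_ind: t => [|a' b'|x y hx hy]; rewrite ?scaler0 ?mulr0 ?scaler0 //.
    by rewrite -tensZr -[LHS]/(c *: tensor_mul _ _) -[RHS]/(tensor_mul _ _)
       !tensor_mulE -tensZr scalerAr.
  by rewrite scalerDr !mulrDr scalerDr hx hy.
by rewrite !mulrDl scalerDr hx hy.
Qed.
HB.instance Definition _ := GRing.Lalgebra_isAlgebra.Build k T tensor_scalerAr.

Lemma tensM (a a' : A) (b b' : B) : (a *t b) * (a' *t b') = (a * a') *t (b * b').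
Proof. exact: tensor_mulE. Qed.
Lemma tens1 : (1 : A) *t (1 : B) = 1. Proof. by []. Qed.

End TensorAlgebra.

Section FreeAlgebraConstruction.
Variables (k : fieldType) (X : choiceType).
Local Notation F := (malg (fmonom X) k).

Let mon (m : fmonom X) : F := mkmalgU m 1.

Lemma malg_monE (g : F) : g = \sum_(m <- msupp g) mcoeff m g *: mon m.
Proof. by rewrite [LHS]monalgE; apply: eq_bigr => m _; apply: mkmalgUZ. Qed.

Lemma malg_monM m m' : mon m * mon m' = mon (fmmul m m').
Proof. by rewrite [LHS]malgM_def fgmulUU mulr1. Qed.

Lemma malg_scalerAr a (g h : F) : a *: (g * h) = g * (a *: h).
Proof.
apply/malgP => m; rewrite mcoeffZ [in LHS]mcoeffMl mulr_sumr.
rewrite (mcoeffMlw _ (fsubset_refl _) (msuppZ_le a h)); apply: eq_bigr => m1 _.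
rewrite mulr_sumr; apply: eq_bigr => m2 _.
by rewrite mcoeffZ mulrCA mulrnAr.
Qed.

Lemma malg_mon_ind (P : F -> Prop) :
  (forall m, P (mon m)) -> (forall a g h, P g -> P h -> P (a *: g + h)) ->
  P 0 -> forall g, P g.
Proof.
move=> Pm PD P0 g; rewrite (malg_monE g).
by elim/big_rec: _ => // m h _ Ph; apply: PD.
Qed.

Lemma malg_mon_prod (s : seq X) : mon (FMonom s) = \prod_(x <- s) mon (fmu x).
Proof.
elim: s => [|x s IH]; first by rewrite big_nil /mon -fmoneE.
by rewrite big_cons -IH malg_monM fmmulE fmuE.
Qed.

Lemma malg_ind (P : F -> Prop) :
  P 1 -> (forall x, P (mon (fmu x))) -> (forall g h, P g -> P h -> P (g * h)) ->
  (forall a g h, P g -> P h -> P (a *: g + h)) -> forall g, P g.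
Proof.
move=> P1 PX PM PD; have P0 : P 0.
  by rewrite -(addNr 1) -scaleN1r; apply: PD.
apply: malg_mon_ind => // -[s]; rewrite malg_mon_prod.
by elim/big_rec: _ => // x h _ Ph; apply: PM.
Qed.

Definition free_malg := F.
HB.instance Definition _ := GRing.Lalgebra.on free_malg.
HB.instance Definition _ :=
  GRing.Lalgebra_isAlgebra.Build k free_malg malg_scalerAr.

Section Lift.
Variables (B : algType k) (f : X -> B).

Definition malg_lift : F -> B := free_lift (fun m : fmonom X => \prod_(x <- m) f x).

Lemma malg_lift_linear : linear malg_lift.
Proof. exact: free_lift_linear. Qed.
HB.instance Definition _ := GRing.isLinear.Build k F B _ malg_lift malg_lift_linear.

Lemma malg_lift_mon s : malg_lift (mkmalgU (FMonom s) 1) = \prod_(x <- s) f x.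
Proof. by rewrite /malg_lift free_liftU. Qed.

Lemma malg_lift_monoid : monoid_morphism malg_lift.
Proof.
split; first by rewrite -[1]/(mkmalgU (fmone X) 1) fmoneE malg_lift_mon big_nil.
move=> g h; move: g; apply: malg_mon_ind => [[s]|a g g' Hg Hg'|]; last first.
- by rewrite mul0r linear0 mul0r.
- rewrite mulrDl -scalerAl [LHS]malg_lift_linear [in RHS]malg_lift_linear.
  by rewrite [RHS]mulrDl -scalerAl; congr (_ *: _ + _).
move: h; apply: malg_mon_ind => [[s']|a g g' Hg Hg'|]; last first.
- by rewrite mulr0 linear0 mulr0.
- rewrite mulrDr -malg_scalerAr [LHS]malg_lift_linear.
  rewrite [in RHS]malg_lift_linear [RHS]mulrDr -scalerAr.
  by congr (_ *: _ + _).
by rewrite malg_monM fmmulE !malg_lift_mon big_cat.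
Qed.
HB.instance Definition _ :=
  GRing.isMonoidMorphism.Build free_malg B malg_lift malg_lift_monoid.

Lemma malg_lift_var x : malg_lift (mkmalgU (fmu x) 1) = f x.
Proof. by rewrite fmuE malg_lift_mon big_seq1. Qed.

End Lift.

End FreeAlgebraConstruction.

(* Universal property of the free algebra on [X]. The monoid algebra of words
   is the witness; it is locked because unification otherwise unfolds its
   product into finite sums. *)
Record free_presentation (k : fieldType) (X : choiceType) := FreePresentation {
  fp_alg : algType k;
  fp_var : X -> fp_alg;
  fp_ind : forall P : fp_alg -> Prop,
    P 1 -> (forall x, P (fp_var x)) -> (forall g h, P g -> P h -> P (g * h)) ->
    (forall a g h, P g -> P h -> P (a *: g + h)) -> forall g, P g;
  fp_lift : forall (B : algType k) (f : X -> B),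
    exists h : {lrmorphism fp_alg -> B}, forall x, h (fp_var x) = f x
}.

HB.lock Definition free_malg_presentation (k : fieldType) (X : choiceType) :
    free_presentation k X :=
  @FreePresentation k X (free_malg k X) (fun x => mkmalgU (fmu x) 1)
    (@malg_ind k X)
    (fun B f => ex_intro _ (malg_lift f : {lrmorphism free_malg k X -> B})
       (malg_lift_var f)).

Definition free_alg (k : fieldType) (X : choiceType) : algType k :=
  fp_alg (free_malg_presentation k X).

Definition fvar {k : fieldType} {X : choiceType} (x : X) : free_alg k X :=
  fp_var (free_malg_presentation k X) x.

Definition alg_lift (k : fieldType) (X : choiceType) (B : algType k)
  (f : X -> B) : {lrmorphism free_alg k X -> B} :=
  sval (cid (fp_lift (free_malg_presentation k X) f)).

Section FreeAlgebraTheory.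
Variables (k : fieldType) (X : choiceType).

Lemma free_alg_ind (P : free_alg k X -> Prop) :
  P 1 -> (forall x, P (fvar x)) -> (forall g h, P g -> P h -> P (g * h)) ->
  (forall a g h, P g -> P h -> P (a *: g + h)) -> forall g, P g.
Proof. exact: fp_ind. Qed.

Lemma alg_lift_var (B : algType k) (f : X -> B) x : alg_lift f (fvar x) = f x.
Proof. exact: (svalP (cid (fp_lift (free_malg_presentation k X) f))). Qed.

Lemma alg_lift_unique (B : algType k) (f : X -> B)
    (h : {lrmorphism free_alg k X -> B}) :
  (forall x, h (fvar x) = f x) -> h =1 alg_lift f.
Proof.
move=> hf; apply: free_alg_ind => [|x|u v hu hv|a u v hu hv].
- by rewrite !rmorph1.
- by rewrite hf alg_lift_var.
- by rewrite !rmorphM /= hu hv.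
- by rewrite !linearP /= hu hv.
Qed.

End FreeAlgebraTheory.

Lemma tensor_lift_mul (k : fieldType) (A B C : algType k) (f : A -> B -> C) :
  is_bilinear f ->
  (forall a b a' b', f (a * a') (b * b') = f a b * f a' b') ->
  {morph tensor_lift f : s t / s * t}.
Proof.
move=> hf fM s t; elim/tensor_ind: s => [|a b|x y hx hy]; last first.
- by rewrite mulrDl !tensor_liftD // hx hy mulrDl.
- elim/tensor_ind: t => [|a' b'|x y hx hy]; last first.
  + by rewrite mulrDr !tensor_liftD // hx hy mulrDr.
  + by rewrite tensM !tensor_liftE.
  + by rewrite mulr0 tensor_lift0 // mulr0.
- by rewrite mul0r tensor_lift0 // mul0r.
Qed.

HB.mixin Record Algebra_isBialgebra (k : fieldType) B of GRing.Algebra k B := {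
  comul : B -> tensor B B;
  counit : B -> k;
  comul_linear : linear comul;
  comul_monoid : monoid_morphism comul;
  counit_scalar : scalar counit;
  counit_monoid : monoid_morphism counit;
  (* coassociativity, both sides read in [tensor (tensor B B) B] *)
  comulA : forall b : B,
    tensor_lift (fun x y => tensor_lift (fun y1 y2 => (x *t y1) *t y2) (comul y))
      (comul b) = tensor_lift (fun x y => comul x *t y) (comul b);
  counitl : forall b : B, tensor_lift (fun x y => counit x *: y) (comul b) = b;
  counitr : forall b : B, tensor_lift (fun x y => counit y *: x) (comul b) = b
}.

#[short(type="bialgType")]
HB.structure Definition Bialgebra (k : fieldType) :=
  {B of GRing.Algebra k B & Algebra_isBialgebra k B}.

HB.mixin Record Bialgebra_isHopf (k : fieldType) H of Bialgebra k H := {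
  antipode : H -> H;
  antipode_linear : linear antipode;
  antipodel : forall h : H,
    tensor_lift (fun x y => antipode x * y) (comul h) = counit h *: 1;
  antipoder : forall h : H,
    tensor_lift (fun x y => x * antipode y) (comul h) = counit h *: 1
}.

#[short(type="hopfAlgType")]
HB.structure Definition HopfAlgebra (k : fieldType) :=
  {H of Bialgebra k H & Bialgebra_isHopf k H}.

Section MatrixBialgebra.
Variables (k : fieldType) (n : nat).

Definition mx_bialg : Type := free_alg k ('I_n * 'I_n)%type.
HB.instance Definition _ := GRing.Algebra.on mx_bialg.

Definition mx_gen (i j : 'I_n) : mx_bialg := fvar (i, j).

Definition mx_comul : {lrmorphism mx_bialg -> tensor mx_bialg mx_bialg} :=
  alg_lift (fun p => \sum_(s < n) mx_gen p.1 s *t mx_gen s p.2).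
Definition mx_counit : {lrmorphism mx_bialg -> k^o} :=
  alg_lift (fun p => (p.1 == p.2)%:R).

Lemma mx_comul_gen i j :
  mx_comul (mx_gen i j) = \sum_s mx_gen i s *t mx_gen s j.
Proof. exact: alg_lift_var. Qed.
Lemma mx_counit_gen i j : mx_counit (mx_gen i j) = (i == j)%:R.
Proof. exact: alg_lift_var. Qed.

Lemma mx_bialg_ind (P : mx_bialg -> Prop) :
  P 1 -> (forall i j, P (mx_gen i j)) ->
  (forall g h, P g -> P h -> P (g * h)) ->
  (forall a g h, P g -> P h -> P (a *: g + h)) -> forall g, P g.
Proof. by move=> P1 PX PM PD; apply: free_alg_ind => // -[i j]; apply: PX. Qed.

Lemma mx_counitl b :
  tensor_lift (fun x y => (mx_counit x : k) *: y) (mx_comul b) = b.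
Proof.
have bil : is_bilinear (fun x y : mx_bialg => (mx_counit x : k) *: y).
  split=> [y a u v | x a u v]; first by rewrite linearP scalerDl scalerA.
  by rewrite scalerDr !scalerA mulrC.
elim/mx_bialg_ind: b => [|i j|g h Hg Hh|a g h Hg Hh].
- by rewrite rmorph1 -tens1 tensor_liftE // rmorph1 scale1r.
- rewrite mx_comul_gen (big_morph _ (tensor_liftD bil) (tensor_lift0 bil)).
  rewrite (bigD1 i) //= tensor_liftE // mx_counit_gen eqxx scale1r.
  rewrite big1 ?addr0 // => s si.
  by rewrite tensor_liftE // mx_counit_gen eq_sym (negPf si) scale0r.
- rewrite rmorphM tensor_lift_mul ?Hg ?Hh // => x y x' y'.
  by rewrite rmorphM -scalerAl -scalerAr scalerA.
- by rewrite linearP tensor_lift_linear // Hg Hh.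
Qed.

Lemma mx_counitr b :
  tensor_lift (fun x y => (mx_counit y : k) *: x) (mx_comul b) = b.
Proof.
have bil : is_bilinear (fun x y : mx_bialg => (mx_counit y : k) *: x).
  split=> [y a u v | x a u v]; last by rewrite linearP scalerDl scalerA.
  by rewrite scalerDr !scalerA mulrC.
elim/mx_bialg_ind: b => [|i j|g h Hg Hh|a g h Hg Hh].
- by rewrite rmorph1 -tens1 tensor_liftE // rmorph1 scale1r.
- rewrite mx_comul_gen (big_morph _ (tensor_liftD bil) (tensor_lift0 bil)).
  rewrite (bigD1 j) //= tensor_liftE // mx_counit_gen eqxx scale1r.
  rewrite big1 ?addr0 // => s si.
  by rewrite tensor_liftE // mx_counit_gen (negPf si) scale0r.
- rewrite rmorphM tensor_lift_mul ?Hg ?Hh // => x y x' y'.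
  by rewrite rmorphM -scalerAl -scalerAr scalerA.
- by rewrite linearP tensor_lift_linear // Hg Hh.
Qed.

Let in_bil (x : mx_bialg) :
  is_bilinear (fun y1 y2 : mx_bialg => (x *t y1) *t y2).
Proof.
split=> [y a u v | y a u v].
  by rewrite tensDr tensZr tensDl tensZl.
by rewrite tensDr tensZr.
Qed.

Let in_mul (x x' : mx_bialg) (s t : tensor mx_bialg mx_bialg) :
  tensor_lift (fun y1 y2 => ((x * x') *t y1) *t y2) (s * t) =
  tensor_lift (fun y1 y2 => (x *t y1) *t y2) s *
  tensor_lift (fun y1 y2 => (x' *t y1) *t y2) t.
Proof.
elim/tensor_ind: s => [|p q|p q hp hq].
- by rewrite mul0r !tensor_lift0 // mul0r.
- elim/tensor_ind: t => [|p' q'|p' q' hp' hq'].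
  + by rewrite mulr0 !tensor_lift0 // mulr0.
  + by rewrite tensM !tensor_liftE // !tensM.
  + by rewrite mulrDr !tensor_liftD // hp' hq' mulrDr.
- by rewrite mulrDl !tensor_liftD // hp hq mulrDl.
Qed.

Let l_bil : is_bilinear (fun x y : mx_bialg =>
  tensor_lift (fun y1 y2 => (x *t y1) *t y2) (mx_comul y)).
Proof.
split=> [y a u v | x a u v]; last by rewrite linearP tensor_lift_linear.
elim/tensor_ind: (mx_comul y) => [|p q|p q hp hq].
- by rewrite !tensor_lift0 // scaler0 addr0.
- by rewrite !tensor_liftE // !(tensDl, tensZl).
- by rewrite !tensor_liftD // hp hq scalerDr addrACA.
Qed.

Let r_bil : is_bilinear (fun x y : mx_bialg => mx_comul x *t y).
Proof.
split=> [y a u v | x a u v]; first by rewrite linearP tensDl tensZl.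
by rewrite tensDr tensZr.
Qed.

Lemma mx_comulA b :
  tensor_lift (fun x y => tensor_lift (fun y1 y2 => (x *t y1) *t y2) (mx_comul y))
    (mx_comul b) = tensor_lift (fun x y => mx_comul x *t y) (mx_comul b).
Proof.
elim/mx_bialg_ind: b => [|i j|g h Hg Hh|a g h Hg Hh].
- by rewrite rmorph1 -tens1 !tensor_liftE // rmorph1 -tens1 tensor_liftE.
- rewrite mx_comul_gen !(big_morph _ (tensor_liftD _) (tensor_lift0 _)) //.
  under eq_bigr => s _.
    rewrite tensor_liftE // mx_comul_gen.
    rewrite (big_morph _ (tensor_liftD (in_bil _)) (tensor_lift0 (in_bil _))).
    under eq_bigr => t _ do rewrite tensor_liftE //.
  over.
  rewrite exchange_big /=; apply: eq_bigr => t _.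
  rewrite tensor_liftE // mx_comul_gen.
  have D : {morph (fun u : tensor mx_bialg mx_bialg => u *t mx_gen t j) : u v / u + v}.
    by move=> u v; rewrite tensDl.
  by rewrite (big_morph _ D (tens0l _ _)).
- rewrite rmorphM !tensor_lift_mul ?Hg ?Hh //.
    by move=> x y x' y'; rewrite rmorphM tensM.
  by move=> x y x' y'; rewrite rmorphM in_mul.
- by rewrite linearP !tensor_lift_linear // Hg Hh.
Qed.

HB.instance Definition _ := Algebra_isBialgebra.Build k mx_bialg
  (linearP mx_comul) (rmorph1 mx_comul, rmorphM mx_comul)
  (linearP mx_counit) (rmorph1 mx_counit, rmorphM mx_counit)
  mx_comulA mx_counitl mx_counitr.

End MatrixBialgebra.

Section Ideals.
Variable R : pzRingType.
Implicit Types (I X : set R).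

Definition is_left_ideal I :=
  [/\ I 0, forall x y, I x -> I y -> I (x + y) & forall a x, I x -> I (a * x)].
Definition is_right_ideal I :=
  [/\ I 0, forall x y, I x -> I y -> I (x + y) & forall a x, I x -> I (x * a)].
Definition is_ideal I := is_left_ideal I /\ is_right_ideal I.

Definition ideal_gen X : set R :=
  [set x | forall I, is_ideal I -> X `<=` I -> I x].

Definition ascending_chain_condition (P : set (set R)) :=
  forall I : nat -> set R,
    (forall i, P (I i)) -> (forall i, I i `<=` I i.+1) ->
    exists m, forall i, (m <= i)%N -> I i = I m.

Definition noetherian :=
  ascending_chain_condition is_left_ideal /\
  ascending_chain_condition is_right_ideal.

End Ideals.

Definition lin_indep (k : fieldType) (V : lmodType k) (m : nat) (f : 'I_m -> V) :=
  forall c : 'I_m -> k, \sum_i c i *: f i = 0 -> forall i, c i = 0.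

Definition vdim (R : realType) (k : fieldType) (V : lmodType k) (U : set V) :
    \bar R :=
  ereal_sup [set (m%:R%:E : \bar R) | m in [set m : nat |
    exists f : 'I_m -> V, (forall i, U (f i)) /\ lin_indep f]].

Section GKdimension.
Variables (R : realType) (k : fieldType) (A : algType k).

(* k + V + ... + V^m *)
Definition power_filtration (V : set A) (m : nat) : set A :=
  lspan [set \prod_(v <- w) v | w in [set w : seq A |
    (size w <= m)%N /\ forall v, v \in w -> V v]].

(* sup over finite-dimensional subspaces V of
   limsup_m log dim (k + V + ... + V^m) / log m *)
Definition GKdim : \bar R :=
  ereal_sup [set limn_esup (fun m : nat =>
      (ln (fine (vdim R (power_filtration V m))) / ln m%:R)%:E)
    | V in [set lspan [set` s] | s in [set: seq A]]].

Definition finite_GKdim : Prop := (GKdim < +oo)%E.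

End GKdimension.

Section HopfNotions.
Variable k : fieldType.

Definition is_bialg_mor (B C : bialgType k) (f : B -> C) :=
  (forall b, comul (f b) = tensor_lift (fun x y => f x *t f y) (comul b)) /\
  (forall b, counit (f b) = counit b).

Definition is_hopf_mor (H K : hopfAlgType k) (f : H -> K) :=
  is_bialg_mor f /\ forall h, f (antipode h) = antipode (f h).

(* [p] identifies [B] with the quotient algebra [A / I] *)
Definition is_quotient (A B : algType k) (I : set A) (p : {lrmorphism A -> B}) :=
  (forall b, exists a, p a = b) /\ (forall a, p a = 0 <-> I a).

Definition grouplike (H : bialgType k) (g : H) :=
  comul g = g *t g /\ counit g = 1.

(* The second clause reads: comul h lies in I (x) H + H (x) I. *)
Definition is_hopf_ideal (H : hopfAlgType k) (I : set H) :=
  [/\ is_ideal I,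
      forall h, I h -> lspan [set t | exists x y, (I x \/ I y) /\ t = x *t y]
                         (comul h),
      forall h, I h -> counit h = 0
    & forall h, I h -> I (antipode h)].

Definition is_hopf_ideal_gen (H : hopfAlgType k) (X I : set H) :=
  [/\ is_hopf_ideal I, X `<=` I
    & forall J, is_hopf_ideal J -> X `<=` J -> I `<=` J].

(* [p] identifies [Q] with the quotient of [H] by the Hopf ideal generated
   by [X] *)
Definition is_hopf_quotient (H Q : hopfAlgType k) (X : set H)
    (p : {lrmorphism H -> Q}) :=
  is_hopf_mor p /\ exists2 I, is_hopf_ideal_gen X I & is_quotient I p.

Definition is_hopf_envelope (B : bialgType k) (H : hopfAlgType k)
    (iota : {lrmorphism B -> H}) :=
  is_bialg_mor iota /\
  forall (K : hopfAlgType k) (f : {lrmorphism B -> K}), is_bialg_mor f ->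
    exists g : {lrmorphism H -> K},
      [/\ is_hopf_mor g, g \o iota =1 f
        & forall g' : {lrmorphism H -> K},
            is_hopf_mor g' -> g' \o iota =1 f -> g' =1 g].

End HopfNotions.

Section QuantumGroups.
Variables (k : fieldType) (n : nat) (E : 'M[k]_n).

Definition relator : free_alg k 'I_n :=
  \sum_i \sum_j E i j *: (fvar i * fvar j).

Definition is_AnE (A : algType k) (p : {lrmorphism free_alg k 'I_n -> A}) :=
  is_quotient (ideal_gen [set relator]) p.

(* [d] ranges over the matrices orthogonal to [E] for the bilinear pairing
   sum_ij d_ij E_ij. *)
Definition OM_relators : set (mx_bialg k n) :=
  [set \sum_i \sum_j \sum_p \sum_q
         (E i j * d p q) *: (mx_gen k p i * mx_gen k q j)
   | d in [set d : 'M[k]_n | \sum_i \sum_j d i j * E i j = 0]].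

Definition is_OM (B : bialgType k) (p : {lrmorphism mx_bialg k n -> B}) :=
  is_bialg_mor p /\ is_quotient (ideal_gen OM_relators) p.

Definition coaction (H : algType k) (a : 'I_n -> 'I_n -> H) :
    {lrmorphism free_alg k 'I_n -> tensor (free_alg k 'I_n) H} :=
  alg_lift (fun i => \sum_s fvar s *t a s i).

Definition is_codeterminant (H : hopfAlgType k) (a : 'I_n -> 'I_n -> H) (D : H) :=
  grouplike D /\
  exists D' : H, [/\ D * D' = 1, D' * D = 1 & coaction a relator = relator *t D'].

Definition is_OGLc (H : hopfAlgType k) (D : H) (Q : hopfAlgType k)
    (p : {lrmorphism H -> Q}) :=
  is_hopf_quotient [set a * D - D * a | a in [set: H]] p.

Definition is_OSL (H : hopfAlgType k) (D : H) (Q : hopfAlgType k)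
    (p : {lrmorphism H -> Q}) :=
  is_hopf_mor p /\ is_quotient (ideal_gen [set D - 1]) p.

Definition is_mod_S2 (H Q : hopfAlgType k) (p : {lrmorphism H -> Q}) :=
  is_hopf_quotient [set antipode (antipode a) - a | a in [set: H]] p.

End QuantumGroups.

(* Main.v *)
From HB Require Import structures.
From mathcomp Require Import all_boot all_order all_algebra generic_quotient.
From mathcomp Require Import all_classical all_reals all_analysis.
From mathcomp Require Import zify ring.
Require Import Defs.

(** Every condition is compared with the value of [n].  Put [F = E^-1].

    The Hopf envelope has an explicit presentation ([envelope_presentation]):
    generators are the entries of a matrix [a] and elements [D], [D'], and the
    relations are [D D' = D' D = 1], [a E a^T = E D'] and [a^T D F a = F].  The
    second relation is the coaction on the quadratic relation of [A]; the third
    one says that the right inverse [E a^T D F] of [a] that it provides is also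
    the left inverse [S(a)].  Conversely the presented algebra is a Hopf algebra
    ([GL_hopf_exists]), in which [S^2(a) = D' Th a Th^-1 D] for [Th = E F^T], and
    the universal property makes the two Hopf algebras isomorphic.

    Let [n = 2].  Over an algebraically closed field there is a basis in which
    [E_00 = 0] ([isotropic_base_change]), hence [F_11 = 0].  Then the entries
    [a01], [a00], [a11], [a10] can be adjoined to [D] and [D'] one after the
    other so that each new variable [x] satisfies [x V <= V x + V V] and
    [V x <= x V + V V], where [V] is the span of 1 and of the earlier variables
    ([GL2_chain]).  This uses a column relation without [D] in the middle,
    [a^T H a = H D'], which holds with [H = F] when [D] is central or trivial and
    with [H = F^T] when [S^2] is the identity: these are the four quotients of the
    theorem.  In such a chain of extensions the ordered monomials span, which
    bounds the growth ([ordered_span_finite_GKdim]), and Hilbert's basis theorem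
    applies at each step, on both sides ([ordered_span_noetherian]).  The algebra
    [A] itself is a chain of two variables ([AnE_bounded]).

    Let [n >= 3].  Since each list of conditions on the four quotients includes
    one on [O(SL)], it is enough to see that [A] and [O(SL)] are neither
    noetherian nor of finite Gelfand-Kirillov dimension.  Both have a right module
    [K] with two elements [f] and [g] such that, for all [u] and [v] in [K], some
    [w] in [K] has [w f = u] and [w g = v].  If [f b + g c] annihilates [K], then
    so do [b] and [c]; modulo the annihilator of [K], therefore, [f] and [g] are
    right linearly independent, the right ideals generated by the
    [f^i g] for [i < m] grow strictly with [m], and the [2^m] words of length [m]
    in [f] and [g] are linearly independent ([wild_quotient]).  For [A] the module
    consists of functions on words that the quadratic relation kills, on which
    [v_s] acts by removing a first letter [s].  For [O(SL)] it consists of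
    functions of two words, one for [E] and one for [F]: on functions of
    one word there are, besides the operators [X_s] that remove a letter,
    operators [Y_s] ([lower]) satisfying relations with them that are dual to
    those of the [X_s], and [a_sj] acts by [X_s X_j - lam Y_s Y_j], where
    [lam^2 + tr(E^T F) lam + 1 = 0] ([contract_biact_row],
    [contract_biact_col]).  That two values can be prescribed simultaneously is
    where [n >= 3] enters ([dual_extend], [bidual_onto]). *)

Set Implicit Arguments.
Unset Strict Implicit.
Unset Printing Implicit Defensive.
Import Order.TTheory GRing.Theory Num.Theory.
Local Open Scope classical_set_scope.
Local Open Scope ring_scope.

(** * Hilbert's basis theorem for almost normalizing extensions *)

Definition is_subring (T : pzRingType) (R : set T) :=
  [/\ R 1, forall x y, R x -> R y -> R (x - y)
    & forall x y, R x -> R y -> R (x * y)].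

Definition left_ideal_in (T : pzRingType) (R J : set T) :=
  [/\ J `<=` R, J 0, forall x y, J x -> J y -> J (x + y)
    & forall a x, R a -> J x -> J (a * x)].

Definition left_noetherian_in (T : pzRingType) (R : set T) :=
  ascending_chain_condition (left_ideal_in R).

Section HilbertStep.
Variables (T : pzRingType) (R : set T) (x : T).
Hypothesis sR : is_subring R.
Hypothesis comm_xr : forall r, R r ->
  exists r1 r2, [/\ R r1, R r2 & x * r = r1 * x + r2].
Hypothesis comm_rx : forall r, R r ->
  exists r1 r2, [/\ R r1, R r2 & r * x = x * r1 + r2].

Let R0 : R 0.
Proof. by case: sR => R1 RB _; rewrite -(subrr 1); apply: RB. Qed.
Let RN a : R a -> R (- a).
Proof. by case: sR => _ RB _ Ra; rewrite -sub0r; apply: RB. Qed.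
Let RD a b : R a -> R b -> R (a + b).
Proof. by case: sR => _ RB _ Ra Rb; rewrite -[b]opprK; apply: RB => //; apply: RN. Qed.

(** Coefficients stand on the right of the powers of [x], so that the leading
    coefficients of a left ideal form a left ideal. *)
Definition poly_lt (m : nat) : set T :=
  [set t | exists c : nat -> T, (forall i, R (c i)) /\ t = \sum_(i < m) x ^+ i * c i].

Lemma poly_lt0 m : poly_lt m 0.
Proof. by exists (fun=> 0); split=> //; rewrite big1 // => i _; rewrite mulr0. Qed.

Lemma poly_ltD m s t : poly_lt m s -> poly_lt m t -> poly_lt m (s + t).
Proof.
move=> [c [Rc ->]] [d [Rd ->]]; exists (fun i => c i + d i); split=> [i|].
  exact: RD.
by rewrite -big_split; apply: eq_bigr => i _; rewrite mulrDr.
Qed.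

Lemma poly_ltN m t : poly_lt m t -> poly_lt m (- t).
Proof.
move=> [c [Rc ->]]; exists (fun i => - c i); split=> [i|]; first exact: RN.
by rewrite -sumrN; apply: eq_bigr => i _; rewrite mulrN.
Qed.

Lemma poly_lt_mono m r i : (i < m)%N -> R r -> poly_lt m (x ^+ i * r).
Proof.
move=> im Rr; exists (fun j => if j == i then r else 0); split=> [j|].
  by case: ifP.
rewrite (bigD1 (Ordinal im)) //= eqxx big1 ?addr0 // => j ji.
by rewrite ifN ?mulr0 //.
Qed.

Lemma poly_ltW m p t : (m <= p)%N -> poly_lt m t -> poly_lt p t.
Proof.
move=> mp [c [Rc ->]]; elim/big_rec: _ => [|i y _ hy]; first exact: poly_lt0.
apply: poly_ltD hy; apply: poly_lt_mono; last exact: Rc.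
exact: leq_trans (ltn_ord i) mp.
Qed.

Lemma poly_lt_mulx m t : poly_lt m t -> poly_lt m.+1 (x * t).
Proof.
move=> [c [Rc ->]]; rewrite mulr_sumr.
elim/big_rec: _ => [|i y _ hy]; first exact: poly_lt0.
apply: poly_ltD => //; rewrite mulrA -exprS; apply: poly_lt_mono => //.
exact: ltn_ord.
Qed.

Lemma poly_lt_mulr m t r : R r -> poly_lt m t -> poly_lt m (t * r).
Proof.
move=> Rr [c [Rc ->]]; rewrite mulr_suml.
elim/big_rec: _ => [|i y _ hy]; first exact: poly_lt0.
by apply: poly_ltD => //; rewrite -mulrA; apply: poly_lt_mono; [exact: ltn_ord | case: sR => _ _; apply].
Qed.

Lemma poly_lt_mulrx m t : poly_lt m t -> poly_lt m.+1 (t * x).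
Proof.
move=> [c [Rc ->]]; rewrite mulr_suml.
elim/big_rec: _ => [|i y _ hy]; first exact: poly_lt0.
apply: poly_ltD => //; have [r1 [r2 [R1 R2 e]]] := comm_rx (Rc i).
rewrite -mulrA e mulrDr mulrA -exprSr; apply: poly_ltD; apply: poly_lt_mono => //.
  exact: ltn_ord.
exact: ltnW (ltn_ord i).
Qed.

(** Moving a coefficient across [x] costs an element of [R], so moving it across a
    power of [x] costs terms of lower degree. *)
Lemma commXn_r m r : R r -> exists2 r1, R r1 & poly_lt m (r * x ^+ m - x ^+ m * r1).
Proof.
move=> Rr; elim: m => [|m [r1 R1 h]].
  by exists r => //; rewrite mulr1 mul1r subrr; apply: poly_lt0.
have [r2 [r3 [R2 R3 e]]] := comm_rx R1; exists r2 => //.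
have := poly_ltD (poly_lt_mulrx h) (poly_lt_mono (leqnn m.+1) R3).
by rewrite mulrBl -!mulrA e mulrDr -exprSr opprD addrA subrK mulrA -exprSr.
Qed.

Lemma comm_rXn m r : R r -> exists2 r1, R r1 & poly_lt m (r1 * x ^+ m - x ^+ m * r).
Proof.
elim: m r => [|m IH] r Rr.
  by exists r => //; rewrite mulr1 mul1r subrr; apply: poly_lt0.
have [r1 [r2 [R1 R2 e]]] := comm_xr Rr; have [r3 R3 h] := IH _ R1.
exists r3 => //; have := poly_ltD (poly_lt_mulrx h) (poly_ltN (poly_lt_mono (leqnn m.+1) R2)).
by rewrite mulrBl -mulrA -exprSr -addrA -opprD -mulrA -mulrDr -e mulrA -exprSr.
Qed.

Lemma poly_lt_mull m t r : R r -> poly_lt m t -> poly_lt m (r * t).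
Proof.
move=> Rr [c [Rc ->]]; rewrite mulr_sumr.
elim/big_rec: _ => [|i y _ hy]; first exact: poly_lt0.
apply: poly_ltD => //; have [r1 R1 h] := commXn_r i Rr.
rewrite mulrA -[r * _](subrK (x ^+ i * r1)) mulrDl; apply: poly_ltD.
  by apply: (@poly_ltW i); [apply/ltnW/ltn_ord | apply: poly_lt_mulr].
by rewrite -mulrA; apply: poly_lt_mono; [exact: ltn_ord | case: sR => _ _; apply].
Qed.

Variable R' : set T.
Hypothesis sR' : is_subring R'.
Hypothesis RR' : R `<=` R'.
Hypothesis R'x : R' x.
Hypothesis R'gen : forall t, R' t -> exists m, poly_lt m t.

Definition lead m (J : set T) : set T :=
  [set r | R r /\ exists2 f, J f & poly_lt m (f - x ^+ m * r)].

Lemma lead_ideal m J : left_ideal_in R' J -> left_ideal_in R (lead m J).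
Proof.
move=> [JR' J0 JD JM]; split=> [r []//| |r s [Rr [f Jf hf]] [Rs [g Jg hg]]|a r Ra [Rr [f Jf hf]]].
- by split=> //; exists 0 => //; rewrite mulr0 subr0; apply: poly_lt0.
- split; first exact: RD; exists (f + g); first exact: JD.
  by rewrite mulrDr opprD addrACA; apply: poly_ltD.
- have Rar : R (a * r) by case: sR => _ _; apply.
  split=> //; have [b Rb h] := comm_rXn m Ra; exists (b * f); first by apply: JM => //; apply: RR'.
  have := poly_ltD (poly_lt_mull Rb hf) (poly_lt_mulr Rr h).
  by rewrite mulrBr mulrBl !mulrA subrKA.
Qed.

Lemma leadS m J : left_ideal_in R' J -> lead m J `<=` lead m.+1 J.
Proof.
move=> [_ _ _ JM] r [Rr [f Jf hf]]; split=> //; exists (x * f); first exact: JM.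
by have := poly_lt_mulx hf; rewrite mulrBr mulrA -exprS.
Qed.

Lemma leadW m p J : left_ideal_in R' J -> (m <= p)%N -> lead m J `<=` lead p J.
Proof.
move=> hJ /subnK <-; elim: (p - m)%N => // k IH r hr.
by rewrite addSn; apply: leadS => //; apply: IH.
Qed.

Lemma lead_sub m J K : J `<=` K -> lead m J `<=` lead m K.
Proof. by move=> JK r [Rr [f Jf hf]]; split=> //; exists f => //; apply: JK. Qed.

(** By induction on the degree: subtracting from an element of [K] one of [J]
    with the same leading term leaves an element of [K] of smaller degree. *)
Lemma ideal_lead_eq J K : left_ideal_in R' J -> left_ideal_in R' K ->
  J `<=` K -> (forall m, lead m K `<=` lead m J) -> K `<=` J.
Proof.
move=> hJ hK JK hlead f Kf; have [JR' J0 JD JM] := hJ; have [KR' K0 KD KM] := hK.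
have [m] := R'gen (KR' _ Kf); elim: m f Kf => [|m IH] f Kf.
  by move=> [c [_ ->]]; rewrite big_ord0.
move=> [c [Rc ef]]; have h0 : poly_lt m (f - x ^+ m * c m).
  by rewrite ef big_ord_recr /= addrK; exists c.
have : lead m K (c m) by split=> //; exists f.
move/hlead => [_ [g Jg hg]]; rewrite -(subrK g f); apply: (JD) => //; apply: IH.
  have R'N1 : R' (-1) by case: sR' => R1 RB _; rewrite -sub0r; apply: (RB) => //; rewrite -(subrr 1); apply: RB.
  by apply: KD => //; rewrite -mulN1r; apply: KM => //; apply: JK.
by have := poly_ltD h0 (poly_ltN hg); rewrite opprB addrA subrK.
Qed.

(** Hilbert's argument with coefficients on the right: the leading coefficients
    of a left ideal in each degree form a left ideal of [R] that grows with the
    degree, because left multiplication by [x] only shifts them. *)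
Lemma hilbert_step : left_noetherian_in R -> left_noetherian_in R'.
Proof.
move=> nR J hJ JS.
have JW i j : (i <= j)%N -> J i `<=` J j.
  move=> /subnK <-; elim: (j - i)%N => // d IH t ht.
  by rewrite addSn; apply: JS; apply: IH.
have [i0 hi0] : exists i0, forall i, (i0 <= i)%N -> lead i (J i) = lead i0 (J i0).
  apply: (nR (fun i => lead i (J i))) => [i|i]; first exact: lead_ideal.
  by move=> r /(lead_sub (JS i)) /(leadW (hJ _) (leqnSn i)).
have hm m : exists im, forall i, (im <= i)%N -> lead m (J i) = lead m (J im).
  by apply: (nR (fun i => lead m (J i))) => i; [apply: lead_ideal|apply: lead_sub].
pose im m := sval (cid (hm m)).
pose N := maxn i0 (\max_(m < i0) im m); exists N => i Ni.
apply/seteqP; split; last exact: JW.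
apply: ideal_lead_eq => //; first exact: JW.
move=> m; have [i0m|mi0] := leqP i0 m.
  have leN p : (N <= p)%N -> lead m (J p) = lead i0 (J i0).
    move=> Np; have i0p : (i0 <= p)%N by apply: leq_trans Np; apply: leq_maxl.
    apply/seteqP; split.
      rewrite -(hi0 (maxn m p)); last by rewrite leq_max i0m.
      apply: subset_trans (leadW (hJ _) (leq_maxl m p)).
      exact/lead_sub/JW/leq_maxr.
    apply: subset_trans (leadW (hJ _) i0m).
    exact/lead_sub/JW.
  by rewrite (leN i) // (leN N).
have imN : (im m <= N)%N.
  by rewrite leq_max (leq_bigmax (Ordinal mi0)) orbT.
have him := svalP (cid (hm m)); rewrite -/(im m) in him.
by rewrite (him i) ?(him N) // (leq_trans imN).
Qed.

End HilbertStep.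

(** * Filtrations by ordered monomials *)

Section Filtration.
Variables (k : fieldType) (T : algType k).
Implicit Types (x y z t : T) (xs ws : seq T) (Phi : nat -> set T).

Record is_filtration Phi := IsFiltration {
  filtration_subspace : forall N, is_subspace (Phi N);
  filtrationS : forall N, Phi N `<=` Phi N.+1;
  filtration1 : Phi 0%N 1;
  filtrationM : forall M N s t, Phi M s -> Phi N t -> Phi (M + N)%N (s * t)
}.

Lemma filtration_le Phi M N : is_filtration Phi -> (M <= N)%N -> Phi M `<=` Phi N.
Proof.
move=> hF /subnK <-; elim: (N - M)%N => // d IH t ht.
by rewrite addSn; apply: filtrationS => //; apply: IH.
Qed.

(** Commuting past [y] costs only terms free of [y], one degree higher. *)
Definition almost_normal y Phi N t :=
  [/\ Phi N t,
      exists a b, [/\ Phi N a, Phi N.+1 b & y * t = a * y + b]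
    & exists a b, [/\ Phi N a, Phi N.+1 b & t * y = y * a + b]].

Section AlmostNormal.
Variables (y : T) (Phi : nat -> set T).
Hypothesis hF : is_filtration Phi.
Let hS N := filtration_subspace hF N.

Lemma almost_normalW N t : almost_normal y Phi N t -> almost_normal y Phi N.+1 t.
Proof.
move=> [ht [a [b [ha hb e]]] [c [d [hc hd e']]]]; split; first exact: filtrationS.
- by exists a, b; split=> //; apply: filtrationS.
- by exists c, d; split=> //; apply: filtrationS.
Qed.

Lemma almost_normal_le M N t : (M <= N)%N ->
  almost_normal y Phi M t -> almost_normal y Phi N t.
Proof.
move=> /subnK <-; elim: (N - M)%N => // d IH ht.
by rewrite addSn; apply: almost_normalW; apply: IH.
Qed.

Lemma almost_normal_scalar c : almost_normal y Phi 0%N (c *: 1).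
Proof.
have h1 : Phi 0%N (c *: 1) by apply: subspaceZ => //; apply: filtration1.
split=> //; exists (c *: 1), 0; (split=> //; first exact: (hS _).1).
  by rewrite addr0 -scalerAl -scalerAr mul1r mulr1.
by rewrite addr0 -scalerAl -scalerAr mul1r mulr1.
Qed.

Lemma almost_normalD N s t : almost_normal y Phi N s -> almost_normal y Phi N t ->
  almost_normal y Phi N (s + t).
Proof.
move=> [hs [a [b [ha hb e]]] [c [d [hc hd e']]]].
move=> [ht [a1 [b1 [ha1 hb1 e1]]] [c1 [d1 [hc1 hd1 e1']]]].
split; first exact: subspaceD.
- exists (a + a1), (b + b1); split; try exact: subspaceD.
  by rewrite mulrDr e e1 mulrDl addrACA.
- exists (c + c1), (d + d1); split; try exact: subspaceD.
  by rewrite mulrDl e' e1' mulrDr addrACA.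
Qed.

Lemma almost_normalM M N s t : almost_normal y Phi M s -> almost_normal y Phi N t ->
  almost_normal y Phi (M + N) (s * t).
Proof.
move=> [hs [a [b [ha hb e]]] [c [d [hc hd e']]]].
move=> [ht [a1 [b1 [ha1 hb1 e1]]] [c1 [d1 [hc1 hd1 e1']]]].
split; first exact: filtrationM.
- exists (a * a1), (a * b1 + b * t); split; first exact: filtrationM.
    apply: subspaceD => //; first by rewrite -addnS; apply: filtrationM.
    by rewrite -addSn; apply: filtrationM.
  by rewrite mulrA e mulrDl -mulrA e1 mulrDr !mulrA addrA.
- exists (c * c1), (d * c1 + s * d1); split; first exact: filtrationM.
    apply: subspaceD => //; first by rewrite -addSn; apply: filtrationM.
    by rewrite -addnS; apply: filtrationM.
  by rewrite -mulrA e1' mulrDr mulrA e' mulrDl !mulrA addrA.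
Qed.

End AlmostNormal.

(** The head of the list is the variable adjoined last, and it stands on the
    left in the ordered monomials. *)
Fixpoint ordered_span xs (N : nat) : set T :=
  if xs is x :: xs' then
    [set t | exists c : nat -> T,
      (forall i, (i <= N)%N -> ordered_span xs' (N - i) (c i)) /\
      t = \sum_(i < N.+1) x ^+ i * c i]
  else [set c *: 1 | c in [set: k]].

Lemma ordered_span_subspace xs N : is_subspace (ordered_span xs N).
Proof.
elim: xs N => [|x xs IH] N /=.
  split; first by exists 0; rewrite ?scale0r.
  move=> a _ _ [c _ <-] [d _ <-]; exists (a * c + d) => //.
  by rewrite scalerDl scalerA.
split.
  exists (fun=> 0); split; first by move=> i _; apply: (IH _).1.
  by rewrite big1 // => i _; rewrite mulr0.
move=> a _ _ [c [hc ->]] [d [hd ->]]; exists (fun i => a *: c i + d i).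
split; first by move=> i iN; apply: (IH _).2; [apply: hc | apply: hd].
rewrite scaler_sumr -big_split; apply: eq_bigr => i _.
by rewrite mulrDr -scalerAr.
Qed.

Lemma ordered_span_mono x xs N i c : (i <= N)%N -> ordered_span xs (N - i) c ->
  ordered_span (x :: xs) N (x ^+ i * c).
Proof.
move=> iN hc; exists (fun j => if j == i then c else 0); split.
  move=> j jN; case: eqP => [->//|_]; exact: (ordered_span_subspace _ _).1.
have iN' : (i < N.+1)%N by [].
rewrite (bigD1 (Ordinal iN')) //= eqxx big1 ?addr0 // => j ji.
by rewrite ifN ?mulr0 //.
Qed.

Lemma ordered_span_cons x xs N : ordered_span xs N `<=` ordered_span (x :: xs) N.
Proof.
by move=> t ht; rewrite -[t]mul1r -(expr0 x); apply: ordered_span_mono; rewrite ?subn0.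
Qed.

(** The condition is on generators only; [ordered_span_almost_normal] extends
    it to all elements that the earlier variables span. *)
Fixpoint almost_normal_chain xs : Prop :=
  if xs is x :: xs' then
    almost_normal_chain xs' /\
    forall y, y \in xs' -> almost_normal x (ordered_span xs') 1 y
  else True.

Lemma ordered_span_almost_normal y Phi ws : is_filtration Phi ->
  (forall z, z \in ws -> almost_normal y Phi 1 z) ->
  forall N t, ordered_span ws N t -> almost_normal y Phi N t.
Proof.
move=> hF; elim: ws => [|w ws IH] hws N t /=.
  move=> [c _ <-]; apply: (@almost_normal_le _ _ hF 0) => //.
  exact: almost_normal_scalar.
move=> [c [hc ->]].
have hw i : almost_normal y Phi i (w ^+ i).
  elim: i => [|i IHi]; first by rewrite -[w ^+ 0]scale1r; apply: almost_normal_scalar.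
  rewrite exprS -add1n; apply: almost_normalM => //.
  by apply: hws; rewrite mem_head.
have IH' : forall N t, ordered_span ws N t -> almost_normal y Phi N t.
  by apply: IH => z zw; apply: hws; rewrite inE zw orbT.
have h0 : almost_normal y Phi N 0.
  rewrite -[0](scale0r 1); apply: (@almost_normal_le _ _ hF 0) => //.
  exact: almost_normal_scalar.
elim/big_rec: _ => // i u _ hu; apply: almost_normalD => //.
have iN : (i <= N)%N by rewrite -ltnS ltn_ord.
move: (nat_of_ord i) iN => j jN; have := almost_normalM hF (hw j) (IH' _ _ (hc j jN)).
by rewrite subnKC.
Qed.

(** To put a product in order, variables are moved to the left past earlier
    ones.  The terms in which the moved variable disappears gain one degree in the
    earlier ones, so that the total degree does not increase. *)
Lemma ordered_span_filtration xs :
  almost_normal_chain xs -> is_filtration (ordered_span xs).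
Proof.
elim: xs => [_|x xs IH [hch hx]].
  split=> [N|N t //||M N _ _ [c _ <-] [d _ <-]] /=.
  - exact: (ordered_span_subspace [::] N).
  - by exists 1 => //; rewrite scale1r.
  - by exists (c * d) => //; rewrite -scalerAl mul1r scalerA.
have hF := IH hch.
have hn := ordered_span_almost_normal hF hx.
have hS N := ordered_span_subspace (x :: xs) N.
have leS N : ordered_span (x :: xs) N `<=` ordered_span (x :: xs) N.+1.
  move=> _ [c [hc ->]]; elim/big_rec: _ => [|i u _ hu]; first exact: (hS _).1.
  apply: subspaceD => //; have iN : (i <= N)%N by rewrite -ltnS ltn_ord.
  apply: ordered_span_mono; first exact: leqW.
  by rewrite subSn //; apply: filtrationS => //; apply: hc.
have mulx N t : ordered_span (x :: xs) N t -> ordered_span (x :: xs) N.+1 (x * t).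
  move=> [c [hc ->]]; rewrite mulr_sumr; elim/big_rec: _ => [|i u _ hu]; first exact: (hS _).1.
  apply: subspaceD => //; have iN : (i <= N)%N by rewrite -ltnS ltn_ord.
  by rewrite mulrA -exprS; apply: ordered_span_mono; rewrite ?subSS //; apply: hc.
have mulXn i N t : ordered_span (x :: xs) N t ->
    ordered_span (x :: xs) (i + N) (x ^+ i * t).
  elim: i => [|i IHi] ht; first by rewrite mul1r.
  by rewrite exprS -mulrA addSn; apply/mulx/IHi.
have mulc i M N r c : ordered_span xs M r -> ordered_span xs N c ->
    ordered_span (x :: xs) (M + i + N) (r * (x ^+ i * c)).
  elim: i M r => [|i IHi] M r hr hc.
    by rewrite mul1r addn0; apply: ordered_span_cons; apply: filtrationM.
  have [_ _ [a [b [ha hb e]]]] := hn _ _ hr.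
  rewrite exprS -mulrA mulrA e mulrDl -mulrA; apply: subspaceD => //.
    by rewrite addnS addSn; apply/mulx/IHi.
  by rewrite addnS -addSn; apply: IHi.
split=> //; first by apply: ordered_span_cons; apply: filtration1.
move=> M N _ t [c [hc ->]] ht; rewrite mulr_suml.
elim/big_rec: _ => [|i u _ hu]; first exact: (hS _).1.
apply: subspaceD => //; have iM : (i <= M)%N by rewrite -ltnS ltn_ord.
rewrite -mulrA; move: (nat_of_ord i) iM => {u hu} {}i iM.
have -> : (M + N = i + (M - i + N))%N by rewrite addnA subnKC.
apply: mulXn; case: ht => d [hd ->]; rewrite mulr_sumr.
elim/big_rec: _ => [|j v _ hv]; first exact: (hS _).1.
apply: subspaceD => //; have jN : (j <= N)%N by rewrite -ltnS ltn_ord.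
move: (nat_of_ord j) jN => {v hv} {}j jN.
have -> : (M - i + N = M - i + j + (N - j))%N by rewrite -addnA subnKC.
by apply: mulc; [apply: hc | apply: hd].
Qed.

Definition ordered_subring xs : set T := [set t | exists N, ordered_span xs N t].

Lemma ordered_subring_is_subring xs :
  almost_normal_chain xs -> is_subring (ordered_subring xs).
Proof.
move=> /ordered_span_filtration hF; split.
- by exists 0%N; apply: filtration1.
- move=> s t [M hs] [N ht]; exists (M + N)%N.
  have hS := ordered_span_subspace xs (M + N).
  apply: subspaceD => //; last apply: subspaceN => //.
    by apply: filtration_le hs => //; apply: leq_addr.
  by apply: filtration_le ht => //; apply: leq_addl.
- by move=> s t [M hs] [N ht]; exists (M + N)%N; apply: filtrationM.
Qed.

Lemma converse_subring (R : set T) : is_subring R -> @is_subring T^c R.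
Proof. by move=> [R1 RB RM]; split=> // s t Rs Rt; apply: RM. Qed.

(** Meant for the scalars, where a nonzero element generates everything. *)
Lemma scalars_left_noetherian (T' : pzRingType) (R : set T') :
  (forall J, left_ideal_in R J -> forall u v, J u -> u != 0 -> R v -> J v) ->
  left_noetherian_in R.
Proof.
move=> hR J hJ JS.
have JW i j : (i <= j)%N -> J i `<=` J j.
  move=> /subnK <-; elim: (j - i)%N => // d IH t ht.
  by rewrite addSn; apply: JS; apply: IH.
have [[i [u [Ju u0]]]|nJ] := pselect (exists i u, J i u /\ u != 0).
  exists i => j ij; apply/seteqP; split=> [v Jv|]; last exact: JW.
  by apply: (hR _ (hJ i) _ _ Ju u0); case: (hJ j) => + _ _ _; apply.
exists 0%N => j _; apply/seteqP; split=> [v Jv|]; last exact: JW.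
have [->|v0] := eqVneq v 0; first by case: (hJ 0%N).
by case: nJ; exists j, v.
Qed.

(** The hypotheses of [hilbert_step] are symmetric, so it applies to the converse
    ring as well; only the normal form has to be turned around there, with the
    coefficients on the other side of the powers of [x]. *)
Lemma ordered_subring_noetherian xs : almost_normal_chain xs ->
  left_noetherian_in (ordered_subring xs) /\
  @left_noetherian_in T^c (ordered_subring xs).
Proof.
elim: xs => [_|x xs IH hch].
  split; apply: scalars_left_noetherian => J [JR J0 JD JM] _ _ /[dup] /JR [_ [c _ <-]] Ju u0 [_ [d _ <-]].
    have -> : d *: (1 : T) = ((d / c) *: 1) * (c *: 1).
      rewrite -scalerAl mul1r scalerA mulfVK //.
      by apply: contra u0 => /eqP ->; rewrite scale0r.
    by apply: JM => //; exists 0%N, (d / c).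
  have -> : d *: (1 : T) = (c *: 1) * ((d / c) *: 1).
    rewrite -scalerAr mulr1 scalerA mulfVK //.
    by apply: contra u0 => /eqP ->; rewrite scale0r.
  by apply: (JM (_ : T^c)) => //; exists 0%N, (d / c).
have [hchx hx] := hch; have [IHl IHr] := IH hchx.
have hF := ordered_span_filtration hchx.
have hn := ordered_span_almost_normal hF hx.
have sR := ordered_subring_is_subring hchx.
have sR' := ordered_subring_is_subring hch.
have cxr r : ordered_subring xs r -> exists r1 r2,
    [/\ ordered_subring xs r1, ordered_subring xs r2 & x * r = r1 * x + r2].
  by move=> [N /hn [_ [a [b [ha hb e]]] _]]; exists a, b; split=> //; [exists N|exists N.+1].
have crx r : ordered_subring xs r -> exists r1 r2,
    [/\ ordered_subring xs r1, ordered_subring xs r2 & r * x = x * r1 + r2].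
  by move=> [N /hn [_ _ [a [b [ha hb e]]]]]; exists a, b; split=> //; [exists N|exists N.+1].
have RR' : ordered_subring xs `<=` ordered_subring (x :: xs).
  by move=> t [N ht]; exists N; apply: ordered_span_cons.
have R'x : ordered_subring (x :: xs) x.
  exists 1%N; have := @ordered_span_mono x xs 1 1 1 isT (filtration1 hF).
  by rewrite expr1 mulr1.
have gen t : ordered_subring (x :: xs) t -> exists m, poly_lt (ordered_subring xs) x m t.
  move=> [N [c [hc ->]]]; exists N.+1.
  exists (fun i => if (i <= N)%N then c i else 0); split.
    move=> i; case: ifP => [iN|_]; first by exists (N - i)%N; apply: hc.
    by exists 0%N; apply: (ordered_span_subspace _ _).1.
  by apply: eq_bigr => i _; rewrite -ltnS ltn_ord.
split; first exact: (hilbert_step sR cxr crx sR' RR' R'x gen).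
apply: (@hilbert_step T^c (ordered_subring xs) x (converse_subring sR) crx cxr) => //.
  exact: converse_subring.
move=> t /gen [m [c [hc ->]]]; exists m.
elim/big_rec: _ => [|i u _ hu]; first by apply: (@poly_lt0 T^c); first exact: converse_subring.
apply: (@poly_ltD T^c) => //; first exact: converse_subring.
apply: (@poly_ltW T^c _ _ (converse_subring sR) i.+1); first exact: ltn_ord.
have [r1 R1 h] := @commXn_r T^c _ _ (converse_subring sR) cxr i _ (hc i).
have := @poly_ltD T^c _ _ (converse_subring sR) _ _ _
  (@poly_ltW T^c _ _ (converse_subring sR) _ _ _ (leqnSn i) h)
  (@poly_lt_mono T^c _ _ (converse_subring sR) i.+1 r1 i (ltnSn i) R1).
by rewrite subrK revrX.
Qed.

Lemma ordered_span_noetherian xs : almost_normal_chain xs ->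
  (forall t, ordered_subring xs t) -> noetherian T.
Proof.
move=> hch hall; have [hl hr] := ordered_subring_noetherian hch; split.
  move=> J hJ JS; apply: hl => // i; have [J0 JD JM] := hJ i.
  by split=> // a t _; apply: JM.
move=> J hJ JS; apply: hr => // i; have [J0 JD JM] := hJ i.
by split=> // a t _; apply: JM.
Qed.

End Filtration.

(** * Dimension and growth *)

Section SpanDim.
Variables (k : fieldType) (V : lmodType k).
Implicit Types (s : seq V) (U : set V).

Lemma lspan_seqP s v :
  lspan [set` s] v -> exists c : 'I_(size s) -> k, v = \sum_j c j *: s`_j.
Proof.
move=> h; apply: (h [set v | exists c : 'I_(size s) -> k, v = \sum_j c j *: s`_j]); last first.
  move=> x /= xs; have ix : (index x s < size s)%N by rewrite index_mem.
  exists (fun j => (j == Ordinal ix)%:R); rewrite (bigD1 (Ordinal ix)) //= eqxx.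
  by rewrite scale1r nth_index // big1 ?addr0 // => j /negPf ->; rewrite scale0r.
split; first by exists (fun=> 0); rewrite big1 // => j _; rewrite scale0r.
move=> a _ _ [c ->] [d ->]; exists (fun j => a * c j + d j).
rewrite scaler_sumr -big_split; apply: eq_bigr => j _.
by rewrite scalerDl scalerA.
Qed.

(** The coordinates of the [f i] along [s] form a matrix with more rows than
    columns when [m] is too large, and a kernel vector is a linear relation. *)
Lemma lin_indep_le m (f : 'I_m -> V) s :
  (forall i, lspan [set` s] (f i)) -> lin_indep f -> (m <= size s)%N.
Proof.
move=> hf hi; rewrite leqNgt; apply/negP => sm.
have /choice [C hC] : forall i, exists c : 'I_(size s) -> k, f i = \sum_j c j *: s`_j.
  by move=> i; apply: lspan_seqP.
pose M : 'M[k]_(m, size s) := \matrix_(i, j) C i j.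
have : kermx M != 0.
  rewrite kermx_eq0; apply/negP => /eqP rM.
  by have := rank_leq_col M; rewrite rM leqNgt sm.
move/rowV0Pn => [u /sub_kermxP uM] u0; case/negP: u0; apply/eqP/rowP => i.
rewrite mxE; apply: (hi (fun i => u 0 i)).
under eq_bigr => i' _ do rewrite hC scaler_sumr.
rewrite exchange_big big1 //= => j _.
under eq_bigr => i' _ do rewrite scalerA.
rewrite -scaler_suml; have /rowP /(_ j) := uM; rewrite !mxE => e.
rewrite -[X in X *: _]/(\sum_i' u 0 i' * C i' j) -[RHS](scale0r s`_j); congr (_ *: _).
by rewrite -[RHS]e; apply: eq_bigr => i' _; rewrite mxE.
Qed.

Lemma lspan_sub U X : is_subspace U -> X `<=` U -> lspan X `<=` U.
Proof. by move=> hU hX v; apply. Qed.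

Lemma vdim_le (R : realType) U s :
  U `<=` lspan [set` s] -> (vdim R U <= (size s)%:R%:E)%E.
Proof.
move=> hU; apply: ge_ereal_sup => _ [m [f [hf hi]] <-].
rewrite lee_fin ler_nat; apply: lin_indep_le hi => i; exact: hU.
Qed.

Lemma vdim_ge (R : realType) U m (f : 'I_m -> V) :
  (forall i, U (f i)) -> lin_indep f -> (m%:R%:E <= vdim R U)%E.
Proof. by move=> hf hi; apply: ereal_sup_ubound; exists m => //; exists f. Qed.

Lemma fine_vdim_le (R : realType) U s :
  U `<=` lspan [set` s] -> 0 <= fine (vdim R U) <= (size s)%:R.
Proof.
move=> hU; have := vdim_le R hU.
have h0 : (0%:E <= vdim R U)%E.
  have := @vdim_ge R U 0 (fun=> 0); rewrite mulr0n; apply; first by case.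
  by move=> c _ [].
by case: (vdim R U) h0 => [r||] //=; rewrite !lee_fin => -> ->.
Qed.

Lemma fine_vdim_ge (R : realType) U s m (f : 'I_m -> V) :
  U `<=` lspan [set` s] -> (forall i, U (f i)) -> lin_indep f ->
  m%:R <= fine (vdim R U).
Proof.
move=> hU hf hi; have := vdim_le R hU; have := vdim_ge R hf hi.
by case: (vdim R U) => [r||] //=; rewrite !lee_fin.
Qed.

End SpanDim.

Section Growth.
Variables (R : realType) (k : fieldType) (T : algType k).
Implicit Types (xs : seq T).

Lemma leqX2r m p e : (m <= p)%N -> (m ^ e <= p ^ e)%N.
Proof. by case: e => // e; rewrite leq_exp2r. Qed.

Lemma ordered_span_spanned xs N : exists s : seq T,
  (size s <= N.+1 ^ size xs)%N /\ ordered_span xs N `<=` lspan [set` s].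
Proof.
elim: xs N => [|x xs IH] N /=.
  exists [:: 1]; split=> // _ [c _ <-]; apply: (subspaceZ _ (lspan_subspace _)).
  by apply: sub_lspan; rewrite /= mem_head.
have /choice [S hS] := IH.
exists (flatten [seq [seq x ^+ i * y | y <- S (N - i)%N] | i <- iota 0 N.+1]); split.
  have szS i : (size (S i) <= i.+1 ^ size xs)%N by case: (hS i).
  rewrite size_flatten /shape -map_comp sumnE big_map.
  apply: (@leq_trans (\sum_(i <- iota 0 N.+1) N.+1 ^ size xs)).
    apply: leq_sum => i _; rewrite /= size_map; apply: leq_trans (szS _) _.
    by apply: leqX2r; rewrite ltnS leq_subr.
  by rewrite big_const_seq count_predT size_iota iter_addn_0 expnS mulnC.
move=> _ [c [hc ->]]; elim/big_rec: _ => [|i u _ hu]; first exact: (lspan_subspace _).1.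
apply: (subspaceD (lspan_subspace _)) => //.
have iN : (i <= N)%N by rewrite -ltnS ltn_ord.
have [_ /(_ _ (hc _ iN)) h] := hS (N - i)%N.
apply: (h [set z | lspan _ (x ^+ i * z)]) => [|y /= yS].
  split; rewrite /= ?mulr0; first exact: (lspan_subspace _).1.
  move=> a v w hv hw /=; rewrite mulrDr -scalerAr.
  by apply: (lspan_subspace _).2.
apply: sub_lspan; change (x ^+ i * y \in flatten [seq [seq x ^+ i * y | y <- S (N - i)%N] | i <- iota 0 N.+1]); apply/flattenP; exists [seq x ^+ i * y | y <- S (N - i)%N].
  by apply: (map_f (fun i => [seq x ^+ i * y | y <- S (N - i)%N])); rewrite mem_iota.
exact: (map_f (fun y => x ^+ i * y)).
Qed.

Lemma power_filtration_sub Phi (V : set T) M m : is_filtration Phi -> V `<=` Phi M ->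
  power_filtration V m `<=` Phi (M * m)%N.
Proof.
move=> hF hV; apply: lspan_sub; first exact: filtration_subspace.
move=> _ [w [wm hw] <-].
have : Phi (M * size w)%N (\prod_(v <- w) v).
  elim: w {wm} hw => [|v w IH] hw; first by rewrite big_nil muln0; apply: filtration1.
  rewrite big_cons mulnS; apply: filtrationM => //.
    by apply: hV; apply: hw; rewrite mem_head.
  by apply: IH => u uw; apply: hw; rewrite inE uw orbT.
by apply: filtration_le => //; rewrite leq_mul2l wm orbT.
Qed.

(** There are at most [(N + 1) ^ d] ordered monomials of degree at most [N].  A
    finite-dimensional space lies in some degree [M], so its [m]-th power has
    dimension at most [(M m + 1) ^ d], and this is at most [m ^ (2 d)] as soon as
    [m >= M + 2]. *)
Lemma ordered_span_finite_GKdim xs : almost_normal_chain xs ->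
  (forall t, ordered_subring xs t) -> finite_GKdim R T.
Proof.
move=> hch hall; have hF := ordered_span_filtration hch.
set d := size xs.
apply: (@le_lt_trans _ _ (2 * d)%:R%:E); last by rewrite ltry.
apply: ge_ereal_sup => _ [_ [s _ <-] <-].
have [M hM] : exists M, lspan [set` s] `<=` ordered_span xs M.
  elim: s => [|x s [M hM]].
    by exists 0%N; apply: lspan_sub => //; exact: ordered_span_subspace.
  have [N hN] := hall x; exists (M + N)%N; apply: lspan_sub.
    exact: ordered_span_subspace.
  move=> y /=; rewrite inE => /orP[/eqP ->|ys].
    by apply: filtration_le hN => //; apply: leq_addl.
  apply: (filtration_le hF (leq_addr N M)); apply: hM; exact: sub_lspan.
rewrite /limn_esup limf_esupE.
pose F m := (ln (fine (vdim R (power_filtration (lspan [set` s]) m))) / ln (m%:R : R))%:E.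
apply: (@le_trans _ _ (ereal_sup (F @` [set m | (M.+2 <= m)%N]))).
  apply: ereal_inf_lbound; exists [set m | (M.+2 <= m)%N] => //; first by exists M.+2.
apply: ge_ereal_sup => _ [m /= mM <-]; rewrite lee_fin.
have [L [sL hL]] := ordered_span_spanned xs (M * m).
have h := subset_trans (power_filtration_sub (m := m) hF hM) hL.
have /andP[v0 vL] := fine_vdim_le R h.
have m1 : (1 < m)%N by apply: leq_trans mM.
have lnm : 0 < ln (m%:R : R) by rewrite ln_gt0 // ltr1n.
rewrite ler_pdivrMr //; move: v0; rewrite le_eqVlt => /orP[/eqP <-|v0].
  by rewrite ln0 // mulr_ge0 // ltW.
have bound : (size L <= m ^ (2 * d))%N.
  apply: (leq_trans sL); rewrite expnM; apply: leqX2r.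
  rewrite -mulnn (leq_trans _ (leq_mul mM (leqnn m))) // !mulSn -addn1 addnC.
  by rewrite leq_add // ?(leq_trans _ m1) // addnC leq_addr.
apply: (@le_trans _ _ (ln ((m ^ (2 * d))%:R : R))).
  rewrite ler_ln ?posrE //; last by rewrite ltr0n expn_gt0 ltnW.
  by rewrite (le_trans vL) // ler_nat.
by rewrite natrX lnXn ?mulr_natl // ltr0n ltnW.
Qed.

End Growth.

(** * Pairs generating a free right ideal *)

Section FreePair.
Variables (R : realType) (k : fieldType) (T : algType k) (I : set T) (f g : T).
Hypotheses (idI : is_ideal I) (I1 : ~ I 1).
Hypothesis fg_free : forall b c, I (f * b + g * c) -> I b /\ I c.

Let I0 : I 0. Proof. by case: idI => [[]]. Qed.
Let IMl a b : I b -> I (a * b). Proof. by case: idI => [[_ _]] + _; apply. Qed.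

Lemma free_pair_powers m (c : nat -> T) u :
  I (\sum_(i < m) f ^+ i * (g * c i) + f ^+ m * u) -> I u.
Proof.
elim: m c => [|m IH] c; first by rewrite big_ord0 add0r mul1r.
rewrite big_ord_recl expr0 mul1r -addrA addrC.
under eq_bigr => i _ do rewrite lift0 exprS -mulrA.
rewrite -mulr_sumr exprS -mulrA -mulrDr => /fg_free [h _].
exact: (IH (fun i => c i.+1)).
Qed.

(** The right ideals generated by [f ^+ i * g] for [i < m] form a strictly
    increasing sequence. *)
Lemma free_pair_not_noetherian : ~ noetherian T.
Proof.
move=> [_ nT].
pose J m : set T := [set t | exists c : nat -> T, t = \sum_(i < m) f ^+ i * (g * c i)].
have [m|m t [c ->]|m hm] := nT J.
- split.
  + by exists (fun=> 0); rewrite big1 // => i _; rewrite !mulr0.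
  + move=> _ _ [c ->] [d ->]; exists (fun i => c i + d i).
    by rewrite -big_split; apply: eq_bigr => i _; rewrite !mulrDr.
  + move=> a _ [c ->]; exists (fun i => c i * a).
    by rewrite mulr_suml; apply: eq_bigr => i _; rewrite !mulrA.
- exists (fun i => if (i < m)%N then c i else 0).
  rewrite big_ord_recr /= ltnn !mulr0 addr0; apply: eq_bigr => i _.
  by rewrite ltn_ord.
have : J m.+1 (f ^+ m * g).
  exists (fun i => (i == m)%:R); rewrite big_ord_recr /= eqxx mulr1 big1 ?add0r // => i _.
  by rewrite ltn_eqF // !mulr0.
rewrite hm ?leqnSn // => -[c e].
have : I (- g).
  by apply: (@free_pair_powers m c); rewrite mulrN e subrr.
rewrite -[- g]add0r -{1}(mulr0 f) -[g]mulr1 -mulrN => /fg_free [_].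
by move=> /(IMl (-1)); rewrite mulrNN mulr1.
Qed.

(** The binary digits of [i < 2 ^ m] choose the letters of the word. *)
Fixpoint free_word m i : T :=
  if m is m'.+1 then
    if (i < 2 ^ m')%N then f * free_word m' i else g * free_word m' (i - 2 ^ m')%N
  else 1.

(** Words are separated by their first letter, using that [f] and [g] are
    right independent modulo [I]. *)
Lemma free_word_indep m (c : nat -> k) :
  I (\sum_(0 <= i < 2 ^ m) c i *: free_word m i) ->
  forall i, (i < 2 ^ m)%N -> c i = 0.
Proof.
elim: m c => [|m IH] c.
  rewrite big_nat1 /= => h i; rewrite ltnS leqn0 => /eqP ->.
  apply/eqP; apply: contra_notT I1 => c0.
  by have := IMl ((c 0%N)^-1 *: 1) h; rewrite -scalerAl mul1r scalerA mulVf ?scale1r.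
rewrite expnS mul2n -addnn (@big_cat_nat _ _ _ (2 ^ m)) ?leq_addr //=.
rewrite [X in X + _](_ : _ = f * \sum_(0 <= i < 2 ^ m) c i *: free_word m i); last first.
  by rewrite mulr_sumr; apply: eq_big_nat => i /andP[_ ->]; rewrite scalerAr.
rewrite [X in _ + X](_ : _ = g * \sum_(0 <= i < 2 ^ m) c (i + 2 ^ m)%N *: free_word m i);
  last first.
  rewrite mulr_sumr -{1}[(2 ^ m)%N]add0n big_addn addnK; apply: eq_big_nat => i _.
  by rewrite ltnNge leq_addl /= addnK scalerAr.
move=> /fg_free [/IH h1 /(IH (fun i => c (i + 2 ^ m)%N)) h2] i.
have [/h1 //|le] := ltnP i (2 ^ m) => hi.
by rewrite -(subnK le); apply: h2; rewrite ltn_subLR.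
Qed.

Lemma free_word_power m i : power_filtration (lspan [set` [:: f; g]]) m (free_word m i).
Proof.
have [hf hg] : lspan [set` [:: f; g]] f /\ lspan [set` [:: f; g]] g.
  by split; apply: sub_lspan; rewrite /= !inE eqxx ?orbT.
suff [w [sw hw ->]] : exists w, [/\ size w = m, forall v, v \in w -> lspan [set` [:: f; g]] v
    & free_word m i = \prod_(v <- w) v].
  by apply: sub_lspan; exists w => //; rewrite /= sw.
elim: m i => [|m IH] i; first by exists [::]; rewrite big_nil.
rewrite /=; case: ifP => _.
  have [w [sw hw ->]] := IH i; exists (f :: w); rewrite /= sw big_cons; split=> // v.
  by rewrite inE => /orP[/eqP ->|/hw].
have [w [sw hw ->]] := IH (i - 2 ^ m)%N; exists (g :: w); rewrite /= sw big_cons; split=> // v.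
by rewrite inE => /orP[/eqP ->|/hw].
Qed.

Lemma power_filtration_spanned (s : seq T) m : exists L : seq T,
  power_filtration (lspan [set` s]) m `<=` lspan [set` L].
Proof.
elim: m => [|m [L hL]].
  exists [:: 1]; apply: lspan_sub; first exact: lspan_subspace.
  move=> _ [w [+ _] <-]; rewrite leqn0 size_eq0 => /eqP ->; rewrite big_nil.
  by apply: sub_lspan; rewrite /= mem_head.
exists (1 :: [seq x * y | x <- s, y <- L]); apply: lspan_sub; first exact: lspan_subspace.
move=> _ [[|v w] [/= hs hw] <-]; first by rewrite big_nil; apply: sub_lspan; rewrite /= mem_head.
rewrite big_cons; set S := lspan [set` (1 :: _)]; have hS : is_subspace S by exact: lspan_subspace.
have /hL : power_filtration (lspan [set` s]) m (\prod_(u <- w) u).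
  by apply: sub_lspan; exists w => //; split=> // u uw; apply: hw; rewrite inE uw orbT.
have hv : lspan [set` s] v by apply: hw; rewrite mem_head.
move: (\prod_(_ <- _) _) => t ht.
apply: (ht [set t | S (v * t)]) => [|y /= yL].
  split; rewrite /= ?mulr0; first exact: hS.1.
  by move=> a p q hp hq /=; rewrite mulrDr -scalerAr; apply: hS.2.
apply: (hv [set v | S (v * y)]) => [|x /= xs].
  split; rewrite /= ?mul0r; first exact: hS.1.
  by move=> a p q hp hq /=; rewrite mulrDl -scalerAl; apply: hS.2.
apply: sub_lspan => /=; rewrite inE; apply/orP; right.
by apply/allpairsP; exists (x, y).
Qed.

(** The space of words of length [m] has dimension at least [2 ^ m].  At [m = 2 ^ j]
    the quotient of logarithms is at least [2 ^ j / j >= j], which is unbounded. *)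
Lemma free_pair_infinite_GKdim : ~ finite_GKdim R T.
Proof.
apply/negP; rewrite -leNgt leye_eq; apply/eqP.
pose V := lspan [set` [:: f; g]].
pose F m := (ln (fine (vdim R (power_filtration V m))) / ln (m%:R : R))%:E.
have hGK : (limn_esup F <= GKdim R T)%E.
  by apply: ereal_sup_ubound; exists V => //; exists [:: f; g].
apply/eqP; rewrite -leye_eq; apply: le_trans hGK; rewrite leye_eq; apply/eqP.
rewrite /limn_esup limf_esupE; apply/eqP; rewrite -leye_eq.
apply: le_ereal_inf_tmp => _ [W [N _ hN] <-].
rewrite leye_eq; apply/eqP/eqyP => A A0.
pose j := maxn (maxn N 4) (Num.bound A).
have Nj : (N <= j)%N by rewrite !leq_max leqnn.
have j4 : (4 <= j)%N by rewrite !leq_max leqnn orbT.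
have Aj : A <= j%:R.
  apply: le_trans (ltW (archi_boundP (ltW A0))) _.
  by rewrite ler_nat leq_maxr.
have jj : (j * j <= 2 ^ j)%N.
  rewrite -(subnKC j4); elim: (j - 4)%N => // i.
  by rewrite addnS expnS; move: (2 ^ (4 + i))%N => X; nia.
have W2 : W (2 ^ j)%N by apply: hN => /=; apply: leq_trans Nj _; apply/ltnW/ltn_expl.
apply: ereal_sup_ge; exists (F (2 ^ j)%N); first by exists (2 ^ j)%N.
rewrite lee_fin; apply: le_trans Aj _.
have j0 : (0 < j)%N by apply: leq_trans j4.
have ln2 : 0 < ln (2%:R : R) by rewrite ln_gt0 // ltr1n.
rewrite natrX lnXn ?ltr0n // -[ln _ *+ _]mulr_natl ler_pdivlMr ?mulr_gt0 ?ltr0n //.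
have [L hL] := power_filtration_spanned [:: f; g] (2 ^ j).
set m := (2 ^ j)%N.
have hind : lin_indep (fun i : 'I_(2 ^ m) => free_word m i).
  move=> c hc i.
  have h := @free_word_indep m (fun i => if insub i is Some i' then c i' else 0).
  rewrite -[c i]/(if Some i is Some i' then c i' else 0) -(valK i); apply: h; last exact: ltn_ord.
  rewrite big_mkord; under eq_bigr => i' _ do rewrite valK.
  by rewrite hc.
have hd := fine_vdim_ge R hL (@free_word_power m) hind.
apply: (@le_trans _ _ (ln ((2 ^ m)%:R : R))); last first.
  rewrite ler_ln // posrE; last by rewrite (lt_le_trans _ hd) // ltr0n expn_gt0.
  by rewrite ltr0n expn_gt0.
rewrite natrX lnXn ?ltr0n // -[ln _ *+ _]mulr_natl mulrA ler_pM2r // -natrM ler_nat.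
exact: jj.
Qed.

End FreePair.

(** * Functions on words *)

Section Contraction.
Variables (k : fieldType) (n : nat) (V : lmodType k).
Implicit Types (F : 'M[k]_n) (f g : 'I_n -> 'I_n -> V).

Definition contract F f : V := \sum_s \sum_t F s t *: f s t.

Lemma eq_contract F f g : (forall s t, f s t = g s t) -> contract F f = contract F g.
Proof. by move=> e; apply: eq_bigr => s _; apply: eq_bigr => t _; rewrite e. Qed.

Lemma contractD F f g :
  contract F (fun s t => f s t + g s t) = contract F f + contract F g.
Proof.
rewrite /contract -big_split; apply: eq_bigr => s _; rewrite -big_split.
by apply: eq_bigr => t _; rewrite scalerDr.
Qed.

Lemma contractZ F a f : contract F (fun s t => a *: f s t) = a *: contract F f.
Proof.
rewrite /contract scaler_sumr; apply: eq_bigr => s _; rewrite scaler_sumr.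
by apply: eq_bigr => t _; rewrite !scalerA mulrC.
Qed.

Lemma contract_mulr F (G : 'M[k]_n) (f : 'I_n -> V) u :
  contract F (fun s t => G t u *: f s) = \sum_s (F *m G) s u *: f s.
Proof.
apply: eq_bigr => s _; rewrite mxE scaler_suml.
by apply: eq_bigr => t _; rewrite scalerA.
Qed.

Lemma contract_mull F (G : 'M[k]_n) (f : 'I_n -> V) u :
  contract F (fun s t => G u s *: f t) = \sum_t (G *m F) u t *: f t.
Proof.
rewrite /contract exchange_big; apply: eq_bigr => t _; rewrite mxE scaler_suml.
by apply: eq_bigr => s _; rewrite scalerA mulrC.
Qed.

Lemma sum_id_mx (f : 'I_n -> V) u : \sum_s (1%:M : 'M[k]_n) s u *: f s = f u.
Proof.
rewrite (bigD1 u) //= mxE eqxx scale1r big1 ?addr0 // => s su.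
by rewrite mxE (negPf su) scale0r.
Qed.

Lemma sum_id_mx' (f : 'I_n -> V) u : \sum_s (1%:M : 'M[k]_n) u s *: f s = f u.
Proof. by rewrite -[RHS]sum_id_mx; apply: eq_bigr => s _; rewrite !mxE eq_sym. Qed.

Lemma contract_scalar F (a : 'I_n -> 'I_n -> k) v :
  contract F (fun s t => a s t *: v) = (\sum_s \sum_t F s t * a s t) *: v.
Proof.
rewrite scaler_suml; apply: eq_bigr => s _; rewrite scaler_suml.
by apply: eq_bigr => t _; rewrite scalerA.
Qed.

End Contraction.

Lemma linear_pack (k : fieldType) (V W : lmodType k) (h : V -> W) :
  linear h -> exists H : {linear V -> W}, h = H.
Proof.
by move=> hlin; exists (HB.pack h (GRing.isLinear.Build _ _ _ _ h hlin) : {linear V -> W}).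
Qed.

Lemma contract_linear (k : fieldType) (n : nat) (V W : lmodType k) (F : 'M[k]_n)
  (h : V -> W) f : linear h -> h (contract F f) = contract F (fun s t => h (f s t)).
Proof.
move=> /linear_pack [H ->]; rewrite /contract linear_sum; apply: eq_bigr => s _.
by rewrite linear_sum; apply: eq_bigr => t _; rewrite linearZ.
Qed.

Section Words.
Variables (k : fieldType) (n : nat) (F E : 'M[k]_n) (xi : 'I_n -> k) (lam : k).

Let word := seq 'I_n.

(** The vectors [xi] will be isotropic for [F], and [zeta] is then a linear form
    vanishing at [xi]; [theta] is the trace of [E^T *m F]. *)
Definition zeta : 'rV[k]_n := \row_s \sum_t F s t * xi t.
Definition theta := \sum_s \sum_t F s t * E s t.

Section Values.
Variable V : lmodType k.
Implicit Types (phi psi : word -> V).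

(** The functionals, with values in [V], on the free algebra modulo the
    two-sided ideal of the relation [\sum_(s, t) F s t x_s x_t] and the left
    ideal of [zeta - 1]: a right module over the algebra with that relation. *)
Definition is_dual phi :=
  (forall u v, contract F (fun s t => phi (u ++ [:: s, t & v])) = 0) /\
  (forall u, \sum_s zeta 0 s *: phi (rcons u s) = phi u).

Definition shift (s : 'I_n) phi : word -> V := fun w => phi (s :: w).

(** With [X_s = shift s] and [Y_s = lower s], the recursion says that
    [shift t (lower s phi) = lam *: lower t (shift s phi) + E s t *: phi].  On dual
    functions this forces the other relations below as soon as [lam] is a root of [lam ^ 2 + theta lam + 1] and the
    initial value [xi] is isotropic. *)
Fixpoint lower (s : 'I_n) phi (w : word) : V :=
  match w with
  | [::] => xi s *: phi [::]
  | t :: w' => lam *: lower t (shift s phi) w' + E s t *: phi w'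
  end.

Lemma eq_lower s phi psi w : (forall u, (size u <= size w)%N -> phi u = psi u) ->
  lower s phi w = lower s psi w.
Proof.
elim: w s phi psi => [|t w IH] s phi psi e /=; first by rewrite e.
by rewrite (IH t _ (shift s psi)) ?e // => u uw; apply: e; rewrite ltnS.
Qed.

Lemma lower_linear s a phi psi w :
  lower s (fun u => a *: phi u + psi u) w = a *: lower s phi w + lower s psi w.
Proof.
elim: w s phi psi => [|t w IH] s phi psi /=.
  by rewrite scalerDr !scalerA mulrC.
rewrite [X in lam *: X](IH t (shift s phi) (shift s psi)) !scalerDr !scalerA addrACA.
by rewrite ![a * _]mulrC.
Qed.

Lemma lower0 s w : lower s (fun=> 0) w = 0.
Proof.
elim: w s => [|t w IH] s /=; first by rewrite scaler0.
by rewrite (IH t : lower t (shift s (fun=> 0)) w = 0) !scaler0 addr0.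
Qed.

Lemma lower_contract u G (phi : 'I_n -> 'I_n -> word -> V) w :
  lower u (fun w => contract G (fun s t => phi s t w)) w =
  contract G (fun s t => lower u (phi s t) w).
Proof.
elim: w u phi => [|v w IH] u phi /=; first by rewrite contractZ.
rewrite contractD !contractZ; congr (_ *: _ + _).
exact: (IH v (fun s t => shift u (phi s t))).
Qed.

Lemma lower_in (U : set V) s phi w : is_subspace U ->
  (forall u, U (phi u)) -> U (lower s phi w).
Proof.
move=> hU; elim: w s phi => [|t w IH] s phi h /=; first exact: subspaceZ.
by apply: hU.2; [apply: IH => u; apply: h | apply: subspaceZ].
Qed.

Lemma dual_linear a phi psi : is_dual phi -> is_dual psi ->
  is_dual (fun w => a *: phi w + psi w).
Proof.
move=> [h1 h2] [h1' h2']; split=> [u v|u].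
  by rewrite contractD contractZ h1 h1' scaler0 addr0.
rewrite -[in RHS]h2 -[in RHS]h2' scaler_sumr -big_split; apply: eq_bigr => s _.
by rewrite scalerDr !scalerA mulrC.
Qed.

Lemma dual0 : is_dual (fun=> 0).
Proof.
split=> [u v|u].
  by rewrite /contract big1 // => s _; rewrite big1 // => t _; rewrite scaler0.
by rewrite big1 // => s _; rewrite scaler0.
Qed.

Lemma dual_sum (I : Type) (r : seq I) (a : I -> k) (phi : I -> word -> V) :
  (forall i, is_dual (phi i)) -> is_dual (fun w => \sum_(i <- r) a i *: phi i w).
Proof.
move=> h; elim: r => [|i r IH].
  by rewrite (_ : (fun w => _) = fun=> 0) ?funeqE => [|w]; [exact: dual0|rewrite big_nil].
rewrite (_ : (fun w => _) = fun w => a i *: phi i w + \sum_(j <- r) a j *: phi j w).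
  exact: dual_linear.
by rewrite funeqE => w; rewrite big_cons.
Qed.

Lemma eq_dual phi psi : (forall w, phi w = psi w) -> is_dual phi -> is_dual psi.
Proof. by move=> /funext ->. Qed.

Lemma dual_shift s phi : is_dual phi -> is_dual (shift s phi).
Proof. by move=> [h1 h2]; split=> [u v|u]; [apply: (h1 (s :: u))|apply: (h2 (s :: u))]. Qed.

Hypotheses (FE : F *m E = 1%:M) (EF : E *m F = 1%:M).
Hypothesis lamP : lam ^+ 2 + theta * lam + 1 = 0.
Hypothesis xiP : \sum_s \sum_t F s t * (xi s * xi t) = 0.

(** At the empty word this is the normalisation of dual functions by [zeta]. *)
Lemma contract_lower_shift phi : is_dual phi -> forall w,
  contract F (fun s t => lower t (shift s phi) w) = phi w.
Proof.
move=> hphi; have [h1 h2] := hphi; case=> [|u w] /=.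
  rewrite -[RHS](h2 [::]); apply: eq_bigr => s _; rewrite mxE scaler_suml.
  by apply: eq_bigr => t _; rewrite scalerA.
rewrite contractD contractZ contract_mulr FE sum_id_mx.
rewrite -(@lower_contract u F (fun s t => shift t (shift s phi))).
rewrite (@eq_lower _ _ (fun=> 0)) => [|v _]; last exact: (h1 [::]).
by rewrite lower0 scaler0 add0r.
Qed.

Lemma contract_shift_lower phi : is_dual phi -> forall w,
  contract F (fun s t => shift t (lower s phi) w) = (lam + theta) *: phi w.
Proof.
move=> hphi w; rewrite /shift /= contractD contractZ contract_lower_shift //.
by rewrite contract_scalar scalerDl.
Qed.

Lemma contract_lower_lower phi : is_dual phi -> forall w,
  contract F (fun s t => lower t (lower s phi) w) = 0.
Proof.
move=> hphi; case=> [|u w] /=.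
  have -> : contract F (fun s t => xi t *: (xi s *: phi [::])) =
            contract F (fun s t => (xi s * xi t) *: phi [::]).
    by apply: eq_contract => s t; rewrite scalerA mulrC.
  by rewrite contract_scalar xiP scale0r.
rewrite contractD contractZ contract_mulr FE sum_id_mx.
rewrite -(@lower_contract u F (fun s t => shift t (lower s phi))).
rewrite (@eq_lower _ _ (fun w => (lam + theta) *: phi w + 0)) => [|v _]; last first.
  by rewrite addr0; apply: contract_shift_lower.
rewrite (lower_linear u _ phi (fun=> 0)) lower0.
rewrite addr0 scalerA -[X in _ + X]scale1r -scalerDl.
have -> : lam * (lam + theta) + 1 = 0 by rewrite -lamP; ring.
by rewrite scale0r.
Qed.

(** The relation inserted at the front of a word is where the equation of [lam]
    is used; inside a word, the induction hypothesis applies. *)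
Lemma dual_lower s phi : is_dual phi -> is_dual (lower s phi).
Proof.
move=> hphi; split=> [u v|u].
  elim: u s phi hphi => [|a u IH] s phi hphi /=; last first.
    rewrite contractD !contractZ IH ?scaler0 ?add0r; last exact: dual_shift.
    by have [h1 _] := hphi; rewrite h1 scaler0.
  rewrite contractD contractZ contract_mull EF sum_id_mx'.
  have -> : contract F (fun t t' => lower t (shift s phi) (t' :: v)) =
            (lam + theta) *: phi (s :: v).
    exact: (contract_shift_lower (dual_shift s hphi)).
  rewrite scalerA -[X in _ + X]scale1r -scalerDl.
  have -> : lam * (lam + theta) + 1 = 0 by rewrite -lamP; ring.
  by rewrite scale0r.
elim: u s phi hphi => [|a u IH] s phi hphi /=; last first.
  under eq_bigr => t _ do rewrite scalerDr !scalerA ![zeta 0 t * _]mulrC -!scalerA.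
  rewrite big_split /= -!scaler_sumr IH; last exact: dual_shift.
  by have [_ h2] := hphi; rewrite h2.
under eq_bigr => t _ do rewrite scalerDr.
rewrite big_split /=.
under eq_bigr => t _ do rewrite !scalerA.
under [X in _ + X]eq_bigr => t _ do rewrite scalerA.
rewrite -!scaler_suml.
have -> : \sum_i zeta 0 i * lam * xi i = 0.
  have -> : \sum_i zeta 0 i * lam * xi i = lam * \sum_s \sum_t F s t * (xi s * xi t).
    rewrite mulr_sumr; apply: eq_bigr => i _; rewrite mxE mulr_suml mulr_sumr mulr_suml.
    by apply: eq_bigr => t _; ring.
  by rewrite xiP mulr0.
have -> : \sum_i zeta 0 i * E s i = xi s.
  transitivity (\sum_t (E *m F) s t * xi t).
    under eq_bigr => i _ do rewrite mxE mulr_suml.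
    rewrite exchange_big; apply: eq_bigr => t _; rewrite mxE mulr_suml.
    by apply: eq_bigr => i _; ring.
  by rewrite EF; apply: (@sum_id_mx' k n k^o xi s).
by rewrite scale0r add0r.
Qed.

End Values.

Lemma lower_map (V W : lmodType k) (g : V -> W) : linear g ->
  forall s phi w, lower s (fun u => g (phi u)) w = g (lower s phi w).
Proof.
move=> /linear_pack [G ->] s phi w; elim: w s phi => [|t w IH] s phi /=; first by rewrite linearZ.
by rewrite linearD !linearZ (IH t (shift s phi)).
Qed.

Lemma dual_map (V W : lmodType k) (g : V -> W) phi : linear g -> is_dual phi ->
  is_dual (fun w => g (phi w)).
Proof.
move=> hg [h1 h2]; split=> [u v|u].
  rewrite -contract_linear // h1; have [G ->] := linear_pack hg; exact: linear0.
have [G ->] := linear_pack hg; rewrite -[in RHS]h2 linear_sum; apply: eq_bigr => s _.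
by rewrite linearZ.
Qed.

(** * Prescribing values of dual functions *)

Section Solve.
Hypotheses (n_ge3 : (2 < n)%N) (EF : E *m F = 1%:M) (zeta0 : zeta != 0).

(** Over a field, a vector outside the line of [b] is detected by a linear form
    that vanishes on this line. *)
Lemma separating_col (a b : 'rV[k]_n) : ~~ (a <= b)%MS ->
  exists g : 'cV[k]_n, a *m g = 1%:M /\ b *m g = 0.
Proof.
rewrite submxE => /eqP /matrixP h.
have [j hj] : exists j, (a *m cokermx b) 0 j != 0.
  apply: contrapT => nj; apply: h => i j; rewrite ord1 [RHS]mxE.
  by apply/eqP; apply: contrapT => /negP hj; apply: nj; exists j.
set x := (a *m _) 0 j in hj.
exists (x^-1 *: col j (cokermx b)); split.
  apply/matrixP => i i'; rewrite !ord1 -scalemxAr colE mulmxA -colE !mxE eqxx /=.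
  by have := mulVf hj; rewrite /x mxE.
by rewrite -scalemxAr colE mulmxA mulmx_coker mul0mx; apply/matrixP => i i'; rewrite !mxE mulr0.
Qed.

(** The vectors orthogonal to [c] are not covered by the two proper subspaces
    of those orthogonal to [zeta] and of those that [F] maps to multiples of
    [zeta]; the second one is a line at most, whence the bound on [n]. *)
Lemma solve_vectors_exist (c : 'rV[k]_n) : exists gh : 'cV[k]_n * 'rV[k]_n,
  ~~ (c <= zeta)%MS ->
  [/\ c *m gh.1 = 1%:M /\ zeta *m gh.1 = 0, gh.2 *m c^T = 0, gh.2 *m zeta^T = 1%:M
    & ~~ (gh.2 *m F <= zeta)%MS].
Proof.
have [|hc] := boolP (c <= zeta)%MS; first by exists (0, 0).
have [g [g1 g2]] := separating_col hc.
have [h1 [h1z h1c]] : exists h : 'cV_n, zeta *m h = 1%:M /\ c *m h = 0.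
  apply: separating_col; apply: contra hc => /sub_rVP [a e].
  have a0 : a != 0 by apply: contra zeta0 => /eqP a0; rewrite e a0 scale0r.
  by apply/sub_rVP; exists a^-1; rewrite e scalerA mulVf ?scale1r.
have [h2 [h2c h2F]] : exists h : 'rV_n, h *m c^T = 0 /\ ~~ (h *m F <= zeta)%MS.
  apply: contrapT => nh.
  have : (kermx c^T *m F <= zeta)%MS.
    apply/row_subP => i; rewrite row_mul; apply: contrapT => /negP hi; apply: nh.
    exists (row i (kermx c^T)); split=> //; rewrite -row_mul mulmx_ker.
    by apply/rowP => ?; rewrite !mxE.
  have Fu : F \in unitmx by have /mulmx1_unit[] := EF.
  move/mxrankS; rewrite mxrankMfree ?row_free_unit // mxrank_ker.
  have := rank_leq_row zeta; have := rank_leq_col c^T; lia.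
have h1c' : h1^T *m c^T = 0 by rewrite -trmx_mul h1c trmx0.
have h1z' : h1^T *m zeta^T = 1%:M by rewrite -trmx_mul h1z trmx1.
have [h1F|h1F] := boolP (h1^T *m F <= zeta)%MS; last by exists (g, h1^T).
pose x := (h2 *m zeta^T) 0 0; have h2z : h2 *m zeta^T = x%:M.
  by apply/matrixP => i j; rewrite !ord1 [RHS]mxE eqxx.
exists (g, h2 + (1 - x) *: h1^T) => _ /=; split=> //.
- by rewrite mulmxDl h2c -scalemxAl h1c' scaler0 addr0.
- rewrite mulmxDl h2z -scalemxAl h1z'; apply/matrixP => i j.
  by rewrite !ord1 !mxE eqxx /= mulr1 addrC subrK.
- rewrite mulmxDl; apply: contra h2F => h; rewrite -[h2 *m F](addrK ((1 - x) *: h1^T *m F)).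
  by rewrite addmx_sub // eqmx_opp -scalemxAl scalemx_sub.
Qed.

Let vecs := projT1 (choice solve_vectors_exist).
Let vecsP := projT2 (choice solve_vectors_exist).
Let gvec c := (vecs c).1.
Let hvec c := (vecs c).2.

Section SolveValues.
Variable V : lmodType k.
Implicit Types (phi psi : word -> V).

(** What the summand [gvec c v 0 *: psi u] of [solve] contributes to the quadratic
    relation, with the opposite sign. *)
Definition solve_rhs (c : 'rV[k]_n) psi : word -> V :=
  fun u => - \sum_t (\sum_s F s t * gvec c s 0) *: psi (t :: u).

(** A dual function [phi] with [\sum_v c 0 v *: phi (v :: u) = psi u].  Write its
    values at [v :: u] as [gvec c] times [psi u] plus [hvec c] times a function
    [phi']: because [c] is 1 on [gvec c] and 0 on [hvec c], any [phi'] will do for the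
    equation, and the quadratic relation becomes the same problem for [phi'], with
    [c] replaced by [hvec c *m F].  The free value [x] is that at the empty word. *)
Fixpoint solve (c : 'rV[k]_n) psi (x : V) (w : word) : V :=
  match w with
  | [::] => x
  | v :: u => gvec c v 0 *: psi u
              + hvec c 0 v *: solve (hvec c *m F) (solve_rhs c psi) x u
  end.

Lemma dual_solve_rhs c psi : is_dual psi -> is_dual (solve_rhs c psi).
Proof.
move=> hpsi; rewrite /solve_rhs; apply: eq_dual (dual_linear (-1) _ (dual0 V)) => [w|].
  by rewrite scaleN1r addr0.
by apply: dual_sum => t; apply: (dual_shift t hpsi).
Qed.

Lemma solve_eq c psi x w : ~~ (c <= zeta)%MS ->
  \sum_v c 0 v *: solve c psi x (v :: w) = psi w.
Proof.
move=> hc; have [[/matrixP /(_ 0 0) h1 _] /matrixP /(_ 0 0) h2 _ _] := vecsP hc.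
under eq_bigr => v _ do rewrite /= scalerDr !scalerA.
rewrite big_split -!scaler_suml /=.
have -> : \sum_v c 0 v * gvec c v 0 = 1 by move: h1; rewrite !mxE.
have -> : \sum_v c 0 v * hvec c 0 v = 0.
  move: h2; rewrite !mxE => h2; rewrite -[RHS]h2; apply: eq_bigr => v _.
  by rewrite mxE mulrC.
by rewrite scale1r scale0r addr0.
Qed.

Lemma dual_solve c psi x : ~~ (c <= zeta)%MS -> is_dual psi ->
  is_dual (solve c psi x).
Proof.
move=> hc hpsi; split=> u.
  elim: u c psi hc hpsi => [|a u IH] c psi hc hpsi v /=; have [_ _ _ hc'] := vecsP hc.
    rewrite contractD [X in _ + X](_ : _ = solve_rhs c psi v).
      rewrite [X in X + _](_ : _ = - solve_rhs c psi v) ?addNr // /solve_rhs opprK.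
      rewrite /contract exchange_big; apply: eq_bigr => t _; rewrite scaler_suml.
      by apply: eq_bigr => s _; rewrite scalerA.
    apply: etrans (solve_eq (solve_rhs c psi) x v hc'); rewrite /contract exchange_big.
    apply: eq_bigr => t _.
    have -> : (hvec c *m F) 0 t = \sum_s hvec c 0 s * F s t by rewrite mxE.
    rewrite scaler_suml.
    by apply: eq_bigr => s _; rewrite scalerA mulrC.
  rewrite contractD !contractZ IH //; last exact: dual_solve_rhs.
  by have [-> _] := hpsi; rewrite !scaler0 addr0.
elim: u c psi hc hpsi => [|a u IH] c psi hc hpsi /=; have [[_ hz] _ hz' hc'] := vecsP hc.
  under eq_bigr => s _ do rewrite scalerDr !scalerA.
  rewrite big_split -!scaler_suml /=; have /matrixP /(_ 0 0) := hz; rewrite !mxE => ->.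
  have -> : \sum_i zeta 0 i * hvec c 0 i = 1.
    have /matrixP /(_ 0 0) := hz'; rewrite !mxE eqxx mulr1n => h; rewrite -[RHS]h.
    by apply: eq_bigr => i _; rewrite [zeta^T _ _]mxE mulrC.
  by rewrite scale0r add0r scale1r.
under eq_bigr => s _ do
  rewrite scalerDr !scalerA ![zeta 0 s * _]mulrC -!scalerA.
rewrite big_split /= -!scaler_sumr IH //; last exact: dual_solve_rhs.
by have [_ ->] := hpsi.
Qed.

Lemma solve_linear c a phi psi x y w :
  solve c (fun u => a *: phi u + psi u) (a *: x + y) w =
  a *: solve c phi x w + solve c psi y w.
Proof.
elim: w c phi psi => [|v w IH] c phi psi //=.
have -> : solve_rhs c (fun u => a *: phi u + psi u) =
    fun u => a *: solve_rhs c phi u + solve_rhs c psi u.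
  rewrite funeqE => u; rewrite /solve_rhs scalerN -opprD scaler_sumr -big_split.
  by congr (- _); apply: eq_bigr => t _; rewrite scalerDr !scalerA mulrC.
rewrite IH !scalerDr !scalerA addrACA; congr (_ + _ + (_ + _)).
  by rewrite mulrC.
by rewrite mulrC.
Qed.

Lemma eq_solve c phi psi x w : (forall u, (size u < size w)%N -> phi u = psi u) ->
  solve c phi x w = solve c psi x w.
Proof.
elim: w c phi psi => [|v w IH] c phi psi e //=.
rewrite e //; congr (_ + _ *: _); apply: IH => u uw; rewrite /solve_rhs.
by congr (- _); apply: eq_bigr => t _; rewrite e.
Qed.

Lemma solve_in (U : set V) c psi x w : is_subspace U -> U x ->
  (forall u, U (psi u)) -> U (solve c psi x w).
Proof.
move=> hU Ux; elim: w c psi => [|v w IH] c psi hpsi //=.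
apply: hU.2 => //; apply: subspaceZ => //; apply: IH => u; apply: subspaceN => //.
elim/big_rec: _ => [|t y _ hy]; first exact: hU.1.
exact: hU.2.
Qed.

(** A dual function whose shift by [s] is [phi] and whose shifts by the other
    letters, [p] excepted, vanish. *)
Definition extend (s p : 'I_n) phi (w : word) : V :=
  match w with
  | [::] => zeta 0 s *: phi [::]
  | v :: u =>
    if v == s then phi u
    else if v == p then solve (row p F) (fun u => - \sum_t F s t *: phi (t :: u)) 0 u
    else 0
  end.

(** Of the relation at the front of a word only the rows [s] and [p] of [F]
    remain, and [solve] is asked to make them cancel. *)
Lemma dual_extend s p phi : s != p -> ~~ (row p F <= zeta)%MS -> is_dual phi ->
  is_dual (extend s p phi).
Proof.
move=> sp hp hphi.
set psi := fun u => - \sum_t F s t *: phi (t :: u).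
have hpsi : is_dual psi.
  apply: eq_dual (dual_linear (-1) _ (dual0 V)) => [w|]; first by rewrite scaleN1r addr0.
  by apply: dual_sum => t; apply: (dual_shift t hphi).
have [h1 h2] := hphi; have [k1 k2] := dual_solve 0 hp hpsi.
split=> [[|a u] v|[|a u]].
- have ps : (p == s) = false by rewrite eq_sym (negPf sp).
  have e : contract F (fun s' t => extend s p phi [:: s', t & v]) =
      \sum_t F s t *: phi (t :: v) + \sum_t F p t *: solve (row p F) psi 0 (t :: v).
    rewrite /contract (bigD1 s) //; congr (_ + _) => /=.
      by apply: eq_bigr => t _; rewrite /extend eqxx.
    rewrite (bigD1 p) ?ps //=; apply: etrans (addr0 _); congr (_ + _).
      by apply: eq_bigr => t _; rewrite ?ps ?eqxx.
    rewrite big1 // => i /andP[is_ ip]; rewrite big1 // => t _.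
    by rewrite (negPf is_) (negPf ip) scaler0.
  rewrite -[LHS]/(contract F (fun s' t => extend s p phi [:: s', t & v])) e.
  have -> : \sum_t F p t *: solve (row p F) psi 0 (t :: v) = psi v.
    apply: etrans (solve_eq psi 0 v hp); apply: eq_bigr => t _.
    by rewrite [in RHS](_ : row p F 0 t = F p t) // mxE.
  by rewrite /psi; apply: addrN.
- rewrite /=; case: (a == s); first exact: h1.
  case: (a == p); first exact: k1.
  by rewrite /contract big1 // => s' _; rewrite big1 // => t _; rewrite scaler0.
- rewrite (bigD1 s) //= eqxx big1 ?addr0 // => v vs; rewrite (negPf vs).
  by case: (v == p); rewrite scaler0.
- rewrite /=; case: (a == s); first exact: h2.
  case: (a == p); first exact: k2.
  by rewrite big1 // => s' _; rewrite scaler0.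
Qed.

Lemma extend_linear s p : linear (extend s p : (word -> V) -> (word -> V)).
Proof.
move=> a phi psi; rewrite funeqE => -[|v w].
  by rewrite /= -[RHS]/(a *: (zeta 0 s *: phi [::]) + zeta 0 s *: psi [::])
    -[X in _ *: X]/(a *: phi [::] + psi [::]) scalerDr !scalerA mulrC.
rewrite -[RHS]/(a *: extend s p phi (v :: w) + extend s p psi (v :: w)) /=.
case: ifP => // _; case: ifP => _; last by rewrite scaler0 addr0.
rewrite -solve_linear scaler0 addr0; congr (solve _ _ _ _); rewrite funeqE => u.
rewrite scalerN -opprD scaler_sumr -big_split; congr (- _); apply: eq_bigr => t _.
rewrite -[X in _ *: X]/(a *: phi (t :: u) + psi (t :: u)).
by rewrite scalerDr !scalerA mulrC.
Qed.

Lemma shift_extend s p phi : shift s (extend s p phi) = phi.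
Proof. by rewrite funeqE => w; rewrite /shift /= eqxx. Qed.

Lemma shift_extend_neq s t p phi : t != s -> t != p ->
  shift t (extend s p phi) = fun=> 0.
Proof. by move=> ts tp; rewrite funeqE => w; rewrite /shift /= (negPf ts) (negPf tp). Qed.

End SolveValues.
End Solve.
End Words.

(** * Right modules over a free algebra *)

(** The nonzero vector is there to make the ring nontrivial. *)
Record endo (k : fieldType) (W : lmodType k) (w0 : W) (hw : w0 != 0) := Endo {
  endo_fun : W -> W;
  endo_linear : linear endo_fun
}.

Section Endo.
Variables (k : fieldType) (W : lmodType k) (w0 : W) (hw : w0 != 0).
Local Notation L := (endo hw).

Lemma endoP (f g : L) : endo_fun f =1 endo_fun g -> f = g.
Proof.
case: f g => f hf [g hg] /= /funext e; rewrite e in hf *.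
by congr Endo; apply: Prop_irrelevance.
Qed.

HB.instance Definition _ := gen_eqMixin L.
HB.instance Definition _ := gen_choiceMixin L.

Lemma endo_add_linear (f g : L) : linear (fun w => endo_fun f w + endo_fun g w).
Proof. by move=> a u v; rewrite !endo_linear scalerDr addrACA. Qed.
Lemma endo_opp_linear (f : L) : linear (fun w => - endo_fun f w).
Proof. by move=> a u v; rewrite endo_linear opprD scalerN. Qed.
Lemma endo_zero_linear : linear (fun _ : W => 0 : W).
Proof. by move=> a u v; rewrite scaler0 addr0. Qed.
Lemma endo_one_linear : linear (id : W -> W).
Proof. by []. Qed.
Lemma endo_mul_linear (f g : L) : linear (fun w => endo_fun g (endo_fun f w)).
Proof. by move=> a u v; rewrite !endo_linear. Qed.
Lemma endo_scale_linear c (f : L) : linear (fun w => c *: endo_fun f w).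
Proof. by move=> a u v; rewrite endo_linear scalerDr !scalerA mulrC. Qed.

Let add (f g : L) : L := Endo hw (endo_add_linear f g).
Let opp (f : L) : L := Endo hw (endo_opp_linear f).
Let zero : L := Endo hw endo_zero_linear.
Let one : L := Endo hw endo_one_linear.
(** The reversed composition, so that algebra morphisms into [endo hw] are
    right modules. *)
Let mul (f g : L) : L := Endo hw (endo_mul_linear f g).
Let scale c (f : L) : L := Endo hw (endo_scale_linear c f).

Lemma endo_addA : associative add. Proof. by move=> f g h; apply: endoP => w /=; rewrite addrA. Qed.
Lemma endo_addC : commutative add. Proof. by move=> f g; apply: endoP => w /=; rewrite addrC. Qed.
Lemma endo_add0 : left_id zero add. Proof. by move=> f; apply: endoP => w /=; rewrite add0r. Qed.
Lemma endo_addN : left_inverse zero opp add.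
Proof. by move=> f; apply: endoP => w /=; rewrite addNr. Qed.
HB.instance Definition _ := GRing.isZmodule.Build L endo_addA endo_addC endo_add0 endo_addN.

Lemma endo_mulA : associative mul. Proof. by move=> f g h; apply: endoP. Qed.
Lemma endo_mul1 : left_id one mul. Proof. by move=> f; apply: endoP. Qed.
Lemma endo_mulr1 : right_id one mul. Proof. by move=> f; apply: endoP. Qed.
Lemma endo_mulDl : left_distributive mul +%R.
Proof.
move=> f g h; apply: endoP => w /=; have := endo_linear h 1 (endo_fun f w) (endo_fun g w).
by rewrite !scale1r.
Qed.
Lemma endo_mulDr : right_distributive mul +%R. Proof. by move=> f g h; apply: endoP. Qed.
Lemma endo_one_neq0 : one != 0.
Proof. by apply: contra hw => /eqP e; rewrite -[w0]/(endo_fun one w0) e. Qed.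
HB.instance Definition _ := GRing.Zmodule_isNzRing.Build L
  endo_mulA endo_mul1 endo_mulr1 endo_mulDl endo_mulDr endo_one_neq0.

Lemma endo_scaleA a b (f : L) : scale a (scale b f) = scale (a * b) f.
Proof. by apply: endoP => w /=; rewrite scalerA. Qed.
Lemma endo_scale1 : left_id 1 scale. Proof. by move=> f; apply: endoP => w /=; rewrite scale1r. Qed.
Lemma endo_scaleDr : right_distributive scale +%R.
Proof. by move=> a f g; apply: endoP => w /=; rewrite scalerDr. Qed.
Lemma endo_scaleDl (f : L) : {morph scale^~ f : a b / a + b}.
Proof. by move=> a b; apply: endoP => w /=; rewrite scalerDl. Qed.
HB.instance Definition _ := GRing.Zmodule_isLmodule.Build k L
  endo_scaleA endo_scale1 endo_scaleDr endo_scaleDl.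

Lemma endo_scaleAl c (f g : L) : c *: (f * g) = (c *: f) * g.
Proof.
apply: endoP => w /=; have := endo_linear g c (endo_fun f w) 0.
have g0 : endo_fun g 0 = 0.
  by have := endo_linear g (-1) 0 0; rewrite scaler0 addr0 scaleN1r addNr.
by rewrite g0 !addr0.
Qed.
HB.instance Definition _ := GRing.Lmodule_isLalgebra.Build k L endo_scaleAl.
Lemma endo_scaleAr c (f g : L) : c *: (f * g) = f * (c *: g).
Proof. by apply: endoP. Qed.
HB.instance Definition _ := GRing.Lalgebra_isAlgebra.Build k L endo_scaleAr.

End Endo.

Section Annihilator.
Variables (R : realType) (k : fieldType) (W : lmodType k) (w0 : W) (hw : w0 != 0).
Variables (X : choiceType) (act : X -> endo hw) (K : set W).
Hypothesis hK : is_subspace K.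
Hypothesis K_stable : forall x w, K w -> K (endo_fun (act x) w).
Variables (f g : free_alg k X).

Let rho : {lrmorphism free_alg k X -> endo hw} := alg_lift act.

Definition annihilator : set (free_alg k X) :=
  [set b | forall w, K w -> endo_fun (rho b) w = 0].

Lemma free_alg_stable b w : K w -> K (endo_fun (rho b) w).
Proof.
move: b w; apply: free_alg_ind => [w|x w|b c hb hc w|a b c hb hc w] Kw.
- by rewrite rmorph1.
- by rewrite /rho alg_lift_var; apply: K_stable.
- by rewrite rmorphM; apply: hc; apply: hb.
- by rewrite linearP; apply: hK.2; [apply: hb | apply: hc].
Qed.

Lemma endo_fun0 (h : endo hw) : endo_fun h 0 = 0.
Proof. by have := endo_linear h (-1) 0 0; rewrite scaler0 addr0 scaleN1r addNr. Qed.

Lemma annihilator_ideal : is_ideal annihilator.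
Proof.
split; split=> [w _|b c hb hc w Kw|b c hc w Kw].
- by rewrite rmorph0.
- by rewrite rmorphD -[LHS]/(endo_fun (rho b) w + endo_fun (rho c) w) hb // hc // addr0.
- by rewrite rmorphM; apply: hc; apply: free_alg_stable.
- by rewrite rmorph0.
- by rewrite rmorphD -[LHS]/(endo_fun (rho b) w + endo_fun (rho c) w) hb // hc // addr0.
- by rewrite rmorphM -[LHS]/(endo_fun (rho b) (endo_fun (rho c) w)) hc // endo_fun0.
Qed.

Hypothesis K_neq0 : exists2 w, K w & w != 0.
(** This allows a relation [f * b + g * c = 0] on [K] to be tested at vectors that
    [g] or [f] sends to 0 and the other one to any given vector. *)
Hypothesis fg_onto : forall u v, K u -> K v ->
  exists w, [/\ K w, endo_fun (rho f) w = u & endo_fun (rho g) w = v].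

Lemma annihilator_free b c : annihilator (f * b + g * c) -> annihilator b /\ annihilator c.
Proof.
move=> h; split=> u Ku.
  have [w [Kw fw gw]] := fg_onto Ku hK.1; have := h w Kw.
  rewrite rmorphD !rmorphM -[LHS]/(endo_fun (rho b) (endo_fun (rho f) w) +
    endo_fun (rho c) (endo_fun (rho g) w)).
  by rewrite fw gw endo_fun0 addr0.
have [w [Kw fw gw]] := fg_onto hK.1 Ku; have := h w Kw.
rewrite rmorphD !rmorphM -[LHS]/(endo_fun (rho b) (endo_fun (rho f) w) +
  endo_fun (rho c) (endo_fun (rho g) w)).
by rewrite fw gw endo_fun0 add0r.
Qed.

(** The image of the annihilator in [B] is a proper ideal modulo which the images
    of [f] and [g] are right linearly independent. *)
Lemma wild_quotient (B : algType k) (p : {lrmorphism free_alg k X -> B}) :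
  (forall b, exists a, p a = b) -> (forall a, p a = 0 -> annihilator a) ->
  ~ noetherian B /\ ~ finite_GKdim R B.
Proof.
move=> psurj pker; have [[ann0 annD annMl] [_ _ annMr]] := annihilator_ideal.
pose I : set B := [set b | exists2 a, annihilator a & p a = b].
have lift a : I (p a) -> annihilator a.
  move=> [c hc e]; rewrite -[a](subrK c); apply: annD => //; apply: pker.
  by rewrite rmorphB /= e subrr.
have idI : is_ideal I.
  split; split; try by exists 0 => //; rewrite rmorph0.
  - by move=> _ _ [a ha <-] [b hb <-]; exists (a + b); [apply: annD | rewrite rmorphD].
  - move=> c _ [b hb <-]; have [a <-] := psurj c.
    by exists (a * b); [apply: annMl | rewrite rmorphM].
  - by move=> _ _ [a ha <-] [b hb <-]; exists (a + b); [apply: annD | rewrite rmorphD].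
  - move=> c _ [b hb <-]; have [a <-] := psurj c.
    by exists (b * a); [apply: annMr | rewrite rmorphM].
have I1 : ~ I 1.
  rewrite -(rmorph1 p); move=> /lift h; have [w Kw /negP] := K_neq0; apply; apply/eqP.
  by have := h w Kw; rewrite rmorph1.
have free b c : I (p f * b + p g * c) -> I b /\ I c.
  have [b' <-] := psurj b; have [c' <-] := psurj c.
  rewrite -!rmorphM -rmorphD => /lift /annihilator_free [hb hc].
  by split; [exists b' | exists c'].
by split; [apply: free_pair_not_noetherian free | apply: free_pair_infinite_GKdim free].
Qed.

End Annihilator.

Lemma linear_fun0 (k : fieldType) (U W : lmodType k) (h : U -> W) : linear h -> h 0 = 0.
Proof. by move=> /linear_pack [H ->]; apply: linear0. Qed.

Lemma linear_funZ (k : fieldType) (U W : lmodType k) (h : U -> W) : linear h ->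
  forall a u, h (a *: u) = a *: h u.
Proof. by move=> /linear_pack [H ->] a u; apply: linearZ. Qed.

Lemma contract_fun (k : fieldType) (n : nat) (T : Type) (U : lmodType k) (G : 'M[k]_n)
  (f : 'I_n -> 'I_n -> T -> U) x :
  (contract G f : T -> U) x = contract G (fun s t => f s t x).
Proof. by rewrite (@contract_linear _ _ _ U G (fun h : T -> U => h x)). Qed.

(** * Functions of two words *)

Section TwoFactors.
Variables (k : fieldType) (n : nat) (F E : 'M[k]_n) (xi xi' : 'I_n -> k) (lam : k).
Hypotheses (n_ge3 : (2 < n)%N) (FE : F *m E = 1%:M) (EF : E *m F = 1%:M).
Hypothesis lamP : lam ^+ 2 + theta F E * lam + 1 = 0.
Hypothesis xiP : \sum_s \sum_t F s t * (xi s * xi t) = 0.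
Hypothesis xi'P : \sum_s \sum_t E s t * (xi' s * xi' t) = 0.
Hypotheses (z0 : zeta F xi != 0) (z0' : zeta E xi' != 0).

Let word := seq 'I_n.
Let V : lmodType k := word -> k^o.
Let W : lmodType k := word -> V.
Implicit Types (beta : W) (phi : V).

Let lamP' : lam ^+ 2 + theta E F * lam + 1 = 0.
Proof.
rewrite -[RHS]lamP; congr (_ + _ * _ + _); apply: eq_bigr => s _.
by apply: eq_bigr => t _; rewrite mulrC.
Qed.

Let dual1 : set V := @is_dual k n F xi k^o.
Let lower1 s : V -> V := lower E xi lam s.
Let lower2 j : W -> W := lower F xi' lam j.

Definition is_bidual beta := is_dual E xi' beta /\ forall w, dual1 (beta w).

(** The operator [X_s X_j - lam Y_s Y_j], where the factors of index [s] act on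
    the second word and those of index [j] on the first one. *)
Definition biact s j beta : W :=
  fun w => (shift s (beta (j :: w)) : V) - lam *: lower1 s (lower2 j beta w).

Lemma dual1_subspace : is_subspace dual1.
Proof. by split=> [|a u v]; [exact: dual0 | exact: dual_linear]. Qed.

Lemma shift_linear s : linear (shift s : V -> V).
Proof. by []. Qed.
Lemma lower1_linear s : linear (lower1 s).
Proof. by move=> a u v; rewrite funeqE => w; apply: lower_linear. Qed.
Lemma lower2_linear j : linear (lower2 j).
Proof. by move=> a u v; rewrite funeqE => w; apply: lower_linear. Qed.

Lemma is_bidual_subspace : is_subspace is_bidual.
Proof.
split; first by split=> [|w]; exact: dual0.
move=> a u v [h1 h2] [h1' h2']; split; first exact: dual_linear.
by move=> w; apply: dual_linear; [exact: h2 | exact: h2'].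
Qed.

Lemma biact_linear s j : linear (biact s j).
Proof.
move=> a u v; rewrite funeqE => w; rewrite /biact lower2_linear.
rewrite -[lower1 s _]/(lower1 s (a *: lower2 j u w + lower2 j v w)) lower1_linear.
rewrite -[RHS]/(a *: (shift s (u (j :: w)) - lam *: lower1 s (lower2 j u w)) +
  (shift s (v (j :: w)) - lam *: lower1 s (lower2 j v w))).
rewrite -[shift s _]/(a *: shift s (u (j :: w)) + shift s (v (j :: w))).
by rewrite scalerBr scalerDr opprD addrACA !scalerA mulrC.
Qed.

Lemma is_bidual_lower2 j beta : is_bidual beta -> is_bidual (lower2 j beta).
Proof.
move=> [h1 h2]; split; first exact: dual_lower FE lamP' xi'P _ _ h1.
by move=> w; apply: lower_in; first exact: dual1_subspace.
Qed.

Lemma is_bidual_lower1 s beta : is_bidual beta -> is_bidual (fun w => lower1 s (beta w)).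
Proof.
move=> [h1 h2]; split; first exact: dual_map (lower1_linear s) h1.
by move=> w; apply: dual_lower EF lamP xiP _ _ (h2 w).
Qed.

Lemma is_bidual_biact s j beta : is_bidual beta -> is_bidual (biact s j beta).
Proof.
move=> hb; have [h1 h2] := hb.
have -> : biact s j beta = (- lam) *: (fun w => lower1 s (lower2 j beta w)) +
    (fun w => shift s (beta (j :: w)) : V).
  by rewrite funeqE => w; rewrite /biact scaleNr addrC.
apply: is_bidual_subspace.2; first exact/is_bidual_lower1/is_bidual_lower2.
split; first exact: dual_map (@shift_linear s) (dual_shift j h1).
by move=> w; apply/dual_shift/h2.
Qed.

Lemma biact2_expand (U : lmodType k) (a b c d : U) :
  a - lam *: b - lam *: ((- lam) *: c + d) = a - lam *: b - lam *: d + lam ^+ 2 *: c.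
Proof.
rewrite -[RHS]addrA; congr (_ + _).
by rewrite scalerDr scalerA mulrN scaleNr opprD opprK -expr2 addrC.
Qed.

Lemma biact2 s j t j' beta w : biact t j' (biact s j beta) w =
  (shift t (shift s (beta [:: j, j' & w]) : V) : V)
  - lam *: (shift t (lower1 s (lower2 j beta (j' :: w))) : V)
  - lam *: (lower1 t (shift s (lower2 j' (shift j beta) w)) : V)
  + lam ^+ 2 *: lower1 t (lower1 s (lower2 j' (lower2 j beta) w)).
Proof.
have e : lower2 j' (biact s j beta) w =
    (- lam) *: lower1 s (lower2 j' (lower2 j beta) w) +
    (shift s (lower2 j' (shift j beta) w) : V).
  have -> : biact s j beta = (- lam) *: (fun w => lower1 s (lower2 j beta w)) +
      (fun w => shift s (beta (j :: w)) : V).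
    by rewrite funeqE => u; rewrite /biact scaleNr addrC.
  rewrite lower2_linear.
  rewrite -[LHS]/((- lam) *: lower2 j' (fun w => lower1 s (lower2 j beta w)) w +
    lower2 j' (fun w => shift s (shift j beta w) : V) w).
  by rewrite /lower2 (lower_map _ _ _ (lower1_linear s)) (lower_map _ _ _ (@shift_linear s)).
rewrite -[LHS]/(((shift t (shift s (beta [:: j, j' & w]) : V) : V)
  - lam *: (shift t (lower1 s (lower2 j beta (j' :: w))) : V))
  - lam *: lower1 t (lower2 j' (biact s j beta) w)) e.
have -> := lower1_linear t (- lam) (lower1 s (lower2 j' (lower2 j beta) w))
  (shift s (lower2 j' (shift j beta) w)).
exact: biact2_expand.
Qed.

Lemma shift_lower1 t s phi :
  shift t (lower1 s phi) = lam *: lower1 t (shift s phi) + E s t *: phi.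
Proof. by []. Qed.
Lemma lower2_cons j j' beta w :
  lower2 j beta (j' :: w) = lam *: lower2 j' (shift j beta) w + F j j' *: beta w.
Proof. by []. Qed.

Lemma lam_theta : lam * (lam + theta F E) = -1.
Proof. by apply/eqP; rewrite -subr_eq0 opprK -[X in _ == X]lamP; apply/eqP; ring. Qed.

Lemma contract_biact2 (G : 'M[k]_n) (s t j j' : 'I_n -> 'I_n -> 'I_n) beta w :
  contract G (fun u v => biact (t u v) (j' u v) (biact (s u v) (j u v) beta) w) =
  contract G (fun u v =>
     (shift (t u v) (shift (s u v) (beta [:: j u v, j' u v & w]) : V) : V))
  - lam *: contract G (fun u v =>
     (shift (t u v) (lower1 (s u v) (lower2 (j u v) beta (j' u v :: w))) : V))
  - lam *: contract G (fun u v =>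
     (lower1 (t u v) (shift (s u v) (lower2 (j' u v) (shift (j u v) beta) w)) : V))
  + lam ^+ 2 *: contract G (fun u v =>
     lower1 (t u v) (lower1 (s u v) (lower2 (j' u v) (lower2 (j u v) beta) w))).
Proof.
rewrite -!scaleNr -!contractZ -!contractD; apply: eq_contract => u v.
by rewrite biact2 !scaleNr.
Qed.

(** Of the four terms of the product of two operators, those with [X_j X_j'] and
    [Y_j Y_j'] vanish by contraction with [E].  The others become scalar in the first
    word, and what is left in the second one is the defining recursion of [lower]. *)
Lemma contract_biact_row s t beta w : is_bidual beta ->
  contract E (fun j j' => biact t j' (biact s j beta) w) = E s t *: beta w.
Proof.
move=> [h1 h2]; rewrite (contract_biact2 E (fun _ _ => s) (fun _ _ => t) (fun j _ => j)).
rewrite -(@contract_linear _ _ V V E (fun b => shift t (shift s b : V))) //.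
rewrite (h1.1 [::] w).
rewrite -(@contract_linear _ _ V V E (fun b => shift t (lower1 s b))); last first.
  by move=> a u v; rewrite lower1_linear.
rewrite -(@contract_linear _ _ V V E (fun b => lower1 t (shift s b))); last first.
  by move=> a u v; rewrite -lower1_linear.
rewrite -(@contract_linear _ _ V V E (fun b => lower1 t (lower1 s b))); last first.
  by move=> a u v; rewrite !lower1_linear.
have -> : contract E (fun j j' => lower2 j beta (j' :: w)) = (lam + theta F E) *: beta w.
  have := contract_shift_lower lam EF h1 w.
  have -> : theta E F = theta F E.
    by apply: eq_bigr => u _; apply: eq_bigr => v _; rewrite mulrC.
  by [].
have -> : contract E (fun j j' => lower2 j' (shift j beta) w) = beta w.
  exact: (contract_lower_shift lam EF h1).
have -> : contract E (fun j j' => lower2 j' (lower2 j beta) w) = 0.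
  exact: (contract_lower_lower EF lamP' xi'P h1).
rewrite [lower1 s 0](linear_fun0 (lower1_linear s)) [lower1 t 0](linear_fun0 (lower1_linear t)).
rewrite scaler0 addr0 (linear_funZ (lower1_linear s)).
rewrite -[shift t (shift s 0)]/(0 : V) sub0r.
rewrite -[shift t _]/((lam + theta F E) *: (shift t (lower1 s (beta w)) : V)).
rewrite scalerA lam_theta shift_lower1 scaleN1r opprK.
by rewrite addrAC subrr add0r.
Qed.

(** The same computation with the roles of the two words exchanged. *)
Lemma contract_biact_col j j' beta w : is_bidual beta ->
  contract F (fun s t => biact t j' (biact s j beta) w) = F j j' *: beta w.
Proof.
move=> hb; have [h1 h2] := hb.
rewrite (contract_biact2 F (fun s _ => s) (fun _ t => t) (fun _ _ => j)).
have [_ d2] := is_bidual_lower2 j hb.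
have [_ d22] := is_bidual_lower2 j' (is_bidual_lower2 j hb).
have hs : is_bidual (shift j beta) by split; [exact: dual_shift | move=> u; apply: h2].
have [_ ds] := is_bidual_lower2 j' hs.
have -> : contract F (fun s t => (shift t (shift s (beta [:: j, j' & w]) : V) : V)) = 0.
  by rewrite funeqE => u; rewrite contract_fun; apply: (h2 _).1 [::] u.
have -> : contract F (fun s t => (shift t (lower1 s (lower2 j beta (j' :: w))) : V)) =
    (lam + theta F E) *: lower2 j beta (j' :: w).
  rewrite funeqE => u; rewrite contract_fun.
  exact: (contract_shift_lower lam FE (d2 (j' :: w)) u).
have -> : contract F (fun s t => lower1 t (shift s (lower2 j' (shift j beta) w))) =
    lower2 j' (shift j beta) w.
  rewrite funeqE => u; rewrite contract_fun.
  exact: (contract_lower_shift lam FE (ds w) u).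
have -> : contract F (fun s t => lower1 t (lower1 s (lower2 j' (lower2 j beta) w))) = 0.
  rewrite funeqE => u; rewrite contract_fun.
  exact: (contract_lower_lower FE lamP xiP (d22 w) u).
rewrite sub0r scalerA lam_theta scaleN1r opprK scaler0 addr0 lower2_cons.
by rewrite addrAC subrr add0r.
Qed.

End TwoFactors.

Section TwoFactorsOnto.
Variables (k : fieldType) (n : nat) (F E : 'M[k]_n) (xi xi' : 'I_n -> k) (lam : k).
Hypotheses (n_ge3 : (2 < n)%N) (FE : F *m E = 1%:M) (EF : E *m F = 1%:M).
Hypothesis lamP : lam ^+ 2 + theta F E * lam + 1 = 0.
Hypothesis xiP : \sum_s \sum_t F s t * (xi s * xi t) = 0.
Hypothesis xi'P : \sum_s \sum_t E s t * (xi' s * xi' t) = 0.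
Hypotheses (z0 : zeta F xi != 0) (z0' : zeta E xi' != 0).
Variables (p s t d : 'I_n).
Hypotheses (sp : s != p) (tp : t != p) (st : s != t).
Hypothesis hp : ~~ (row p F <= zeta F xi)%MS.
Hypothesis hd : ~~ ((delta_mx 0 d : 'rV_n) <= zeta E xi')%MS.

Let V : lmodType k := seq 'I_n -> k^o.
Let W : lmodType k := seq 'I_n -> V.
Local Notation bidual := (@is_bidual k n F E xi xi').
Local Notation bact := (@biact k n F E xi xi' lam).
Let lower1 i : V -> V := lower E xi lam i.
Let lower2 j : W -> W := lower F xi' lam j.
Let ext i : V -> V := extend n_ge3 EF z0 i p.

Let ext_linear i : linear (ext i).
Proof. exact: extend_linear. Qed.

Lemma bidual_neq0 : exists2 beta, bidual beta & beta != 0.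
Proof.
pose phi : V := solve n_ge3 EF z0 (row p F) (fun=> 0) 1.
have hphi : @is_dual k n F xi k^o phi by apply: dual_solve => //; apply: dual0.
exists (solve n_ge3 FE z0' (delta_mx 0 d) (fun=> 0) phi); last first.
  apply/eqP => /(congr1 (fun f : W => f [::] [::] : k)) /= /eqP.
  by rewrite /phi /= oner_eq0.
split; first by apply: dual_solve => //; apply: dual0.
move=> w; apply: solve_in => //; first exact: dual1_subspace.
by move=> u; apply: dual0.
Qed.

Variables (k1 k2 : W).
Hypotheses (hk1 : bidual k1) (hk2 : bidual k2).

(** The equations for [kappa] prescribe the shifts by [s] and by [t] of the second
    word of [kappa (d :: w)]; by construction of [ext] they follow
    from [kappa (d :: w) = Psi kappa w]. *)
Let Psi (kappa : W) : W := fun w =>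
  ext s (k1 w + lam *: lower1 s (lower2 d kappa w)) +
  ext t (k2 w + lam *: lower1 t (lower2 d kappa w)).

Let bidual_ext i (h : W) : i != p -> bidual h -> bidual (fun w => ext i (h w)).
Proof.
move=> ip [h1 h2]; split; first exact: dual_map (ext_linear i) h1.
by move=> w; apply: dual_extend.
Qed.

Let bidual_corr i (h kappa : W) : bidual h -> bidual kappa ->
  bidual (fun w => h w + lam *: lower1 i (lower2 d kappa w)).
Proof.
move=> hh hkappa.
have -> : (fun w => h w + lam *: lower1 i (lower2 d kappa w)) =
    lam *: (fun w => lower1 i (lower2 d kappa w)) + h.
  by rewrite funeqE => w; rewrite addrC.
apply: (is_bidual_subspace _ _ _ _).2 => //.
by apply: is_bidual_lower1 => //; apply: is_bidual_lower2.
Qed.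

Let bidual_Psi kappa : bidual kappa -> bidual (Psi kappa).
Proof.
move=> hkappa; have -> : Psi kappa =
    1 *: (fun w => ext s (k1 w + lam *: lower1 s (lower2 d kappa w))) +
    (fun w => ext t (k2 w + lam *: lower1 t (lower2 d kappa w))).
  by rewrite scale1r.
apply: (is_bidual_subspace _ _ _ _).2;
  by apply: bidual_ext => //; apply: bidual_corr.
Qed.

Let eq_Psi kappa kappa' w : (forall u, (size u <= size w)%N -> kappa u = kappa' u) ->
  Psi kappa w = Psi kappa' w.
Proof. by move=> e; rewrite /Psi /lower2 (@eq_lower _ _ _ _ _ _ _ kappa kappa'). Qed.

(** Successive approximations: [approx i] is already correct on the words of
    length at most [i], since the right-hand side of the equation at [w] only
    involves values at words that are not longer than [w], while [solve]
    prescribes values at words that are longer by one letter. *)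
Let approx := fix approx i : W :=
  if i is i'.+1 then solve n_ge3 FE z0' (delta_mx 0 d) (Psi (approx i')) 0 else 0.

Let bidual_approx i : bidual (approx i).
Proof.
elim: i => [|i IH] /=; first exact: (is_bidual_subspace _ _ _ _).1.
have [h1 h2] := bidual_Psi IH.
split; first exact: dual_solve.
move=> w; apply: solve_in => //; first exact: dual1_subspace.
exact: dual0.
Qed.

Let approxS i w : (size w <= i)%N -> approx i.+1 w = approx i w.
Proof.
elim: i w => [|i IH] w wi; first by move: wi; rewrite leqn0 size_eq0 => /eqP ->.
apply: eq_solve => u uw; apply: eq_Psi => v vu; apply: IH.
by apply: leq_trans vu _; rewrite -ltnS; apply: leq_trans uw _.
Qed.

Let kappa : W := fun w => approx (size w) w.

Let approxE i w : (size w <= i)%N -> approx i w = kappa w.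
Proof.
move=> /subnK <-; elim: (i - size w)%N => // j IH.
by rewrite addSn approxS // leq_addl.
Qed.

Lemma bidual_onto : exists beta,
  [/\ bidual beta, bact s d beta = k1 & bact t d beta = k2].
Proof.
have hkappa : bidual kappa.
  split; last by move=> w; apply: (bidual_approx _).2.
  split=> [u v|u].
    have [[h _] _] := bidual_approx (size u + (size v).+2).
    rewrite -[RHS](h u v); apply: eq_contract => i j.
    by rewrite approxE // size_cat.
  have [[_ h] _] := bidual_approx (size u).+1.
  rewrite -(@approxE (size u).+1 u) // -h; apply: eq_bigr => i _.
  by rewrite approxE // size_rcons.
have kappa_cons w : kappa (d :: w) = Psi kappa w.
  have := solve_eq n_ge3 FE z0' (Psi (approx (size w))) 0 w hd.
  rewrite (bigD1 d) //= mxE !eqxx scale1r big1 => [|i id_]; last first.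
    by rewrite mxE (negPf id_) andbF scale0r.
  rewrite addr0 -[X in X = _ -> _]/(approx (size w).+1 (d :: w)) => e.
  rewrite -(@approxE (size w).+1) // e; apply: eq_Psi => u uw.
  by rewrite approxE.
have ts : t != s by rewrite eq_sym.
pose a w := k1 w + lam *: lower1 s (lower2 d kappa w).
pose b w := k2 w + lam *: lower1 t (lower2 d kappa w).
have hs w : shift s (kappa (d :: w)) = a w.
  rewrite kappa_cons -[LHS]/((shift s (ext s (a w)) : V) + (shift s (ext t (b w)) : V)).
  have -> : (shift s (ext t (b w)) : V) = 0 by apply: shift_extend_neq.
  by rewrite addr0 /ext shift_extend.
have ht w : shift t (kappa (d :: w)) = b w.
  rewrite kappa_cons -[LHS]/((shift t (ext s (a w)) : V) + (shift t (ext t (b w)) : V)).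
  have -> : (shift t (ext s (a w)) : V) = 0 by apply: shift_extend_neq.
  by rewrite add0r /ext shift_extend.
exists kappa; split=> //; rewrite funeqE => w; rewrite /biact ?hs ?ht.
  exact: addrK.
exact: addrK.
Qed.

End TwoFactorsOnto.

(** * Lower bounds for three or more variables *)

Section Isotropic.
Variables (k : closedFieldType) (n : nat).
Implicit Types (F E : 'M[k]_n).

Lemma quadratic_root (a b c : k) : a != 0 -> exists x, a * x ^+ 2 + b * x + c = 0.
Proof.
move=> a0; have [x hx] := @solve_monicpoly k 2 (fun i => if i == 0%N then - c / a else - b / a) isT.
exists x; rewrite hx big_ord_recl big_ord1 /= expr0 expr1 mulr1.
by field.
Qed.

Lemma isotropic_vector F : (1 < n)%N ->
  exists2 u : 'rV[k]_n, u != 0 & u *m F *m u^T = 0.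
Proof.
move=> n1; pose i0 := Ordinal (ltnW n1); pose i1 := Ordinal n1.
pose e i : 'rV[k]_n := delta_mx 0 i.
have eFe i j : e i *m F *m (e j)^T = (F i j)%:M.
  apply/matrixP => a b; rewrite !ord1 trmx_delta -rowE -colE !mxE eqxx.
  by rewrite mulr1n.
have e1 (x : k) : x *: e i0 + e i1 != 0.
  apply/eqP => /rowP /(_ i1); rewrite !mxE !eqxx /= mulr0 add0r.
  by move/eqP; rewrite oner_eq0.
have [F0|F0] := eqVneq (F i0 i0) 0.
  exists (e i0); last by rewrite eFe F0; apply/matrixP => a b; rewrite !mxE mul0rn.
  by apply/eqP => /rowP /(_ i0); rewrite !mxE !eqxx => /eqP; rewrite oner_eq0.
have [x hx] := quadratic_root (F i0 i1 + F i1 i0) (F i1 i1) F0.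
exists (x *: e i0 + e i1) => //.
rewrite linearD linearZ /= !(mulmxDl, mulmxDr) -!scalemxAl -!scalemxAr !eFe.
apply/matrixP => a b; rewrite !ord1 !mxE eqxx !mulr1n -[RHS]hx; ring.
Qed.

Lemma isotropic_fun F E : (1 < n)%N -> E *m F = 1%:M -> exists xi : 'I_n -> k,
  \sum_s \sum_t F s t * (xi s * xi t) = 0 /\ zeta F xi != 0.
Proof.
move=> n1 EF; have [u u0 uF] := isotropic_vector F n1; exists (fun i => u 0 i); split.
  have /matrixP /(_ 0 0) := uF; rewrite !mxE => h; rewrite -[RHS]h exchange_big.
  apply: eq_bigr => t _; rewrite !mxE mulr_suml; apply: eq_bigr => s _.
  by rewrite mulrCA mulrA.
have -> : zeta F (fun i => u 0 i) = (F *m u^T)^T.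
  by apply/rowP => i; rewrite !mxE; apply: eq_bigr => t _; rewrite mxE.
apply: contra u0 => /eqP h; rewrite -[u]trmxK -[u^T]mul1mx -EF -mulmxA.
by rewrite -[F *m u^T]trmxK h trmx0 mulmx0 trmx0.
Qed.

(** The rows of an invertible matrix are pairwise not proportional. *)
Lemma rows_not_multiples (G : 'M[k]_n) (z : 'rV_n) i j : G \in unitmx -> i != j ->
  (row i G <= z)%MS -> ~~ (row j G <= z)%MS.
Proof.
move=> Gu ij /sub_rVP [a ha]; apply/negP => /sub_rVP [b hb].
pose y := z *m invmx G.
have {}ha : delta_mx 0 i = a *: y by rewrite scalemxAl -ha rowE mulmxK.
have {}hb : delta_mx 0 j = b *: y by rewrite scalemxAl -hb rowE mulmxK.
have /eqP := congr1 (fun M : 'rV_n => M 0 i) ha.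
have /eqP := congr1 (fun M : 'rV_n => M 0 j) ha.
have /eqP := congr1 (fun M : 'rV_n => M 0 j) hb.
have ji : (j == i) = false by rewrite eq_sym (negPf ij).
rewrite !mxE !eqxx ji /= => h1 h2 h3.
move: h2; rewrite eq_sym mulf_eq0 => /orP[/eqP e|/eqP e].
  by move: h3; rewrite e mul0r oner_eq0.
by move: h1; rewrite e mulr0 oner_eq0.
Qed.

Lemma three_indices (P : pred 'I_n) : (2 < n)%N ->
  (forall i j, i != j -> P i -> ~~ P j) ->
  exists p s t : 'I_n, [/\ s != p, t != p, s != t & ~~ P p].
Proof.
move=> n2 hP; pose i0 := Ordinal (ltnW (ltnW n2)); pose i1 := Ordinal (ltnW n2).
pose i2 := Ordinal n2.
have [P0|P0] := boolP (P i0); last by exists i0, i1, i2.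
by exists i1, i0, i2; split=> //; apply: hP P0.
Qed.

End Isotropic.

Lemma endo_fun_contract (k : fieldType) (n : nat) (W : lmodType k) (w0 : W)
  (hw : w0 != 0) (G : 'M[k]_n) (f : 'I_n -> 'I_n -> endo hw) w :
  endo_fun (contract G f) w = contract G (fun i j => endo_fun (f i j) w).
Proof. by rewrite (@contract_linear _ _ _ W G (fun h : endo hw => endo_fun h w)). Qed.

Section QuadraticAlgebra.
Variables (R : realType) (k : closedFieldType) (n : nat) (n_ge3 : (2 < n)%N).
Variables (E : 'M[k]_n) (Eu : E \in unitmx).

Let F := invmx E.
Let FE : F *m E = 1%:M. Proof. exact: mulVmx. Qed.
Let EF : E *m F = 1%:M. Proof. exact: mulmxV. Qed.

Let word_one_neq0 : (fun _ => 1 : k^o) != 0 :> (seq 'I_n -> k^o).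
Proof. by apply/eqP => /(congr1 (fun f => f [::])) /eqP; rewrite oner_eq0. Qed.

Let shift_linear' s : linear (@shift k n k^o s).
Proof. by []. Qed.

(** The operators are the shifts by two letters [s] and [t]; [extend] gives
    functions with prescribed shifts, at the price of a third letter. *)
Lemma AnE_wild (A : algType k) (p : {lrmorphism free_alg k 'I_n -> A}) :
  is_AnE E p -> ~ noetherian A /\ ~ finite_GKdim R A.
Proof.
move=> [psurj pker].
have [xi [xiP z0]] := isotropic_fun (ltnW n_ge3) FE.
have [q [s [t [sq tq st hq]]]] := three_indices n_ge3
  (fun i j => @rows_not_multiples k n E (zeta E xi) i j Eu).
pose act s : endo word_one_neq0 := Endo word_one_neq0 (shift_linear' s).
pose K : set (seq 'I_n -> k^o) := @is_dual k n E xi k^o.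
have hK : is_subspace K by split=> [|a u v]; [exact: dual0 | exact: dual_linear].
have K_stable x w : K w -> K (endo_fun (act x) w) by apply: dual_shift.
have K_neq0 : exists2 w, K w & w != 0.
  exists (solve n_ge3 FE z0 (row q E) (fun=> 0) 1); first by apply: dual_solve => //; apply: dual0.
  by apply/eqP => /(congr1 (fun f => f [::] : k)) /eqP; rewrite oner_eq0.
have ts : t != s by rewrite eq_sym.
apply: (@wild_quotient R k _ _ _ _ act K hK K_stable (fvar s) (fvar t) K_neq0 _ A p psurj).
  move=> u v Ku Kv.
  exists (extend n_ge3 FE z0 s q u + extend n_ge3 FE z0 t q v); rewrite !alg_lift_var; split.
  - rewrite -[X in X + _]scale1r; apply: hK.2; exact: dual_extend.
  - rewrite -[LHS]/((shift s (extend n_ge3 FE z0 s q u) : seq 'I_n -> k^o) +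
      shift s (extend n_ge3 FE z0 t q v)) shift_extend.
    have -> : (shift s (extend n_ge3 FE z0 t q v) : seq 'I_n -> k^o) = 0 by apply: shift_extend_neq.
    by rewrite addr0.
  - rewrite -[LHS]/((shift t (extend n_ge3 FE z0 s q u) : seq 'I_n -> k^o) +
      shift t (extend n_ge3 FE z0 t q v)) shift_extend.
    have -> : (shift t (extend n_ge3 FE z0 s q u) : seq 'I_n -> k^o) = 0 by apply: shift_extend_neq.
    by rewrite add0r.
move=> a /pker; apply; first exact: annihilator_ideal.
move=> _ -> w [Kw _]; rewrite -[relator E]/(contract E (fun i j => fvar i * fvar j)).
rewrite (contract_linear E _ (linearP (alg_lift act))) endo_fun_contract.
rewrite funeqE => u; rewrite contract_fun -[RHS](Kw [::] u); apply: eq_contract => i j.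
by rewrite rmorphM /= !alg_lift_var.
Qed.

(** Generators of the presentation of the Hopf envelope: the matrix entries,
    the codeterminant and its inverse. *)
Definition GL_var : choiceType := ('I_n * 'I_n + bool)%type.
Definition GL_free := free_alg k GL_var.
Definition GL_a (i j : 'I_n) : GL_free := fvar (inl (i, j) : GL_var).
Definition GL_D : GL_free := fvar (inr true : GL_var).
Definition GL_D' : GL_free := fvar (inr false : GL_var).

Definition GL_row_relator s t : GL_free :=
  contract E (fun i j => GL_a s i * GL_a t j) - E s t *: GL_D'.
Definition GL_col_relator i j : GL_free :=
  contract F (fun s t => GL_a s i * GL_D * GL_a t j) - F i j *: 1.

Definition GL_relators : set GL_free :=
  [set GL_D * GL_D' - 1; GL_D' * GL_D - 1] `|`
  [set GL_row_relator s t | s in setT & t in setT] `|`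
  [set GL_col_relator i j | i in setT & j in setT].

Let word2_one_neq0 : (fun _ _ => 1 : k^o) != 0 :> (seq 'I_n -> seq 'I_n -> k^o).
Proof.
by apply/eqP => /(congr1 (fun f : seq 'I_n -> seq 'I_n -> k^o => f [::] [::])) /eqP;
  rewrite oner_eq0.
Qed.

(** The two operators are those of two entries in the same column, and [GL_D] acts
    trivially. *)
Lemma SL_wild (B : algType k) (p : {lrmorphism GL_free -> B}) :
  (forall b, exists a, p a = b) ->
  (forall a, p a = 0 -> ideal_gen (GL_relators `|` [set GL_D - 1]) a) ->
  ~ noetherian B /\ ~ finite_GKdim R B.
Proof.
move=> psurj pker; have n1 := ltnW n_ge3.
have Fu : F \in unitmx by rewrite unitmx_inv.
have [xi [xiP z0]] := isotropic_fun n1 EF.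
have [xi' [xi'P z0']] := isotropic_fun n1 FE.
have [q [s [t [sq tq st hq]]]] := three_indices n_ge3
  (fun i j => @rows_not_multiples k n F (zeta F xi) i j Fu).
have [d [_ [_ [_ _ _ hd]]]] := three_indices n_ge3
  (fun i j => @rows_not_multiples k n 1%:M (zeta E xi') i j (unitmx1 _ _)).
rewrite row1 in hd.
have [lam lamP] : exists lam, lam ^+ 2 + theta F E * lam + 1 = 0.
  by have [x] := quadratic_root (theta F E) 1 (oner_neq0 k); rewrite mul1r; exists x.
pose act (x : GL_var) : endo word2_one_neq0 :=
  match x with
  | inl ij => Endo word2_one_neq0 (@biact_linear k n F E xi xi' lam ij.1 ij.2)
  | inr _ => 1
  end.
pose K : set (seq 'I_n -> seq 'I_n -> k^o) := is_bidual F E xi xi'.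
have hK : is_subspace K by exact: is_bidual_subspace.
have K_stable x w : K w -> K (endo_fun (act x) w).
  by case: x => [[i j]|b] //= Kw; apply: is_bidual_biact.
have K_neq0 : exists2 w, K w & w != 0 by apply: bidual_neq0 hq hd.
apply: (@wild_quotient R k _ _ _ _ act K hK K_stable (GL_a s d) (GL_a t d) K_neq0 _ B p psurj).
  move=> u v Ku Kv; rewrite /GL_a !alg_lift_var /=.
  exact: bidual_onto hq hd _ _ Ku Kv.
set rho := alg_lift act.
have rhoa i j : rho (GL_a i j) = act (inl (i, j)) by rewrite /rho alg_lift_var.
have rhoD : rho GL_D = 1 by rewrite /rho alg_lift_var.
have rhoD' : rho GL_D' = 1 by rewrite /rho alg_lift_var.
move=> a /pker; apply; first exact: annihilator_ideal.
move=> _ [[[[->|->]|[i _ [j _ <-]]]|[i _ [j _ <-]]]|->] w Kw; rewrite -/rho.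
- suff -> : rho (GL_D * GL_D' - 1) = 0 by [].
  by rewrite rmorphB rmorphM rmorph1 /= rhoD rhoD' mulr1 subrr.
- suff -> : rho (GL_D' * GL_D - 1) = 0 by [].
  by rewrite rmorphB rmorphM rmorph1 /= rhoD rhoD' mulr1 subrr.
- have -> : rho (GL_row_relator i j) =
      contract E (fun i' j' => rho (GL_a i i' * GL_a j j')) - E i j *: 1.
    rewrite /GL_row_relator linearB linearZ.
    congr (_ - _ *: _); last exact: rhoD'.
    exact: (contract_linear E _ (linearP rho)).
  rewrite -[LHS]/(endo_fun (contract E (fun i' j' => rho (GL_a i i' * GL_a j j'))) w - E i j *: w).
  rewrite endo_fun_contract; apply/eqP; rewrite subr_eq0; apply/eqP.
  rewrite funeqE => u; rewrite contract_fun.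
  rewrite -[RHS](contract_biact_row EF lamP xi'P i j u Kw); apply: eq_contract => i' j'.
  by have -> : rho (GL_a i i' * GL_a j j') = act (inl (i, i')) * act (inl (j, j'));
    first by rewrite rmorphM /= !rhoa.
- have -> : rho (GL_col_relator i j) =
      contract F (fun i' j' => rho (GL_a i' i * GL_D * GL_a j' j)) - F i j *: 1.
    rewrite /GL_col_relator linearB linearZ.
    congr (_ - _ *: _); last exact: (rmorph1 rho).
    exact: (contract_linear F _ (linearP rho)).
  rewrite -[LHS]/(endo_fun (contract F (fun i' j' => rho (GL_a i' i * GL_D * GL_a j' j))) w
    - F i j *: w).
  rewrite endo_fun_contract; apply/eqP; rewrite subr_eq0; apply/eqP.
  rewrite funeqE => u; rewrite contract_fun.
  rewrite -[RHS](contract_biact_col FE EF lamP xiP xi'P i j u Kw); apply: eq_contract => i' j'.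
  by have -> : rho (GL_a i' i * GL_D * GL_a j' j) = act (inl (i', i)) * act (inl (j', j));
    first by rewrite !rmorphM /= rhoD mulr1 !rhoa.
- suff -> : rho (GL_D - 1) = 0 by [].
  by rewrite rmorphB rmorph1 /= rhoD subrr.
Qed.

End QuadraticAlgebra.

(** * Quotient algebras and opposite algebras *)

Lemma ideal_gen_ideal (R : pzRingType) (X : set R) : is_ideal (ideal_gen X).
Proof.
split; split=> [I [[h _ _] _] _ //|x y hx hy I hI hX|a x hx I hI hX].
- by case: (hI) => [[_ D _] _]; apply: D; [apply: hx | apply: hy].
- by case: (hI) => [[_ _ M] _]; apply: M; apply: hx.
- by case: (hI) => [[_ D _] _]; apply: D; [apply: hx | apply: hy].
- by case: (hI) => [_ [_ _ M]]; apply: M; apply: hx.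
Qed.

Lemma sub_ideal_gen (R : pzRingType) (X : set R) : X `<=` ideal_gen X.
Proof. by move=> x Xx I _; apply. Qed.

Lemma ker_ideal (k : fieldType) (A B : algType k) (f : {lrmorphism A -> B}) :
  is_ideal [set a | f a = 0].
Proof.
split; split=> [|x y /= hx hy|a x /= hx]; rewrite /= ?rmorph0 //.
- by rewrite rmorphD /= hx hy addr0.
- by rewrite rmorphM /= hx mulr0.
- by rewrite rmorphD /= hx hy addr0.
- by rewrite rmorphM /= hx mul0r.
Qed.

Lemma lspan_ideal (k : fieldType) (A : algType k) (I : set A) :
  is_ideal I -> lspan I = I.
Proof.
move=> [[I0 ID IM] _]; apply/seteqP; split; last exact: sub_lspan.
move=> v /(_ I); apply=> //; split=> // a u w Iu Iw.
by apply: ID => //; rewrite -[u]mul1r scalerAl; apply: IM.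
Qed.

Definition quotient_algebra (k : fieldType) (A : algType k) (I : set A)
  of is_ideal I & ~ I 1 : Type := quot_mod I.
HB.instance Definition _ (k : fieldType) (A : algType k) (I : set A)
  (idI : is_ideal I) (I1 : ~ I 1) := GRing.Lmodule.on (quotient_algebra idI I1).

(* Locked, so that unification does not look into the representatives. *)
HB.lock Definition quotient_proj (k : fieldType) (A : algType k) (I : set A)
  (idI : is_ideal I) (I1 : ~ I 1) (a : A) : quotient_algebra idI I1 := quot_pi I a.
HB.lock Definition quotient_mul (k : fieldType) (A : algType k) (I : set A)
  (idI : is_ideal I) (I1 : ~ I 1) (x y : quotient_algebra idI I1) :=
  quotient_proj idI I1 (repr (x : quot_mod I) * repr (y : quot_mod I)).

Section QuotientAlgebra.
Variables (k : fieldType) (A : algType k) (I : set A).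
Hypotheses (idI : is_ideal I) (I1 : ~ I 1).
Local Notation Q := (quotient_algebra idI I1).
Local Notation quotient_proj := (@quotient_proj k A I idI I1).
Local Notation quotient_mul := (@quotient_mul k A I idI I1).

Lemma quotient_proj_eq a b : quotient_proj a = quotient_proj b <-> I (a - b).
Proof. by rewrite quotient_proj.unlock -!quot_piE quot_eqP lspan_ideal. Qed.

Lemma quotient_proj_surj (x : Q) : exists a, quotient_proj a = x.
Proof. by exists (repr (x : quot_mod I)); rewrite quotient_proj.unlock -quot_piE reprK. Qed.

Lemma quotient_mulE a b : quotient_mul (quotient_proj a) (quotient_proj b) = quotient_proj (a * b).
Proof.
have [[_ ID IMl] [_ _ IMr]] := idI.
have hr c : I (repr (quotient_proj c : quot_mod I) - c).
  have : lspan I (repr (quotient_proj c : quot_mod I) - c).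
    by rewrite quotient_proj.unlock -quot_piE; apply: repr_piP.
  by rewrite lspan_ideal.
rewrite quotient_mul.unlock; apply/quotient_proj_eq; rewrite -[_ - _](subrKA (a * repr (quotient_proj b : quot_mod I))).
by apply: ID; [rewrite -mulrBl; apply: IMr | rewrite -mulrBr; apply: IMl].
Qed.

Lemma quotient_proj_linear : linear quotient_proj.
Proof. by rewrite quotient_proj.unlock; apply: quot_pi_linear. Qed.

Lemma quotient_mulA : associative quotient_mul.
Proof.
move=> x y z; have [a <-] := quotient_proj_surj x; have [b <-] := quotient_proj_surj y.
by have [c <-] := quotient_proj_surj z; rewrite !quotient_mulE mulrA.
Qed.
Lemma quotient_mul1r : left_id (quotient_proj 1) quotient_mul.
Proof. by move=> x; have [a <-] := quotient_proj_surj x; rewrite quotient_mulE mul1r. Qed.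
Lemma quotient_mulr1 : right_id (quotient_proj 1) quotient_mul.
Proof. by move=> x; have [a <-] := quotient_proj_surj x; rewrite quotient_mulE mulr1. Qed.

Let projD a b : quotient_proj (a + b) = quotient_proj a + quotient_proj b.
Proof. by rewrite -[a]scale1r quotient_proj_linear !scale1r. Qed.

Lemma quotient_mulDl : left_distributive quotient_mul +%R.
Proof.
move=> x y z; have [a <-] := quotient_proj_surj x; have [b <-] := quotient_proj_surj y.
by have [c <-] := quotient_proj_surj z; rewrite -projD !quotient_mulE mulrDl projD.
Qed.
Lemma quotient_mulDr : right_distributive quotient_mul +%R.
Proof.
move=> x y z; have [a <-] := quotient_proj_surj x; have [b <-] := quotient_proj_surj y.
by have [c <-] := quotient_proj_surj z; rewrite -projD !quotient_mulE mulrDr projD.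
Qed.
Lemma quotient_one_neq0 : quotient_proj 1 != 0.
Proof.
apply/eqP; have -> : 0 = quotient_proj 0.
  have := quotient_proj_linear (-1) 0 0.
  by rewrite scaler0 addr0 scaleN1r addNr.
by move/quotient_proj_eq; rewrite subr0.
Qed.
HB.instance Definition _ := GRing.Zmodule_isNzRing.Build Q
  quotient_mulA quotient_mul1r quotient_mulr1 quotient_mulDl quotient_mulDr quotient_one_neq0.

Let projZ c a : quotient_proj (c *: a) = c *: quotient_proj a.
Proof.
have := quotient_proj_linear c a 0; rewrite addr0 => ->.
have -> : quotient_proj 0 = 0.
  by have := quotient_proj_linear (-1) 0 0; rewrite scaler0 addr0 scaleN1r addNr.
by rewrite addr0.
Qed.

Let projM a b : quotient_proj (a * b) = quotient_proj a * quotient_proj b.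
Proof. by rewrite -quotient_mulE. Qed.

Lemma quotient_scaleAl c (x y : Q) : c *: (x * y) = (c *: x) * y.
Proof.
have [a <-] := quotient_proj_surj x; have [b <-] := quotient_proj_surj y.
by rewrite -projM -!projZ -projM scalerAl.
Qed.
HB.instance Definition _ := GRing.Lmodule_isLalgebra.Build k Q quotient_scaleAl.
Lemma quotient_scaleAr c (x y : Q) : c *: (x * y) = x * (c *: y).
Proof.
have [a <-] := quotient_proj_surj x; have [b <-] := quotient_proj_surj y.
by rewrite -projM -!projZ -projM scalerAr.
Qed.
HB.instance Definition _ := GRing.Lalgebra_isAlgebra.Build k Q quotient_scaleAr.

HB.instance Definition _ := GRing.isLinear.Build k A Q _ quotient_proj quotient_proj_linear.
Lemma quotient_proj_monoid : monoid_morphism quotient_proj.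
Proof. by split=> // a b; rewrite projM. Qed.
HB.instance Definition _ := GRing.isMonoidMorphism.Build A Q quotient_proj quotient_proj_monoid.

Lemma quotient_proj_eq0 a : quotient_proj a = 0 <-> I a.
Proof. by rewrite -(linear0 quotient_proj) quotient_proj_eq subr0. Qed.

End QuotientAlgebra.

(** Universal property of a quotient, for an arbitrary surjection. *)
Lemma factor_through (k : fieldType) (A B C : algType k)
  (p : {lrmorphism A -> B}) (f : {lrmorphism A -> C}) :
  (forall b, exists a, p a = b) -> (forall a, p a = 0 -> f a = 0) ->
  exists g : {lrmorphism B -> C}, forall a, g (p a) = f a.
Proof.
move=> /choice [s ps] pf.
pose g b := f (s b).
have gp a : g (p a) = f a.
  apply/eqP; rewrite -subr_eq0 /g -rmorphB; apply/eqP/pf.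
  by rewrite rmorphB /= ps subrr.
have glin : linear g.
  move=> a u v; rewrite -(ps u) -(ps v); move: (s u) (s v) => x y.
  by rewrite -[a *: p x + p y](linearP p) !gp linearP.
have gmon : monoid_morphism g.
  split; first by rewrite -(rmorph1 p) gp rmorph1.
  move=> u v; rewrite -(ps u) -(ps v); move: (s u) (s v) => a b.
  by rewrite -[p a * p b](rmorphM p) !gp rmorphM.
pose G1 := GRing.isLinear.Build k B C _ g glin.
pose G2 := GRing.isMonoidMorphism.Build B C g gmon.
by exists (HB.pack g G1 G2 : {lrmorphism B -> C}).
Qed.

Definition opposite (k : fieldType) (A : algType k) : Type := A.

Section Opposite.
Variables (k : fieldType) (A : algType k).
Local Notation O := (opposite A).
HB.instance Definition _ := GRing.Lmodule.copy O A.

Let mul (x y : O) : O := (y : A) * (x : A).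

Lemma opposite_mulA : associative mul. Proof. by move=> x y z; rewrite /mul mulrA. Qed.
Lemma opposite_mul1r : left_id (1 : A) mul. Proof. by move=> x; rewrite /mul mulr1. Qed.
Lemma opposite_mulr1 : right_id (1 : A) mul. Proof. by move=> x; rewrite /mul mul1r. Qed.
Lemma opposite_mulDl : left_distributive mul +%R.
Proof. by move=> x y z; rewrite /mul -mulrDr. Qed.
Lemma opposite_mulDr : right_distributive mul +%R.
Proof. by move=> x y z; rewrite /mul -mulrDl. Qed.
Lemma opposite_one_neq0 : (1 : A) != 0 :> O.
Proof. exact: oner_neq0. Qed.
HB.instance Definition _ := GRing.Zmodule_isNzRing.Build O
  opposite_mulA opposite_mul1r opposite_mulr1 opposite_mulDl opposite_mulDr opposite_one_neq0.

Lemma opposite_scaleAl c (x y : O) : c *: (x * y) = (c *: x : O) * y.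
Proof. exact: (@scalerAr k A c y x). Qed.
HB.instance Definition _ := GRing.Lmodule_isLalgebra.Build k O opposite_scaleAl.
Lemma opposite_scaleAr c (x y : O) : c *: (x * y) = x * (c *: y : O).
Proof. exact: (@scalerAl k A c y x). Qed.
HB.instance Definition _ := GRing.Lalgebra_isAlgebra.Build k O opposite_scaleAr.

End Opposite.

(** * Bialgebra axioms on generators *)

Lemma tensor_lift_sum (k : fieldType) (V W U : lmodType k) (f : V -> W -> U) :
  is_bilinear f -> forall (I : Type) (r : seq I) (P : pred I) (t : I -> tensor V W),
  tensor_lift f (\sum_(i <- r | P i) t i) = \sum_(i <- r | P i) tensor_lift f (t i).
Proof.
by move=> hf I r P t; apply: (big_morph _ (tensor_liftD hf) (tensor_lift0 hf)).
Qed.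

Section Bilinear.
Variables (k : fieldType) (B C C' : algType k).

Lemma counitl_bil (eps : B -> k) : scalar eps -> is_bilinear (fun x y : B => eps x *: y).
Proof.
move=> he; split=> [y a u v|x a u v]; first by rewrite he scalerDl scalerA.
by rewrite scalerDr !scalerA mulrC.
Qed.

Lemma counitr_bil (eps : B -> k) : scalar eps -> is_bilinear (fun x y : B => eps y *: x).
Proof.
move=> he; split=> [y a u v|x a u v]; last by rewrite he scalerDl scalerA.
by rewrite scalerDr !scalerA mulrC.
Qed.

Lemma mul_bil (f g : B -> C) : linear f -> linear g -> is_bilinear (fun x y => f x * g y).
Proof.
move=> hf hg; split=> [y a u v|x a u v]; first by rewrite hf mulrDl scalerAl.
by rewrite hg mulrDr scalerAr.
Qed.

Lemma tens_bil (f : B -> C) (g : B -> C') : linear f -> linear g ->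
  is_bilinear (fun x y => f x *t g y).
Proof.
move=> hf hg; split=> [y a u v|x a u v]; first by rewrite hf tensDl tensZl.
by rewrite hg tensDr tensZr.
Qed.

Lemma assoc_bil (x : B) : is_bilinear (fun y1 y2 : B => (x *t y1) *t y2).
Proof.
split=> [y a u v | y a u v]; first by rewrite tensDr tensZr tensDl tensZl.
by rewrite tensDr tensZr.
Qed.

Lemma coassocl_bil (Delta : B -> tensor B B) : linear Delta ->
  is_bilinear (fun x y : B => tensor_lift (fun y1 y2 => (x *t y1) *t y2) (Delta y)).
Proof.
move=> hD; have bil := assoc_bil.
split=> [y a u v | x a u v]; last by rewrite hD tensor_lift_linear.
elim/tensor_ind: (Delta y) => [|p q|p q hp hq].
- by rewrite !tensor_lift0 // scaler0 addr0.
- by rewrite !tensor_liftE // !(tensDl, tensZl).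
- by rewrite !tensor_liftD // hp hq scalerDr addrACA.
Qed.

Lemma coassocr_bil (Delta : B -> tensor B B) : linear Delta ->
  is_bilinear (fun x y : B => Delta x *t y).
Proof.
move=> hD; split=> [y a u v | x a u v]; first by rewrite hD tensDl tensZl.
by rewrite tensDr tensZr.
Qed.

End Bilinear.

(** Stated as an induction principle, the only form in which it is used. *)
Definition generated_by (k : fieldType) (C : algType k) (X : set C) := forall P : C -> Prop,
  P 1 -> (forall x, X x -> P x) -> (forall g h, P g -> P h -> P (g * h)) ->
  (forall c g h, P g -> P h -> P (c *: g + h)) -> forall g, P g.

Section GeneratorAxioms.
Variables (k : fieldType) (B : algType k).
Variables (Delta : {lrmorphism B -> tensor B B}) (eps : {lrmorphism B -> k^o}) (X : set B).
Hypothesis B_gen : generated_by X.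

Lemma counitl_gen :
  (forall x, X x -> tensor_lift (fun x y => (eps x : k) *: y) (Delta x) = x) ->
  forall b, tensor_lift (fun x y => (eps x : k) *: y) (Delta b) = b.
Proof.
have bil := counitl_bil (linearP eps : scalar eps); move=> hX; elim/B_gen => [|x /hX //|g h Hg Hh|a g h Hg Hh].
- by rewrite rmorph1 -tens1 tensor_liftE // rmorph1 scale1r.
- rewrite rmorphM tensor_lift_mul ?Hg ?Hh // => x y x' y'.
  by rewrite rmorphM -scalerAl -scalerAr scalerA.
- by rewrite linearP tensor_lift_linear // Hg Hh.
Qed.

Lemma counitr_gen :
  (forall x, X x -> tensor_lift (fun x y => (eps y : k) *: x) (Delta x) = x) ->
  forall b, tensor_lift (fun x y => (eps y : k) *: x) (Delta b) = b.
Proof.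
have bil := counitr_bil (linearP eps : scalar eps); move=> hX; elim/B_gen => [|x /hX //|g h Hg Hh|a g h Hg Hh].
- by rewrite rmorph1 -tens1 tensor_liftE // rmorph1 scale1r.
- rewrite rmorphM tensor_lift_mul ?Hg ?Hh // => x y x' y'.
  by rewrite rmorphM -scalerAl -scalerAr scalerA.
- by rewrite linearP tensor_lift_linear // Hg Hh.
Qed.

Lemma assoc_mul (x x' : B) (s t : tensor B B) :
  tensor_lift (fun y1 y2 => ((x * x') *t y1) *t y2) (s * t) =
  tensor_lift (fun y1 y2 => (x *t y1) *t y2) s *
  tensor_lift (fun y1 y2 => (x' *t y1) *t y2) t.
Proof.
have bil := @assoc_bil k B; elim/tensor_ind: s => [|p q|p q hp hq].
- by rewrite mul0r !tensor_lift0 // mul0r.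
- elim/tensor_ind: t => [|p' q'|p' q' hp' hq'].
  + by rewrite mulr0 !tensor_lift0 // mulr0.
  + by rewrite tensM !tensor_liftE // !tensM.
  + by rewrite mulrDr !tensor_liftD // hp' hq' mulrDr.
- by rewrite mulrDl !tensor_liftD // hp hq mulrDl.
Qed.

Lemma coassoc_gen :
  (forall x, X x ->
    tensor_lift (fun x y => tensor_lift (fun y1 y2 => (x *t y1) *t y2) (Delta y)) (Delta x)
    = tensor_lift (fun x y => Delta x *t y) (Delta x)) ->
  forall b,
    tensor_lift (fun x y => tensor_lift (fun y1 y2 => (x *t y1) *t y2) (Delta y)) (Delta b)
    = tensor_lift (fun x y => Delta x *t y) (Delta b).
Proof.
have abil := @assoc_bil k B.
have lbil := coassocl_bil (linearP Delta); have rbil := coassocr_bil (linearP Delta).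
move=> hX; elim/B_gen => [|x /hX //|g h Hg Hh|a g h Hg Hh].
- by rewrite rmorph1 -tens1 !tensor_liftE // rmorph1 -tens1 tensor_liftE.
- rewrite rmorphM !tensor_lift_mul ?Hg ?Hh //.
    by move=> x y x' y'; rewrite rmorphM tensM.
  by move=> x y x' y'; rewrite rmorphM assoc_mul.
- by rewrite linearP !tensor_lift_linear // Hg Hh.
Qed.

Variable S : {lrmorphism B -> opposite B}.

Let SM x y : S (x * y) = (S y : B) * (S x : B) :> B.
Proof. exact: (rmorphM S). Qed.

Let Slin : linear (S : B -> B). Proof. exact: (linearP S). Qed.
Let idlin : linear (id : B -> B). Proof. by []. Qed.
Lemma antipodel_bil : is_bilinear (fun x y : B => (S x : B) * y). Proof. exact: mul_bil. Qed.
Lemma antipoder_bil : is_bilinear (fun x y : B => x * (S y : B)). Proof. exact: mul_bil. Qed.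

(** The inner factor of a product collapses to a scalar first. *)
Lemma antipodel_mul s t c : tensor_lift (fun x y => (S x : B) * y) s = c *: 1 ->
  tensor_lift (fun x y => (S x : B) * y) (s * t) =
  c *: tensor_lift (fun x y => (S x : B) * y) t.
Proof.
have bil := antipodel_bil => hs; elim/tensor_ind: t => [|x' y'|p q hp hq].
- by rewrite mulr0 !tensor_lift0 // scaler0.
- transitivity ((S x' : B) * tensor_lift (fun x y => (S x : B) * y) s * y'); last first.
    by rewrite hs tensor_liftE // -scalerAr mulr1 scalerAl.
  elim/tensor_ind: s {hs} => [|x y|p q hp hq].
  + by rewrite mul0r !tensor_lift0 // mulr0 mul0r.
  + by rewrite tensM !tensor_liftE // SM !mulrA.
  + by rewrite mulrDl !tensor_liftD // hp hq mulrDr mulrDl.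
- by rewrite mulrDr !tensor_liftD // hp hq scalerDr.
Qed.

Lemma antipoder_mul s t c : tensor_lift (fun x y => x * (S y : B)) t = c *: 1 ->
  tensor_lift (fun x y => x * (S y : B)) (s * t) =
  c *: tensor_lift (fun x y => x * (S y : B)) s.
Proof.
have bil := antipoder_bil => ht; elim/tensor_ind: s => [|x y|p q hp hq].
- by rewrite mul0r !tensor_lift0 // scaler0.
- transitivity (x * tensor_lift (fun x y => x * (S y : B)) t * (S y : B)); last first.
    by rewrite ht tensor_liftE // -scalerAr mulr1 scalerAl.
  elim/tensor_ind: t {ht} => [|x' y'|p q hp hq].
  + by rewrite mulr0 !tensor_lift0 // mulr0 mul0r.
  + by rewrite tensM !tensor_liftE // SM !mulrA.
  + by rewrite mulrDr !tensor_liftD // hp hq mulrDr mulrDl.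
- by rewrite mulrDl !tensor_liftD // hp hq scalerDr.
Qed.

Let S1 : (S 1 : B) = 1. Proof. exact: (rmorph1 S). Qed.

Lemma antipodel_gen :
  (forall x, X x -> tensor_lift (fun x y => (S x : B) * y) (Delta x) = (eps x : k) *: 1) ->
  forall b, tensor_lift (fun x y => (S x : B) * y) (Delta b) = (eps b : k) *: 1.
Proof.
have bil := antipodel_bil; move=> hX; elim/B_gen => [|x /hX //|g h Hg Hh|a g h Hg Hh].
- by rewrite rmorph1 -tens1 tensor_liftE // S1 mulr1 rmorph1 scale1r.
- by rewrite rmorphM (antipodel_mul _ Hg) Hh rmorphM scalerA.
- by rewrite linearP tensor_lift_linear // Hg Hh linearP scalerDl scalerA.
Qed.

Lemma antipoder_gen :
  (forall x, X x -> tensor_lift (fun x y => x * (S y : B)) (Delta x) = (eps x : k) *: 1) ->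
  forall b, tensor_lift (fun x y => x * (S y : B)) (Delta b) = (eps b : k) *: 1.
Proof.
have bil := antipoder_bil; move=> hX; elim/B_gen => [|x /hX //|g h Hg Hh|a g h Hg Hh].
- by rewrite rmorph1 -tens1 tensor_liftE // S1 mulr1 rmorph1 scale1r.
- by rewrite rmorphM (antipoder_mul _ Hh) Hg rmorphM scalerA mulrC.
- by rewrite linearP tensor_lift_linear // Hg Hh linearP scalerDl scalerA.
Qed.

End GeneratorAxioms.

(** * Bialgebra morphisms between Hopf algebras *)

Section Convolution.
Variables (k : fieldType) (B : bialgType k) (C : algType k).
Implicit Types (f g h : B -> C).

Definition convolution f g : B -> C := fun b => tensor_lift (fun x y => f x * g y) (comul b).

Lemma convolution_linear f g : linear f -> linear g -> linear (convolution f g).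
Proof.
move=> hf hg a u v; rewrite /convolution comul_linear tensor_lift_linear //.
exact: mul_bil.
Qed.

Lemma convolutionA f g h : linear f -> linear g -> linear h ->
  forall b, convolution f (convolution g h) b = convolution (convolution f g) h b.
Proof.
move=> hf hg hh b.
have fg := mul_bil hf hg; have gh := mul_bil hg hh.
pose T (t : tensor (tensor B B) B) : C :=
  tensor_lift (fun s z => tensor_lift (fun x y => f x * g y) s * h z) t.
have Tbil : is_bilinear (fun (s : tensor B B) (z : B) =>
    tensor_lift (fun x y => f x * g y) s * h z).
  split=> [z a u v|s a u v]; first by rewrite tensor_lift_linear // mulrDl scalerAl.
  by rewrite hh mulrDr scalerAr.
have abil := @assoc_bil k B.
have TD u v : T (u + v) = T u + T v by apply: (tensor_liftD Tbil).
have e1 x s : T (tensor_lift (fun y1 y2 => (x *t y1) *t y2) s) =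
    f x * tensor_lift (fun y z => g y * h z) s.
  elim/tensor_ind: s => [|y z|s s' hs hs'].
  - by rewrite /T !tensor_lift0 // mulr0.
  - by rewrite /T !tensor_liftE // mulrA.
  - by rewrite (tensor_liftD (abil x)) TD hs hs' (tensor_liftD gh) mulrDr.
have cl := coassocl_bil (@comul_linear k B); have cr := coassocr_bil (@comul_linear k B).
have fgh := mul_bil hf (convolution_linear hg hh).
have fgh' := mul_bil (convolution_linear hf hg) hh.
transitivity (T (tensor_lift (fun x y => tensor_lift (fun y1 y2 => (x *t y1) *t y2) (comul y))
    (comul b))).
  rewrite {1}/convolution; elim/tensor_ind: (comul b) => [|x y|s s' hs hs'].
  - by rewrite /T !tensor_lift0.
  - by rewrite !tensor_liftE // e1.
  - by rewrite (tensor_liftD fgh) (tensor_liftD cl) TD hs hs'.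
rewrite comulA [RHS]/convolution; elim/tensor_ind: (comul b) => [|x y|s s' hs hs'].
- by rewrite /T !tensor_lift0.
- by rewrite /T !tensor_liftE.
- by rewrite (tensor_liftD cr) (tensor_liftD fgh') TD hs hs'.
Qed.

Lemma convolution_unitl f : linear f -> forall b,
  convolution (fun b => counit b *: 1) f b = f b.
Proof.
move=> hf b; rewrite /convolution -[in RHS](counitl b).
have [F eF] := linear_pack hf; rewrite eF in hf *.
have bil := counitl_bil (@counit_scalar k B).
have bil' : is_bilinear (fun x y : B => counit x *: 1 * F y).
  apply: mul_bil => // a u v.
  by rewrite counit_scalar scalerDl scalerA.
elim/tensor_ind: (comul b) => [|x y|s s' hs hs'].
- by rewrite !tensor_lift0 // linear0.
- by rewrite !tensor_liftE // linearZ -scalerAl mul1r.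
- by rewrite !tensor_liftD // linearD hs hs'.
Qed.

Lemma convolution_unitr f : linear f -> forall b,
  convolution f (fun b => counit b *: 1) b = f b.
Proof.
move=> hf b; rewrite /convolution -[in RHS](counitr b).
have [F eF] := linear_pack hf; rewrite eF in hf *.
have bil := counitr_bil (@counit_scalar k B).
have bil' : is_bilinear (fun x y : B => F x * (counit y *: 1)).
  apply: mul_bil => // a u v.
  by rewrite counit_scalar scalerDl scalerA.
elim/tensor_ind: (comul b) => [|x y|s s' hs hs'].
- by rewrite !tensor_lift0 // linear0.
- by rewrite !tensor_liftE // linearZ -scalerAr mulr1.
- by rewrite !tensor_liftD // linearD hs hs'.
Qed.

Lemma convolution_inverse_unique f g h : linear f -> linear g -> linear h ->
  (forall b, convolution f h b = counit b *: 1) ->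
  (forall b, convolution h g b = counit b *: 1) -> f =1 g.
Proof.
move=> hf hg hh fh hg' b; rewrite -(convolution_unitr hf) -(convolution_unitl hg).
have -> : (fun b => counit b *: 1) = convolution h g by apply/funext => u; rewrite hg'.
rewrite (convolutionA hf hh hg); congr (convolution _ g b).
by apply/funext => u; rewrite fh hg'.
Qed.

End Convolution.

(** Both [f \o antipode] and [antipode \o f] are convolution inverses of [f]. *)
Lemma bialg_mor_hopf (k : fieldType) (H K : hopfAlgType k) (f : {lrmorphism H -> K}) :
  is_bialg_mor f -> is_hopf_mor f.
Proof.
move=> hf; split=> // h; have [f_comul f_counit] := hf.
have alin := @antipode_linear k H; have alin' := @antipode_linear k K.
have flin : linear f := linearP f.
apply: (@convolution_inverse_unique k H K (fun h => f (antipode h))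
  (fun h => antipode (f h)) f) => //.
- by move=> a u v; rewrite alin linearP.
- by move=> a u v; rewrite linearP alin'.
- move=> b; have bil : is_bilinear (fun x y : H => antipode x * y).
    exact: mul_bil.
  transitivity (f (tensor_lift (fun x y => antipode x * y) (comul b))); last first.
    by rewrite antipodel linearZ rmorph1.
  have bil' : is_bilinear (fun x y : H => f (antipode x) * f y).
    by apply: mul_bil => // a u v; rewrite alin linearP.
  rewrite /convolution; elim/tensor_ind: (comul b) => [|x y|s s' hs hs'].
  + by rewrite !tensor_lift0 // linear0.
  + by rewrite !tensor_liftE // rmorphM.
  + by rewrite !tensor_liftD // linearD hs hs'.
- move=> b; have bil : is_bilinear (fun x y : K => x * antipode y).
    exact: mul_bil.
  rewrite -f_counit -antipoder f_comul.
  have bil' : is_bilinear (fun x y : H => f x * antipode (f y)).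
    by apply: mul_bil => // a u v; rewrite linearP alin'.
  have bil2 := tens_bil flin flin.
  rewrite /convolution; elim/tensor_ind: (comul b) => [|x y|s s' hs hs'].
  + by rewrite !tensor_lift0.
  + by rewrite !tensor_liftE.
  + by rewrite !tensor_liftD // hs hs'.
Qed.

(** * Matrices with entries in an algebra *)

Section AlgebraMatrices.
Variables (k : fieldType) (T : algType k).

Definition scalars m p (G : 'M[k]_(m, p)) : 'M[T]_(m, p) := map_mx (in_alg T) G.

Lemma scalarsE m p (G : 'M[k]_(m, p)) i j : scalars G i j = G i j *: 1.
Proof. by rewrite mxE. Qed.

Lemma scalarsM m p q (G : 'M[k]_(m, p)) (H : 'M[k]_(p, q)) :
  scalars (G *m H) = scalars G *m scalars H.
Proof. exact: map_mxM. Qed.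

Lemma scalars1 m : scalars (1%:M : 'M[k]_m) = 1%:M.
Proof. exact: map_mx1. Qed.

Lemma mul_scalarsl m p q (G : 'M[k]_(m, p)) (A : 'M[T]_(p, q)) i j :
  (scalars G *m A) i j = \sum_s G i s *: A s j.
Proof. by rewrite mxE; apply: eq_bigr => s _; rewrite mxE -scalerAl mul1r. Qed.

Lemma mul_scalarsr m p q (A : 'M[T]_(m, p)) (G : 'M[k]_(p, q)) i j :
  (A *m scalars G) i j = \sum_s G s j *: A i s.
Proof. by rewrite mxE; apply: eq_bigr => s _; rewrite mxE -scalerAr mulr1. Qed.

(** Transposition reverses products with matrices of scalars only. *)
Lemma trmx_scalarsl m p q (G : 'M[k]_(m, p)) (A : 'M[T]_(p, q)) :
  (scalars G *m A)^T = A^T *m scalars G^T.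
Proof.
apply/matrixP => i j; rewrite mxE mul_scalarsl mul_scalarsr.
by apply: eq_bigr => s _; rewrite !mxE.
Qed.

Lemma trmx_scalarsr m p q (A : 'M[T]_(m, p)) (G : 'M[k]_(p, q)) :
  (A *m scalars G)^T = scalars G^T *m A^T.
Proof.
apply/matrixP => i j; rewrite mxE mul_scalarsl mul_scalarsr.
by apply: eq_bigr => s _; rewrite !mxE.
Qed.

Lemma mul_mx_entry m p (A : 'M[T]_(m, p)) d i j : (A *m d%:M) i j = A i j * d.
Proof.
rewrite mxE (bigD1 j) //= mxE eqxx big1 ?addr0 // => s sj.
by rewrite mxE (negPf sj) mulr0.
Qed.

Lemma mul_entry_mx m p (A : 'M[T]_(m, p)) d i j : (d%:M *m A) i j = d * A i j.
Proof.
rewrite mxE (bigD1 i) //= mxE eqxx big1 ?addr0 // => s si.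
by rewrite mxE eq_sym (negPf si) mul0r.
Qed.

Lemma scalars_comm m p (G : 'M[k]_(m, p)) d : scalars G *m d%:M = d%:M *m scalars G.
Proof.
apply/matrixP => i j; rewrite mul_mx_entry mul_entry_mx mxE.
by rewrite -scalerAl -scalerAr mul1r mulr1.
Qed.

Lemma trmx_entry m p (A : 'M[T]_(m, p)) d : (A *m d%:M)^T = A^T *m d%:M.
Proof. by apply/matrixP => i j; rewrite mxE !mul_mx_entry mxE. Qed.

Lemma scalars_contract m n p (A : 'M[T]_(m, n)) (G : 'M[k]_n) (B : 'M[T]_(n, p)) i j :
  (A *m scalars G *m B) i j = contract G (fun s t => A i s * B t j).
Proof.
rewrite mxE /contract exchange_big; apply: eq_bigr => t _.
rewrite mul_scalarsr mulr_suml; apply: eq_bigr => s _.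
by rewrite scalerAl.
Qed.

End AlgebraMatrices.

Lemma map_scalars (k : fieldType) (T U : algType k) (f : {lrmorphism T -> U})
  m p (G : 'M[k]_(m, p)) : map_mx f (scalars T G) = scalars U G.
Proof. by apply/matrixP => i j; rewrite !mxE linearZ rmorph1. Qed.

Lemma contract_sum (k : fieldType) (n : nat) (V : lmodType k) (G : 'M[k]_n)
  (I : Type) (r : seq I) (f : I -> 'I_n -> 'I_n -> V) :
  contract G (fun s t => \sum_(i <- r) f i s t) = \sum_(i <- r) contract G (f i).
Proof.
elim: r => [|i r IH].
  rewrite big_nil /contract big1 // => s _; rewrite big1 // => t _.
  by rewrite big_nil scaler0.
rewrite big_cons -IH -contractD; apply: eq_contract => s t.
by rewrite big_cons.
Qed.

(** * The presented Hopf algebra *)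

Section GLHopf.
Variables (k : closedFieldType) (n : nat) (E : 'M[k]_n) (Eu : E \in unitmx).
Let F := invmx E.
Let FE : F *m E = 1%:M. Proof. exact: mulVmx. Qed.
Let EF : E *m F = 1%:M. Proof. exact: mulmxV. Qed.

Definition GL_relations (C : algType k) (a : 'M[C]_n) (d d' : C) :=
  [/\ d * d' = 1, d' * d = 1,
      a *m scalars C E *m a^T = scalars C E *m d'%:M
    & a^T *m d%:M *m scalars C F *m a = scalars C F].

Lemma GL_free_mor (C : algType k) (a : 'M[C]_n) (d d' : C) : GL_relations a d d' ->
  exists f : {lrmorphism GL_free k n -> C},
    [/\ forall i j, f (GL_a k i j) = a i j, f (GL_D k n) = d, f (GL_D' k n) = d'
      & forall b, ideal_gen (GL_relators E) b -> f b = 0].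
Proof.
move=> [dd' d'd row col].
pose f := alg_lift (fun x : GL_var n => match x with
  | inl ij => a ij.1 ij.2 | inr true => d | inr false => d' end).
have fa i j : f (GL_a k i j) = a i j by apply: alg_lift_var.
have fd : f (GL_D k n) = d by apply: alg_lift_var.
have fd' : f (GL_D' k n) = d' by apply: alg_lift_var.
exists f; split=> // b hb; apply: (hb _ (ker_ideal f)) => {hb b}.
move=> _ [[[->|->]|[s _ [t _ <-]]]|[i _ [j _ <-]]] /=.
- by rewrite rmorphB rmorphM rmorph1 /= fd fd' dd' subrr.
- by rewrite rmorphB rmorphM rmorph1 /= fd fd' d'd subrr.
- rewrite /GL_row_relator linearB linearZ /= fd' (contract_linear E _ (linearP f)).
  apply/eqP; rewrite subr_eq0; apply/eqP; have /matrixP /(_ s t) := row.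
  rewrite scalars_contract mul_mx_entry scalarsE -scalerAl mul1r => <-.
  by apply: eq_contract => i j; rewrite rmorphM /= !fa mxE.
- rewrite /GL_col_relator linearB linearZ rmorph1 /= (contract_linear F _ (linearP f)).
  apply/eqP; rewrite subr_eq0; apply/eqP; have /matrixP /(_ i j) := col.
  rewrite scalars_contract scalarsE => <-.
  apply: eq_contract => s t; rewrite mul_mx_entry !rmorphM /= fd !fa.
  by rewrite [a^T _ _]mxE.
Qed.

(** The matrix [a (x) a] satisfies the relations because contracting one tensor
    factor reduces them to those in the other. *)
Lemma GL_comul_relations (C : algType k) (a : 'M[C]_n) (d d' : C) : GL_relations a d d' ->
  GL_relations (\matrix_(i, j) \sum_s a i s *t a s j) (d *t d) (d' *t d').
Proof.
move=> [dd' d'd row col].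
split; rewrite ?tensM ?dd' ?d'd ?tens1 //.
- apply/matrixP => s t; rewrite scalars_contract mul_mx_entry scalarsE -scalerAl mul1r.
  transitivity (\sum_p \sum_q (a s p * a t q) *t
      (contract E (fun i j => a p i * a q j))).
    under eq_contract => i j do rewrite !mxE mulr_suml.
    rewrite contract_sum; apply: eq_bigr => p _.
    under eq_contract => i j do rewrite mulr_sumr.
    rewrite contract_sum; apply: eq_bigr => q _.
    rewrite (contract_linear E (h := fun y => (a s p * a t q) *t y)) => [|c u v].
      by apply: eq_contract => i j; rewrite tensM.
    by rewrite tensDr tensZr.
  have rowE p q : contract E (fun i j => a p i * a q j) = E p q *: d'.
    have /matrixP /(_ p q) := row.
    rewrite scalars_contract mul_mx_entry scalarsE -scalerAl mul1r => <-.
    by apply: eq_contract => i j; rewrite [a^T _ _]mxE.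
  under eq_bigr => p _ do under eq_bigr => q _ do rewrite rowE tensZr -tensZl.
  rewrite -tensZl -rowE (contract_linear E (h := fun x => x *t d')) => [|c u v].
    by apply: eq_bigr => p _; apply: eq_bigr => q _; rewrite tensZl.
  by rewrite tensDl tensZl.
- apply/matrixP => i j; rewrite scalars_contract scalarsE.
  transitivity (\sum_p \sum_q (contract F (fun s t => a s p * d * a t q)) *t
      (a p i * d * a q j)).
    under eq_contract => s t do rewrite mul_mx_entry !mxE !mulr_suml.
    rewrite contract_sum; apply: eq_bigr => p _.
    under eq_contract => s t do rewrite mulr_sumr.
    rewrite contract_sum; apply: eq_bigr => q _.
    rewrite (contract_linear F (h := fun x => x *t (a p i * d * a q j))) => [|c u v].
      by apply: eq_contract => s t; rewrite !tensM.
    by rewrite tensDl tensZl.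
  have colE p q : contract F (fun s t => a s p * d * a t q) = F p q *: 1.
    have /matrixP /(_ p q) := col.
    rewrite scalars_contract scalarsE => <-.
    by apply: eq_contract => s t; rewrite mul_mx_entry [a^T _ _]mxE.
  under eq_bigr => p _ do under eq_bigr => q _ do rewrite colE tensZl -tensZr.
  rewrite -tens1 -tensZr -colE (contract_linear F (h := fun y => 1 *t y)) => [|c u v].
    by apply: eq_bigr => p _; apply: eq_bigr => q _; rewrite tensZr.
  by rewrite tensDr tensZr.
Qed.

(** Both relations of the presentation say that this matrix is inverse to [a], from
    one side each. *)
Definition GL_antipode_mx (C : algType k) (a : 'M[C]_n) (d : C) : 'M[C]_n :=
  scalars C E *m a^T *m d%:M *m scalars C F.

Section Relations.
Variables (C : algType k) (a : 'M[C]_n) (d d' : C).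
Hypothesis adP : GL_relations a d d'.
Local Notation b := (GL_antipode_mx a d).

Lemma mulmx_antipodel : b *m a = 1%:M.
Proof.
have [_ _ _ col] := adP.
rewrite /GL_antipode_mx -!mulmxA [_ *m (_ *m (_ *m a))](_ : _ = scalars C F).
  by rewrite -scalarsM EF scalars1.
by rewrite -[RHS]col !mulmxA.
Qed.

Lemma mulmx_antipoder : a *m b = 1%:M.
Proof.
have [_ d'd row _] := adP.
rewrite /GL_antipode_mx !mulmxA row -!mulmxA [d'%:M *m _]mulmxA -scalar_mxM d'd mul1mx.
by rewrite -scalarsM EF scalars1.
Qed.

(** In the opposite algebra the relations are read from right to left, hence
    transposed; they follow from [b] being the inverse of [a]. *)
Lemma GL_antipode_relations :
  @GL_relations (opposite C) b (d' : opposite C) (d : opposite C).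
Proof.
have [dd' d'd row col] := adP.
split=> //.
- apply/matrixP => s t; rewrite scalars_contract mul_mx_entry scalarsE.
  transitivity ((b *m scalars C E^T *m b^T) t s).
    rewrite scalars_contract /contract exchange_big.
    by apply: eq_bigr => i _; apply: eq_bigr => j _; rewrite !mxE.
  have -> : b *m scalars C E^T *m b^T = d%:M *m scalars C E^T.
    rewrite {2}/GL_antipode_mx trmx_scalarsr trmx_entry trmx_scalarsl trmxK.
    rewrite !mulmxA -[b *m _ *m _]mulmxA -scalarsM -trmx_mul FE trmx1 scalars1 mulmx1.
    by rewrite mulmx_antipodel mul1mx scalars_comm.
  by rewrite mul_entry_mx !mxE.
- apply/matrixP => i j; rewrite scalars_contract scalarsE.
  transitivity ((b^T *m d'%:M *m scalars C F^T *m b) j i).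
    rewrite scalars_contract /contract exchange_big.
    apply: eq_bigr => s _; apply: eq_bigr => t _.
    rewrite !mul_mx_entry ![b^T _ _]mxE [F^T _ _]mxE; congr (_ *: _).
    by rewrite -mulrA.
  have -> : b^T *m d'%:M *m scalars C F^T *m b = scalars C F^T.
    rewrite {1}/GL_antipode_mx trmx_scalarsr trmx_entry trmx_scalarsl trmxK.
    rewrite -!mulmxA [d%:M *m _]mulmxA -scalar_mxM dd' mul1mx.
    rewrite [scalars C E^T *m _]mulmxA -scalarsM -trmx_mul FE trmx1 scalars1 mul1mx.
    by rewrite mulmx_antipoder mulmx1.
  by rewrite !mxE.
Qed.
End Relations.

Definition GL_generator (C : algType k) (a : 'M[C]_n) (d d' : C) : set C :=
  [set x | (exists i j, x = a i j) \/ x = d \/ x = d'].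

Section HopfAxioms.
Variables (C : algType k) (a : 'M[C]_n) (d d' : C).
Variables (Delta : {lrmorphism C -> tensor C C}) (eps : {lrmorphism C -> k^o}).
Variable S : {lrmorphism C -> opposite C}.
Hypothesis adP : GL_relations a d d'.
Hypothesis C_gen : generated_by (GL_generator a d d').
Hypotheses (Delta_a : forall i j, Delta (a i j) = \sum_s a i s *t a s j)
  (Delta_d : Delta d = d *t d) (Delta_d' : Delta d' = d' *t d').
Hypotheses (eps_a : forall i j, eps (a i j) = (i == j)%:R :> k)
  (eps_d : eps d = 1 :> k) (eps_d' : eps d' = 1 :> k).
Hypotheses (S_a : forall i j, S (a i j) = GL_antipode_mx a d i j :> C)
  (S_d : S d = d' :> C) (S_d' : S d' = d :> C).

Lemma GL_coassoc b :
  tensor_lift (fun x y => tensor_lift (fun y1 y2 => (x *t y1) *t y2) (Delta y)) (Delta b)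
  = tensor_lift (fun x y => Delta x *t y) (Delta b).
Proof.
have abil := @assoc_bil k C.
have lbil := coassocl_bil (linearP Delta); have rbil := coassocr_bil (linearP Delta).
move: b; apply: coassoc_gen C_gen _ => _ [[i [j ->]]|[->|->]].
- rewrite Delta_a !tensor_lift_sum //.
  under eq_bigr => s _.
    rewrite tensor_liftE // Delta_a tensor_lift_sum //.
    under eq_bigr => t _ do rewrite tensor_liftE //.
  over.
  rewrite exchange_big /=; apply: eq_bigr => t _.
  rewrite tensor_liftE // Delta_a.
  have D : {morph (fun u : tensor C C => u *t a t j) : u v / u + v}.
    by move=> u v; rewrite tensDl.
  by rewrite (big_morph _ D (tens0l _ _)).
- by rewrite Delta_d !tensor_liftE // Delta_d tensor_liftE.
- by rewrite Delta_d' !tensor_liftE // Delta_d' tensor_liftE.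
Qed.

Lemma GL_counitl b : tensor_lift (fun x y => (eps x : k) *: y) (Delta b) = b.
Proof.
have bil := counitl_bil (linearP eps : scalar eps); move: b; apply: counitl_gen C_gen _ => _ [[i [j ->]]|[->|->]].
- rewrite Delta_a tensor_lift_sum // (bigD1 i) //= tensor_liftE // eps_a eqxx scale1r.
  by rewrite big1 ?addr0 // => s si; rewrite tensor_liftE // eps_a eq_sym (negPf si) scale0r.
- by rewrite Delta_d tensor_liftE // eps_d scale1r.
- by rewrite Delta_d' tensor_liftE // eps_d' scale1r.
Qed.

Lemma GL_counitr b : tensor_lift (fun x y => (eps y : k) *: x) (Delta b) = b.
Proof.
have bil := counitr_bil (linearP eps : scalar eps); move: b; apply: counitr_gen C_gen _ => _ [[i [j ->]]|[->|->]].
- rewrite Delta_a tensor_lift_sum // (bigD1 j) //= tensor_liftE // eps_a eqxx scale1r.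
  by rewrite big1 ?addr0 // => s si; rewrite tensor_liftE // eps_a (negPf si) scale0r.
- by rewrite Delta_d tensor_liftE // eps_d scale1r.
- by rewrite Delta_d' tensor_liftE // eps_d' scale1r.
Qed.

Lemma GL_antipodel b :
  tensor_lift (fun x y => (S x : C) * y) (Delta b) = (eps b : k) *: 1.
Proof.
have [dd' d'd _ _] := adP.
have bil := antipodel_bil S; move: b; apply: (antipodel_gen C_gen (S := S)) => _ [[i [j ->]]|[->|->]].
- rewrite Delta_a tensor_lift_sum // eps_a.
  have /matrixP /(_ i j) := mulmx_antipodel adP; rewrite !mxE => e.
  rewrite scaler_nat -e; apply: eq_bigr => s _.
  by rewrite tensor_liftE // S_a.
- by rewrite Delta_d tensor_liftE // eps_d scale1r S_d.
- by rewrite Delta_d' tensor_liftE // eps_d' scale1r S_d'.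
Qed.

Lemma GL_antipoder b :
  tensor_lift (fun x y => x * (S y : C)) (Delta b) = (eps b : k) *: 1.
Proof.
have [dd' d'd _ _] := adP.
have bil := antipoder_bil S; move: b; apply: (antipoder_gen C_gen (S := S)) => _ [[i [j ->]]|[->|->]].
- rewrite Delta_a tensor_lift_sum // eps_a.
  have /matrixP /(_ i j) := mulmx_antipoder adP; rewrite !mxE => e.
  rewrite scaler_nat -e; apply: eq_bigr => s _.
  by rewrite tensor_liftE // S_a.
- by rewrite Delta_d tensor_liftE // eps_d scale1r S_d.
- by rewrite Delta_d' tensor_liftE // eps_d' scale1r S_d'.
Qed.

(** The square of the antipode is an inner automorphism by [d'] composed with
    the conjugation by the asymmetry of the form. *)
Lemma GL_antipode_square i j : S (S (a i j)) =
  (d'%:M *m scalars C (E *m F^T) *m a *m scalars C (E^T *m F) *m d%:M) i j :> C.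
Proof.
have SZ c x : (S (c *: x) : C) = c *: (S x : C) by rewrite linearZ.
have SM x y : (S (x * y) : C) = (S y : C) * (S x : C) by rewrite rmorphM.
have Ssum (f : 'I_n -> C) : (S (\sum_s f s) : C) = \sum_s (S (f s) : C) by rewrite linear_sum.
have e : S (GL_antipode_mx a d i j) =
    (scalars C E *m (d'%:M *m (GL_antipode_mx a d)^T) *m scalars C F) i j :> C.
  rewrite -[GL_antipode_mx a d i j]/((scalars C E *m a^T *m d%:M *m scalars C F) i j).
  rewrite !mul_scalarsr Ssum; apply: eq_bigr => s _; rewrite SZ; congr (_ *: _).
  rewrite mul_mx_entry SM S_d !mul_scalarsl Ssum mulr_sumr; apply: eq_bigr => t _.
  by rewrite SZ mul_entry_mx -scalerAr ![_^T _ _]mxE S_a.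
have -> : (S (S (a i j)) : C) = S (GL_antipode_mx a d i j) by rewrite S_a.
rewrite e; congr (fun_of_matrix _ i j).
rewrite /GL_antipode_mx trmx_scalarsr trmx_entry trmx_scalarsl trmxK.
rewrite !scalarsM !mulmxA scalars_comm -[_ *m d%:M *m scalars C F]mulmxA.
by rewrite -[d%:M *m scalars C F]scalars_comm !mulmxA.
Qed.

End HopfAxioms.

End GLHopf.

Section GLConstruction.
Variables (k : closedFieldType) (n : nat) (E : 'M[k]_n) (Eu : E \in unitmx).

Lemma GL_counit_relations : GL_relations E (1%:M : 'M[k^o]_n) 1 1.
Proof.
split; rewrite ?mulr1 // ?trmx1 ?mulmx1 ?mul1mx //.
Qed.

(** The counit shows that the relations are consistent. *)
Lemma GL_proper : ~ ideal_gen (GL_relators E) 1.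
Proof.
have [f [_ _ _ f0]] := GL_free_mor GL_counit_relations.
by move=> /f0; rewrite rmorph1 => /eqP; rewrite oner_eq0.
Qed.

Definition GL_hopf of E \in unitmx : Type := quotient_algebra (ideal_gen_ideal (GL_relators E)) GL_proper.
Local Notation GL := (GL_hopf Eu).
HB.instance Definition _ := GRing.Algebra.on GL.

Definition GL_pi : {lrmorphism GL_free k n -> GL} :=
  quotient_proj (ideal_gen_ideal (GL_relators E)) GL_proper.
Definition gl_a : 'M[GL]_n := \matrix_(i, j) GL_pi (GL_a k i j).
Definition gl_D : GL := GL_pi (GL_D k n).
Definition gl_D' : GL := GL_pi (GL_D' k n).

Lemma GL_pi_surj x : exists b, GL_pi b = x.
Proof. exact: quotient_proj_surj. Qed.

Lemma GL_pi_eq0 b : GL_pi b = 0 <-> ideal_gen (GL_relators E) b.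
Proof. exact: quotient_proj_eq0. Qed.
End GLConstruction.

Lemma GL_relations_of_mor (k : closedFieldType) (n : nat) (E : 'M[k]_n) (C : algType k)
  (f : {lrmorphism GL_free k n -> C}) :
  (forall b, GL_relators E b -> f b = 0) ->
  GL_relations E (\matrix_(i, j) f (GL_a k i j)) (f (GL_D k n)) (f (GL_D' k n)).
Proof.
move=> h; split.
- apply/eqP; rewrite -subr_eq0; apply/eqP; rewrite -(rmorph1 f) -rmorphM -rmorphB.
  by apply: h; left; left; left.
- apply/eqP; rewrite -subr_eq0; apply/eqP; rewrite -(rmorph1 f) -rmorphM -rmorphB.
  by apply: h; left; left; right.
- apply/matrixP => s t; rewrite scalars_contract mul_mx_entry scalarsE -scalerAl mul1r.
  have := h (GL_row_relator E s t) (or_introl (or_intror (ex_intro2 _ _ s I (ex_intro2 _ _ t I erefl)))).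
  rewrite /GL_row_relator linearB linearZ /= (contract_linear E _ (linearP f)).
  move/eqP; rewrite subr_eq0 => /eqP <-; apply: eq_contract => i j.
  by rewrite rmorphM !mxE.
- apply/matrixP => i j; rewrite scalars_contract scalarsE.
  have := h (GL_col_relator E i j) (or_intror (ex_intro2 _ _ i I (ex_intro2 _ _ j I erefl))).
  rewrite /GL_col_relator linearB linearZ /= (contract_linear (invmx E) _ (linearP f)) rmorph1.
  move/eqP; rewrite subr_eq0 => /eqP <-; apply: eq_contract => s t.
  by rewrite mul_mx_entry !rmorphM !mxE.
Qed.

Lemma GL_generated_of_mor (k : closedFieldType) (n : nat) (C : algType k)
  (f : {lrmorphism GL_free k n -> C}) : (forall x, exists b, f b = x) ->
  generated_by (GL_generator (\matrix_(i, j) f (GL_a k i j)) (f (GL_D k n)) (f (GL_D' k n))).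
Proof.
move=> fsurj P P1 PX PM PD x; have [b <-] := fsurj x; move: b {x}.
apply: free_alg_ind => [|[[i j]|[]]|g h Pg Ph|c g h Pg Ph].
- by rewrite rmorph1.
- by apply: PX; left; exists i, j; rewrite mxE.
- by apply: PX; right; left.
- by apply: PX; right; right.
- by rewrite rmorphM; apply: PM.
- by rewrite linearP; apply: PD.
Qed.

Section GLHopf.
Variables (k : closedFieldType) (n : nat) (E : 'M[k]_n) (Eu : E \in unitmx).
Local Notation GL := (GL_hopf Eu).
Local Notation a := (gl_a Eu).
Local Notation d := (gl_D Eu).
Local Notation d' := (gl_D' Eu).

Lemma gl_relations : GL_relations E a d d'.
Proof.
apply: (GL_relations_of_mor (f := GL_pi Eu)) => b hb; apply/GL_pi_eq0.
exact: sub_ideal_gen.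
Qed.

Lemma GL_mor (C : algType k) (x : 'M[C]_n) (y y' : C) : GL_relations E x y y' ->
  exists f : {lrmorphism GL -> C}, [/\ forall i j, f (a i j) = x i j, f d = y & f d' = y'].
Proof.
move=> /GL_free_mor [f [fa fd fd' f0]].
have [g gE] := factor_through (@GL_pi_surj _ _ _ Eu) (fun b hb => f0 b ((GL_pi_eq0 Eu b).1 hb)).
exists g; split=> [i j||]; last first.
- by rewrite /gl_D' gE.
- by rewrite /gl_D gE.
by rewrite mxE gE.
Qed.

Lemma GL_generated : generated_by (GL_generator a d d').
Proof. exact: (GL_generated_of_mor (GL_pi_surj (Eu := Eu))). Qed.

Let Delta_ex := GL_mor (GL_comul_relations gl_relations).
Let eps_ex := GL_mor (GL_counit_relations E).
Let S_ex := GL_mor (GL_antipode_relations Eu gl_relations).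

Definition gl_comul : {lrmorphism GL -> tensor GL GL} := sval (cid Delta_ex).
Definition gl_counit : {lrmorphism GL -> k^o} := sval (cid eps_ex).
Definition gl_antipode : {lrmorphism GL -> opposite GL} := sval (cid S_ex).

Lemma gl_comulE : [/\ forall i j, gl_comul (a i j) = \sum_s a i s *t a s j,
  gl_comul d = d *t d & gl_comul d' = d' *t d'].
Proof.
have [h1 h2 h3] := svalP (cid Delta_ex); split=> // i j.
by rewrite [LHS]h1 mxE.
Qed.

Lemma gl_counitE : [/\ forall i j, gl_counit (a i j) = (i == j)%:R :> k,
  gl_counit d = 1 :> k & gl_counit d' = 1 :> k].
Proof.
have [h1 h2 h3] := svalP (cid eps_ex); split=> // i j.
by rewrite [LHS]h1 mxE.
Qed.

Lemma gl_antipodeE : [/\ forall i j, gl_antipode (a i j) = GL_antipode_mx E a d i j :> GL,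
  gl_antipode d = d' :> GL & gl_antipode d' = d :> GL].
Proof. exact: svalP (cid S_ex). Qed.

Let cE := gl_comulE.
Let eE := gl_counitE.
Let sE := gl_antipodeE.

Lemma gl_comulA b :
  tensor_lift (fun x y => tensor_lift (fun y1 y2 => (x *t y1) *t y2) (gl_comul y)) (gl_comul b)
  = tensor_lift (fun x y => gl_comul x *t y) (gl_comul b).
Proof. by case: cE => h1 h2 h3; apply: (GL_coassoc GL_generated h1 h2 h3). Qed.

Lemma gl_counitl b : tensor_lift (fun x y => (gl_counit x : k) *: y) (gl_comul b) = b.
Proof.
by case: cE => h1 h2 h3; case: eE => h4 h5 h6; apply: (GL_counitl GL_generated h1 h2 h3 h4 h5 h6).
Qed.

Lemma gl_counitr b : tensor_lift (fun x y => (gl_counit y : k) *: x) (gl_comul b) = b.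
Proof.
by case: cE => h1 h2 h3; case: eE => h4 h5 h6; apply: (GL_counitr GL_generated h1 h2 h3 h4 h5 h6).
Qed.

HB.instance Definition _ := Algebra_isBialgebra.Build k GL
  (linearP gl_comul) (rmorph1 gl_comul, rmorphM gl_comul)
  (linearP gl_counit) (rmorph1 gl_counit, rmorphM gl_counit)
  gl_comulA gl_counitl gl_counitr.

Definition gl_S (x : GL) : GL := gl_antipode x.

Lemma gl_S_linear : linear gl_S.
Proof. exact: (linearP gl_antipode). Qed.

Lemma gl_antipodel (x : GL) :
  tensor_lift (fun x y => gl_S x * y) (comul x) = counit x *: 1.
Proof.
case: cE => h1 h2 h3; case: eE => h4 h5 h6; case: sE => h7 h8 h9.
exact: (GL_antipodel Eu gl_relations GL_generated h1 h2 h3 h4 h5 h6 h7 h8 h9 x).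
Qed.

Lemma gl_antipoder (x : GL) :
  tensor_lift (fun x y => x * gl_S y) (comul x) = counit x *: 1.
Proof.
case: cE => h1 h2 h3; case: eE => h4 h5 h6; case: sE => h7 h8 h9.
exact: (GL_antipoder Eu gl_relations GL_generated h1 h2 h3 h4 h5 h6 h7 h8 h9 x).
Qed.

HB.instance Definition _ := Bialgebra_isHopf.Build k GL gl_S_linear gl_antipodel gl_antipoder.

Lemma gl_antipode_square i j : antipode (antipode (a i j : GL)) =
  (d'%:M *m scalars GL (E *m (invmx E)^T) *m a *m scalars GL (E^T *m invmx E) *m d%:M) i j.
Proof.
case: sE => h7 h8 h9; exact: (GL_antipode_square h7 h8).
Qed.

End GLHopf.

(** Packaged by its properties, so that no later argument depends on the
    construction of the quotient. *)
Lemma GL_hopf_exists (k : closedFieldType) (n : nat) (E : 'M[k]_n) :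
  E \in unitmx ->
  exists (K : hopfAlgType k) (p : {lrmorphism GL_free k n -> K}),
  let a : 'M[K]_n := \matrix_(i, j) p (GL_a k i j) in
  let d := p (GL_D k n) in let d' := p (GL_D' k n) in
  [/\ is_quotient (ideal_gen (GL_relators E)) p,
      [/\ forall i j, comul (a i j) = \sum_s a i s *t a s j,
          comul d = d *t d & comul d' = d' *t d'],
      [/\ forall i j, counit (a i j) = (i == j)%:R, counit d = 1 & counit d' = 1]
    & forall i j, antipode (antipode (a i j)) =
        (d'%:M *m scalars K (E *m (invmx E)^T) *m a *m scalars K (E^T *m invmx E) *m d%:M) i j].
Proof.
move=> Eu; exists (GL_hopf Eu), (GL_pi Eu) => a d d'; split.
- by split; [exact: GL_pi_surj | exact: GL_pi_eq0].
- exact: gl_comulE.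
- exact: gl_counitE.
- exact: gl_antipode_square.
Qed.

(** * The Hopf envelope is the presented Hopf algebra *)

Section BialgebraMorphisms.
Variable k : fieldType.

Lemma tens_map_comp (A B C : algType k) (f : {lrmorphism A -> B}) (g : {lrmorphism B -> C}) t :
  tensor_lift (fun x y => g x *t g y) (tensor_lift (fun x y => f x *t f y) t) =
  tensor_lift (fun x y => g (f x) *t g (f y)) t.
Proof.
have bf := tens_bil (linearP f) (linearP f); have bg := tens_bil (linearP g) (linearP g).
have bgf : is_bilinear (fun x y => g (f x) *t g (f y)) by exact: (tens_bil (linearP (g \o f)) (linearP (g \o f))).
elim/tensor_ind: t => [|x y|s t hs ht]; first by rewrite !tensor_lift0.
  by rewrite !tensor_liftE.
by rewrite !tensor_liftD // hs ht.
Qed.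

Lemma bialg_mor_comp (A B C : bialgType k) (f : {lrmorphism A -> B}) (g : {lrmorphism B -> C}) :
  is_bialg_mor f -> is_bialg_mor g -> is_bialg_mor (g \o f).
Proof.
move=> [f1 f2] [g1 g2]; split=> b /=; last by rewrite g2 f2.
by rewrite g1 f1 tens_map_comp.
Qed.

Lemma bialg_mor_gen (B C : bialgType k) (f : {lrmorphism B -> C}) (X : set B) :
  generated_by X ->
  (forall x, X x -> comul (f x) = tensor_lift (fun x y => f x *t f y) (comul x)) ->
  (forall x, X x -> counit (f x) = counit x) -> is_bialg_mor f.
Proof.
move=> Xgen hD he; have bil := tens_bil (linearP f) (linearP f).
have [c1 cM] := @comul_monoid k B; have [c1' cM'] := @comul_monoid k C.
have [e1 eM] := @counit_monoid k B; have [e1' eM'] := @counit_monoid k C.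
split; apply: Xgen => //.
- by rewrite rmorph1 c1 c1' -tens1 tensor_liftE // rmorph1.
- move=> u v hu hv; rewrite rmorphM cM' cM hu hv tensor_lift_mul // => x y x' y'.
  by rewrite !rmorphM tensM.
- by move=> c u v hu hv; rewrite linearP !comul_linear tensor_lift_linear // hu hv.
- by rewrite rmorph1 e1 e1'.
- by move=> u v hu hv; rewrite rmorphM eM eM' hu hv.
- by move=> c u v hu hv; rewrite linearP !counit_scalar hu hv.
Qed.

Lemma bialg_mor_factor (A B C : bialgType k) (p : {lrmorphism A -> B})
  (f : {lrmorphism A -> C}) (g : {lrmorphism B -> C}) :
  (forall b, exists a, p a = b) -> (forall a, g (p a) = f a) ->
  is_bialg_mor p -> is_bialg_mor f -> is_bialg_mor g.
Proof.
move=> psurj gp [p1 p2] [f1 f2]; split=> b; have [a <-] := psurj b.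
  rewrite gp f1 p1 tens_map_comp; congr (tensor_lift _ _).
  by apply/funext => x; apply/funext => y; rewrite !gp.
by rewrite gp f2 p2.
Qed.

Lemma bialg_mor_id (A : bialgType k) : is_bialg_mor (idfun : {lrmorphism A -> A}).
Proof.
have idlin : linear (idfun : A -> A) by [].
have bil := tens_bil idlin idlin.
split=> // b /=; elim/tensor_ind: (comul b) => [|x y|s t {1}-> {1}->].
- by rewrite tensor_lift0.
- by rewrite tensor_liftE.
- by rewrite tensor_liftD.
Qed.

End BialgebraMorphisms.

Lemma mx_generated (k : fieldType) (n : nat) :
  generated_by [set x | exists i j, x = mx_gen k i j :> mx_bialg k n].
Proof.
move=> P P1 PX PM PD; apply: mx_bialg_ind => // i j.
by apply: PX; exists i, j.
Qed.

(** The coefficient of [v_s v_t] is an entry in a representation by strictly upper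
    triangular 3 x 3 matrices, where the other products of two variables vanish. *)
Lemma quadratic_coefficient (k : fieldType) (n : nat) (s t : 'I_n) :
  exists c : free_alg k 'I_n -> k^o, linear c /\
    forall i j, c (fvar i * fvar j) = ((i == s) && (j == t))%:R :> k.
Proof.
pose M i : 'M[k]_3 := (i == s)%:R *: delta_mx 0 1 + (i == t)%:R *: delta_mx 1 2%:R.
have ME i : alg_lift M (fvar i) = M i by exact: alg_lift_var.
exists (fun b => alg_lift M b 0 2%:R); split.
  by move=> a u v; rewrite linearP !mxE.
move=> i j /=; rewrite rmorphM /= !ME /M mxE !big_ord_recl big_ord0 !mxE /=.
rewrite !(mulr0, mul0r, mulr1, addr0, add0r).
by rewrite -natrM mulnb.
Qed.

Section CoactionRelation.
Variables (k : closedFieldType) (n : nat) (E : 'M[k]_n) (H : hopfAlgType k).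
Variables (a : 'I_n -> 'I_n -> H) (D : H).

(** Comparing the coefficients of [v_s v_t] in the two values of the coaction at
    the relation of [A]. *)
Lemma codeterminant_row D' : coaction a (relator E) = relator E *t D' ->
  (\matrix_(i, j) a i j) *m scalars H E *m (\matrix_(i, j) a i j)^T = scalars H E *m D'%:M.
Proof.
move=> e; apply/matrixP => s t; rewrite scalars_contract mul_mx_entry scalarsE -scalerAl mul1r.
have [c [clin cE]] := quadratic_coefficient k s t.
have [C Ce] := linear_pack clin; rewrite {}Ce in clin cE.
have bil : is_bilinear (fun (x : free_alg k 'I_n) (y : H) => (C x : k) *: y).
  split=> [y u v w|x u v w]; first by rewrite linearP scalerDl scalerA.
  by rewrite scalerDr !scalerA mulrC.
have := congr1 (tensor_lift (fun x y => (C x : k) *: y)) e.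
rewrite tensor_liftE //.
have -> : (C (relator E) : k) = E s t.
  rewrite /relator linear_sum (bigD1 s) //= linear_sum (bigD1 t) //= linearZ /= cE !eqxx.
  rewrite !big1 ?addr0 => [|i is_|j jt]; first exact: mulr1.
    by rewrite linear_sum big1 // => j _; rewrite linearZ /= cE (negPf is_); apply: mulr0.
  by rewrite linearZ /= cE (negPf jt) andbF; apply: mulr0.
move=> <-; rewrite -[relator E]/(contract E (fun i j => fvar i * fvar j)).
rewrite (contract_linear E _ (linearP (coaction a))).
rewrite (contract_linear E _ (tensor_lift_linear bil)).
apply: eq_contract => i j; rewrite rmorphM /= !alg_lift_var mulr_suml tensor_lift_sum //.
have Ce p q : tensor_lift (fun x y => (C x : k) *: y) ((fvar p *t a p i) * (fvar q *t a q j)) =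
    ((p == s) && (q == t))%:R *: (a p i * a q j).
  by rewrite tensM tensor_liftE // cE.
under eq_bigr => p _ do [rewrite mulr_sumr tensor_lift_sum //; under eq_bigr => q _ do rewrite Ce].
rewrite (bigD1 s) //= [X in _ + X]big1 ?addr0 => [|p ps]; last first.
  by rewrite big1 // => q _; rewrite (negPf ps) scale0r.
rewrite (bigD1 t) //= big1 ?addr0 => [|q qt]; last first.
  by rewrite (negPf qt) andbF scale0r.
by rewrite !eqxx scale1r !mxE.
Qed.

End CoactionRelation.

Lemma inverse_unique (T : pzRingType) (x y z : T) : x * y = 1 -> y * z = 1 -> x = z.
Proof. by move=> xy yz; rewrite -[x]mulr1 -yz mulrA xy mul1r. Qed.

Lemma grouplike_inverse (k : fieldType) (H : bialgType k) (x y : H) :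
  grouplike x -> x * y = 1 -> y * x = 1 -> grouplike y.
Proof.
move=> [Dx ex] xy yx; have [c1 cM] := @comul_monoid k H; have [e1 eM] := @counit_monoid k H.
split.
  apply: (@inverse_unique _ _ (x *t x)); first by rewrite -Dx -cM yx c1.
  by rewrite tensM xy tens1.
by rewrite -[LHS]mul1r -ex -eM xy e1.
Qed.

(** A matrix coalgebra inside a Hopf algebra is inverted by its antipode. *)
Lemma antipode_matrix (k : fieldType) (n : nat) (H : hopfAlgType k) (a : 'M[H]_n) :
  (forall i j, comul (a i j) = \sum_s a i s *t a s j) ->
  (forall i j, counit (a i j) = (i == j)%:R) ->
  map_mx antipode a *m a = 1%:M /\ a *m map_mx antipode a = 1%:M.
Proof.
move=> Da ea.
have idlin : linear (id : H -> H) by [].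
have bill := mul_bil (@antipode_linear k H) idlin; have bilr := mul_bil idlin (@antipode_linear k H).
have delta i j : (i == j)%:R *: 1 = (1%:M : 'M[H]_n) i j.
  by rewrite mxE scaler_nat.
split; apply/matrixP => i j; rewrite -delta -ea mxE.
  rewrite -antipodel Da tensor_lift_sum //; apply: eq_bigr => s _.
  by rewrite tensor_liftE // mxE.
rewrite -antipoder Da tensor_lift_sum //; apply: eq_bigr => s _.
by rewrite tensor_liftE // mxE.
Qed.

Lemma contract_exchange (k : fieldType) (n : nat) (V : lmodType k) (G H : 'M[k]_n)
  (f : 'I_n -> 'I_n -> 'I_n -> 'I_n -> V) :
  contract G (fun s t => contract H (f s t)) = contract H (fun i j => contract G (fun s t => f s t i j)).
Proof.
rewrite {2}/contract contract_sum; apply: eq_bigr => i _.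
by rewrite contract_sum; apply: eq_bigr => j _; rewrite contractZ.
Qed.

Section Envelope.
Variables (k : closedFieldType) (n : nat) (n_gt0 : (0 < n)%N).
Variables (E : 'M[k]_n) (Eu : E \in unitmx).
Variables (OM : bialgType k) (pM : {lrmorphism mx_bialg k n -> OM}) (OM_def : is_OM E pM).
Variables (OGL : hopfAlgType k) (iota : {lrmorphism OM -> OGL}).
Hypothesis OGL_def : is_hopf_envelope iota.
Variables (D D' : OGL) (D_grouplike : grouplike D) (DD' : D * D' = 1) (D'D : D' * D = 1).
Let alpha : 'M[OGL]_n := \matrix_(i, j) iota (pM (mx_gen k i j)).
Hypothesis D_row : alpha *m scalars OGL E *m alpha^T = scalars OGL E *m D'%:M.

Let iota_mor : is_bialg_mor (iota \o pM).
Proof. exact: bialg_mor_comp OM_def.1 OGL_def.1. Qed.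

Lemma envelope_comul i j : comul (alpha i j) = \sum_s alpha i s *t alpha s j.
Proof.
have bil := tens_bil (linearP (iota \o pM)) (linearP (iota \o pM)).
rewrite mxE [LHS]iota_mor.1 [comul _]mx_comul_gen tensor_lift_sum //.
by apply: eq_bigr => s _; rewrite tensor_liftE // !mxE.
Qed.

Lemma envelope_counit i j : counit (alpha i j) = (i == j)%:R.
Proof. by rewrite mxE [LHS]iota_mor.2 [LHS]mx_counit_gen. Qed.

(** The antipode is a left inverse of the matrix [alpha], and the row relation
    gives a right inverse; that they agree is the column relation. *)
Lemma envelope_relations : GL_relations E alpha D D'.
Proof.
split=> //; have [Sl _] := antipode_matrix envelope_comul envelope_counit.
pose G := scalars OGL E *m alpha^T *m D%:M *m scalars OGL (invmx E).
have aG : alpha *m G = 1%:M.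
  rewrite /G !mulmxA D_row -[_ *m D'%:M *m D%:M]mulmxA -scalar_mxM D'D mulmx1.
  by rewrite -scalarsM mulmxV // scalars1.
have SG : map_mx antipode alpha = G by rewrite -[LHS]mulmx1 -aG mulmxA Sl mul1mx.
have := congr1 (mulmx (scalars OGL (invmx E))) Sl; rewrite SG mulmx1 /G !mulmxA.
by rewrite -scalarsM mulVmx // scalars1 mul1mx.
Qed.

(** Let [K] be the presented Hopf algebra.  The relations hold in the envelope,
    which gives [h] from [K]; those of [O(M)] hold in [K], and the universal property
    gives [g] in the other direction.  The uniqueness part of it makes [h \o g] the
    identity, and [g \o h] is the identity on generators. *)
Lemma envelope_presentation : exists f : {lrmorphism GL_free k n -> OGL},
  [/\ is_quotient (ideal_gen (GL_relators E)) f,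
      forall i j, f (GL_a k i j) = alpha i j, f (GL_D k n) = D, f (GL_D' k n) = D'
    & forall i j, antipode (antipode (alpha i j)) =
        (D'%:M *m scalars OGL (E *m (invmx E)^T) *m alpha *m
         scalars OGL (E^T *m invmx E) *m D%:M) i j].
Proof.
have [f0 [f0a f0D f0D' f0I]] := GL_free_mor envelope_relations.
have [K [p [[psurj pker] [Ka Kd Kd'] [ea ed ed'] KSS]]] := GL_hopf_exists Eu.
set a := (\matrix_(i, j) p (GL_a k i j) : 'M[K]_n) in Ka ea KSS.
set d := p (GL_D k n) in Kd ed KSS; set d' := p (GL_D' k n) in Kd' ed' KSS.
have [h hp] := factor_through psurj (fun b hb => f0I b ((pker b).1 hb)).
have ha i j : h (a i j) = alpha i j by rewrite mxE hp f0a.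
have hd : h d = D by rewrite hp f0D.
have hd' : h d' = D' by rewrite hp f0D'.
have [_ d'd Krow _] : GL_relations E a d d'.
  by apply: (GL_relations_of_mor (f := p)) => b hb; apply/pker; apply: sub_ideal_gen.
have Kgen : generated_by (GL_generator a d d') := GL_generated_of_mor psurj.
have D'_grouplike := grouplike_inverse D_grouplike DD' D'D.
have h_mor : is_hopf_mor h.
  apply: bialg_mor_hopf; have bil := tens_bil (linearP h) (linearP h).
  apply: (bialg_mor_gen Kgen) => _ [[i [j ->]]|[->|->]].
  - rewrite ha envelope_comul Ka tensor_lift_sum //; apply: eq_bigr => s _.
    by rewrite tensor_liftE // !ha.
  - by rewrite hd Kd tensor_liftE // hd D_grouplike.1.
  - by rewrite hd' Kd' tensor_liftE // hd' D'_grouplike.1.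
  - by rewrite ha envelope_counit ea.
  - by rewrite hd D_grouplike.2 ed.
  - by rewrite hd' D'_grouplike.2 ed'.
pose m : {lrmorphism mx_bialg k n -> K} := alg_lift (fun ij => a ij.1 ij.2).
have mE i j : m (mx_gen k i j) = a i j by exact: alg_lift_var.
have [pM_mor [pM_surj pM_ker]] := OM_def.
have m_mor : is_bialg_mor m.
  have bil := tens_bil (linearP m) (linearP m).
  apply: (bialg_mor_gen (@mx_generated k n)) => _ [i [j ->]].
    rewrite mE Ka [comul _]mx_comul_gen tensor_lift_sum //; apply: eq_bigr => s _.
    by rewrite tensor_liftE // !mE.
  by rewrite mE ea [RHS]mx_counit_gen.
have m0 b : pM b = 0 -> m b = 0.
  move=> /pM_ker; move=> /(_ _ (ker_ideal m)); apply => {b} _ [x hx <-] /=.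
  have -> : \sum_i \sum_j \sum_p \sum_q (E i j * x p q) *: (mx_gen k p i * mx_gen k q j) =
      contract E (fun i j => contract x (fun p q => mx_gen k p i * mx_gen k q j)).
    apply: eq_bigr => i _; apply: eq_bigr => j _; rewrite scaler_sumr.
    by apply: eq_bigr => p' _; rewrite scaler_sumr; apply: eq_bigr => q _; rewrite scalerA.
  rewrite contract_exchange (contract_linear x _ (linearP m)).
  transitivity (contract x (fun s t => E s t *: d')); last first.
    by rewrite contract_scalar hx scale0r.
  apply: eq_contract => s t; rewrite (contract_linear E _ (linearP m)).
  have /matrixP /(_ s t) := Krow.
  rewrite scalars_contract mul_mx_entry scalarsE -scalerAl mul1r => <-.
  by apply: eq_contract => i j; rewrite rmorphM /= !mE [a^T _ _]mxE.
have [q qpM] := factor_through pM_surj m0.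
have q_mor : is_bialg_mor q := bialg_mor_factor pM_surj qpM pM_mor m_mor.
have [g [g_mor giota _]] := OGL_def.2 K q q_mor.
have galpha i j : g (alpha i j) = a i j by rewrite mxE [LHS]giota qpM mE.
have hg x : h (g x) = x.
  have [u [_ _ uuniq]] := OGL_def.2 OGL iota OGL_def.1.
  have -> : h (g x) = u x.
    apply: (uuniq (h \o g)) => [|b /=].
      split=> [|y /=]; first exact: bialg_mor_comp g_mor.1 h_mor.1.
      by rewrite g_mor.2 h_mor.2.
    have [c <-] := pM_surj b; rewrite [g _]giota qpM.
    elim/mx_bialg_ind: c => [|i j|c c' hc hc'|t c c' hc hc'].
    - by rewrite !rmorph1.
    - by rewrite mE ha mxE.
    - by rewrite !rmorphM /= hc hc'.
    - by rewrite !linearP /= hc hc'.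
  by apply/esym/(uuniq idfun) => //; split=> //; apply: bialg_mor_id.
have gD' : g D' = d'.
  have := congr1 (map_mx g) D_row.
  rewrite !map_mxM -map_trmx map_scalar_mx map_scalars /=.
  have -> : map_mx g alpha = a by apply/matrixP => i j; rewrite mxE galpha mxE.
  rewrite Krow => /(congr1 (mulmx (scalars K (invmx E)))).
  rewrite !mulmxA -scalarsM mulVmx // scalars1 !mul1mx => e.
  have /matrixP /(_ (Ordinal n_gt0) (Ordinal n_gt0)) := e.
  by rewrite !mxE eqxx.
have gD : g D = d.
  by apply: (@inverse_unique _ _ d') => //; rewrite -gD' -rmorphM DD' rmorph1.
have gh y : g (h y) = y.
  apply: (Kgen (fun y => g (h y) = y)) => [|_ [[i [j ->]]|[->|->]]|{}y z hy hz|c {}y z hy hz].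
  - by rewrite !rmorph1.
  - by rewrite ha galpha.
  - by rewrite hd.
  - by rewrite hd'.
  - by rewrite !rmorphM /= hy hz.
  - by rewrite !linearP /= hy hz.
exists (h \o p); split=> /=.
- split=> [x|b]; first by have [b pb] := psurj (g x); exists b; rewrite /= pb hg.
  rewrite -pker /=; split=> [hb|->]; last by rewrite rmorph0.
  by rewrite -[p b]gh hb rmorph0.
- by move=> i j; rewrite -ha mxE.
- by [].
- by [].
move=> i j; rewrite -ha -!h_mor.2 KSS.
have <- : map_mx h a = alpha by apply/matrixP => s t; rewrite mxE ha.
by rewrite -hd -hd' -!(map_scalars h) -!map_scalar_mx -!map_mxM [RHS]mxE.
Qed.

End Envelope.

(** * Upper bounds for two variables *)

Lemma subspace_solve (k : fieldType) (V : lmodType k) (U : set V) (c : k) (x y z : V) :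
  is_subspace U -> c != 0 -> c *: x + y = z -> U y -> U z -> U x.
Proof.
move=> hU c0 e Uy Uz; have -> : x = c^-1 *: (z - y).
  by rewrite -e addrK scalerA mulVf // scale1r.
by apply: (subspaceZ _ hU); apply: (subspaceD hU) => //; apply: (subspaceN hU).
Qed.

Section Chains.
Variables (k : fieldType) (T : algType k).
Implicit Types (x y z : T) (xs : seq T).

(** These are subspaces, so that a commutation rule can be read off from a linear
    relation all of whose other terms are known to lie in them. *)
Definition left_span xs x : set T := [set t | exists a b,
  [/\ ordered_span xs 1 a, ordered_span xs 2 b & t = a * x + b]].
Definition right_span xs x : set T := [set t | exists a b,
  [/\ ordered_span xs 1 a, ordered_span xs 2 b & t = x * a + b]].

Lemma left_span_subspace xs x : is_subspace (left_span xs x).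
Proof.
have h1 := ordered_span_subspace xs 1; have h2 := ordered_span_subspace xs 2.
split; first by exists 0, 0; rewrite mul0r addr0; split=> //; [exact: h1.1 | exact: h2.1].
move=> c _ _ [a [b [ha hb ->]]] [a' [b' [ha' hb' ->]]].
exists (c *: a + a'), (c *: b + b'); split; [exact: h1.2 | exact: h2.2 |].
by rewrite scalerDr mulrDl scalerAl addrACA.
Qed.

Lemma right_span_subspace xs x : is_subspace (right_span xs x).
Proof.
have h1 := ordered_span_subspace xs 1; have h2 := ordered_span_subspace xs 2.
split; first by exists 0, 0; rewrite mulr0 addr0; split=> //; [exact: h1.1 | exact: h2.1].
move=> c _ _ [a [b [ha hb ->]]] [a' [b' [ha' hb' ->]]].
exists (c *: a + a'), (c *: b + b'); split; [exact: h1.2 | exact: h2.2 |].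
by rewrite scalerDr mulrDr scalerAr addrACA.
Qed.

Section InChain.
Variable xs : seq T.
Hypothesis hch : almost_normal_chain xs.
Let hF := ordered_span_filtration hch.
Let h1 := ordered_span_subspace xs 1.
Let h2 := ordered_span_subspace xs 2.

Lemma left_span_mul x y : ordered_span xs 1 y -> left_span xs x (y * x).
Proof. by move=> hy; exists y, 0; rewrite addr0; split=> //; apply: h2.1. Qed.

Lemma right_span_mul x y : ordered_span xs 1 y -> right_span xs x (x * y).
Proof. by move=> hy; exists y, 0; rewrite addr0; split=> //; apply: h2.1. Qed.

Lemma left_span_sub x y : ordered_span xs 2 y -> left_span xs x y.
Proof. by move=> hy; exists 0, y; rewrite mul0r add0r; split=> //; apply: h1.1. Qed.

Lemma right_span_sub x y : ordered_span xs 2 y -> right_span xs x y.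
Proof. by move=> hy; exists 0, y; rewrite mulr0 add0r; split=> //; apply: h1.1. Qed.

Lemma ordered_span_mul2 y z : ordered_span xs 1 y -> ordered_span xs 1 z -> ordered_span xs 2 (y * z).
Proof. by move=> hy hz; apply: (filtrationM hF (M := 1) (N := 1)). Qed.

Lemma ordered_span_12 y : ordered_span xs 1 y -> ordered_span xs 2 y.
Proof. exact: (filtrationS hF). Qed.

Lemma ordered_span_1 : ordered_span xs 1 1.
Proof. by apply: (filtrationS hF); apply: filtration1. Qed.

End InChain.

Lemma ordered_span_self x xs : almost_normal_chain xs -> ordered_span (x :: xs) 1 x.
Proof.
move=> hch; rewrite -[X in ordered_span _ _ X]mulr1 -[X in X * 1]expr1.
apply: ordered_span_mono => //; rewrite subnn.
by apply: (filtration1 (ordered_span_filtration hch)).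
Qed.

Lemma ordered_span_mem xs : almost_normal_chain xs -> forall x, x \in xs -> ordered_span xs 1 x.
Proof.
elim: xs => [//|y xs IH] [hch _] x; rewrite inE => /orP[/eqP ->|/(IH hch) h].
  exact: ordered_span_self.
exact: ordered_span_cons.
Qed.

Lemma almost_normal_cons x xs : almost_normal_chain xs ->
  (forall y, y \in xs -> left_span xs x (x * y) /\ right_span xs x (y * x)) ->
  almost_normal_chain (x :: xs).
Proof.
move=> hch h; split=> // y yxs; have [hl hr] := h y yxs.
by split=> //; apply: ordered_span_mem.
Qed.

(** An invertible element that normalises [x] up to earlier terms can be moved
    past it, and so can its inverse. *)
Lemma span_normalising xs x d d' w (c : k) : almost_normal_chain xs ->
  d * d' = 1 -> d' * d = 1 -> c != 0 -> d * x = c *: (x * d) + w * d ->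
  ordered_span xs 1 w -> ordered_span xs 1 d -> ordered_span xs 1 d' ->
  (left_span xs x (x * d) /\ right_span xs x (d * x)) /\
  (left_span xs x (x * d') /\ right_span xs x (d' * x)).
Proof.
move=> hch dd' d'd c0 e hw hd hd'.
have hl := left_span_subspace xs x; have hr := right_span_subspace xs x.
have e' : x * d' = c *: (d' * x) + d' * w.
  have : d' * (d * x) * d' = d' * (c *: (x * d) + w * d) * d' by rewrite e.
  rewrite mulrA d'd mul1r => ->; rewrite mulrDr mulrDl -scalerAr -scalerAl.
  by rewrite -!mulrA dd' !mulr1.
split; split.
- apply: (subspace_solve hl c0 (esym e)); last exact: left_span_mul.
  by apply: left_span_sub; apply: ordered_span_mul2.
- rewrite e; apply: (subspaceD hr); last by apply: right_span_sub; apply: ordered_span_mul2.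
  by apply: (subspaceZ _ hr); apply: right_span_mul.
- rewrite e'; apply: (subspaceD hl); last by apply: left_span_sub; apply: ordered_span_mul2.
  by apply: (subspaceZ _ hl); apply: left_span_mul.
- apply: (subspace_solve hr c0 (esym e')); last exact: right_span_mul.
  by apply: right_span_sub; apply: ordered_span_mul2.
Qed.

End Chains.

Lemma contract2 (k : fieldType) (V : lmodType k) (G : 'M[k]_2) (f : 'I_2 -> 'I_2 -> V) :
  contract G f = G 0 0 *: f 0 0 + G 0 1 *: f 0 1 + (G 1 0 *: f 1 0 + G 1 1 *: f 1 1).
Proof.
have e : lift ord0 ord0 = 1 :> 'I_2 by apply: val_inj.
by rewrite /contract !big_ord_recl !big_ord0 !addr0 !e.
Qed.

Lemma chain_A (k : fieldType) (T : algType k) (x y : T) (b c e : k) :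
  b != 0 -> c != 0 -> b *: (x * y) + c *: (y * x) + e *: (y * y) = 0 ->
  almost_normal_chain [:: x; y].
Proof.
move=> b0 c0 rel; have hch : almost_normal_chain [:: y] by split=> // z; rewrite in_nil.
apply: almost_normal_cons => // z; rewrite inE => /eqP ->.
have hl := left_span_subspace [:: y] x; have hr := right_span_subspace [:: y] x.
have hy := ordered_span_mem hch (mem_head y [::]).
have hyy := ordered_span_mul2 hch hy hy.
split.
  rewrite -addrA in rel; apply: (subspace_solve hl b0 rel); last exact: hl.1.
  apply: (subspaceD hl); apply: (subspaceZ _ hl); first exact: left_span_mul.
  exact: left_span_sub.
rewrite [b *: _ + _]addrC -addrA in rel; apply: (subspace_solve hr c0 rel); last exact: hr.1.
apply: (subspaceD hr); apply: (subspaceZ _ hr); first exact: right_span_mul.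
exact: right_span_sub.
Qed.

Ltac mem_chain := apply: ordered_span_mem; rewrite // !inE eqxx ?orbT.

(** Membership of a linear combination of products in [left_span] or
    [right_span]. *)
Ltac span_terms hs := solve [
  repeat first [apply: (subspaceD hs) | apply: (subspaceN hs) | apply: (subspaceZ _ hs)];
  first [ exact: hs.1 | by apply: left_span_mul | by apply: right_span_mul
    | by apply: left_span_sub; first [apply: ordered_span_mul2 | apply: ordered_span_12]
    | by apply: right_span_sub; first [apply: ordered_span_mul2 | apply: ordered_span_12] ]].

Section GL2.
Variables (k : fieldType) (T : algType k) (a : 'M[T]_2) (d d' : T).
Variables (E H Th Th' : 'M[k]_2).
Hypotheses (dd' : d * d' = 1) (d'd : d' * d = 1).
Hypotheses (row : a *m scalars T E *m a^T = scalars T E *m d'%:M)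
  (col : a^T *m scalars T H *m a = scalars T H *m d'%:M).
Hypothesis dTh : d%:M *m a = scalars T Th *m a *m scalars T Th' *m d%:M.
Hypotheses (E00 : E 0 0 = 0) (E01 : E 0 1 != 0) (E10 : E 1 0 != 0).
Hypotheses (H11 : H 1 1 = 0) (H01 : H 0 1 != 0) (H10 : H 1 0 != 0).
Hypotheses (Th01 : Th 0 1 = 0) (Th'01 : Th' 0 1 = 0)
  (Th00 : Th 0 0 != 0) (Th11 : Th 1 1 != 0) (Th'00 : Th' 0 0 != 0) (Th'11 : Th' 1 1 != 0).

Let rowE i j : contract E (fun s t => a i s * a j t) = E i j *: d'.
Proof.
have /matrixP /(_ i j) := row.
rewrite scalars_contract mul_mx_entry scalarsE -scalerAl mul1r => <-.
by apply: eq_contract => s t; rewrite [a^T _ _]mxE.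
Qed.

Let colE i j : contract H (fun s t => a s i * a t j) = H i j *: d'.
Proof.
have /matrixP /(_ i j) := col.
rewrite scalars_contract mul_mx_entry scalarsE -scalerAl mul1r => <-.
by apply: eq_contract => s t; rewrite [a^T _ _]mxE.
Qed.

Let dE i j : d * a i j =
  Th' 0 j *: (Th i 0 *: a 0 0 + Th i 1 *: a 1 0) * d + Th' 1 j *: (Th i 0 *: a 0 1 + Th i 1 *: a 1 1) * d.
Proof.
have e : lift ord0 ord0 = 1 :> 'I_2 by apply: val_inj.
have /matrixP /(_ i j) := dTh; rewrite mul_entry_mx mul_mx_entry => ->.
rewrite mul_scalarsr !big_ord_recl !big_ord0 !addr0 !e mulrDl !mul_scalarsl.
by rewrite !big_ord_recl !big_ord0 !addr0 !e.
Qed.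

(** Every commutation rule is one of the eight entries of the two matrix relations.
    The vanishing of [E 0 0] and [H 1 1] leaves in each of them few enough terms for
    the order [a 0 1], [a 0 0], [a 1 1], [a 1 0] to work, and [Th] being triangular lets
    [d] pass each entry up to earlier ones. *)
Lemma GL2_chain : almost_normal_chain [:: a 1 0; a 1 1; a 0 0; a 0 1; d; d'].
Proof.
have ch0 : almost_normal_chain [:: d'] by split=> // z; rewrite in_nil.
have ch1 : almost_normal_chain [:: d; d'].
  apply: almost_normal_cons => // y; rewrite inE => /eqP ->; rewrite dd' d'd.
  have h1 := ordered_span_12 ch0 (ordered_span_1 ch0).
  by split; [apply: left_span_sub | apply: right_span_sub].
have ch2 : almost_normal_chain [:: a 0 1; d; d'].
  apply: almost_normal_cons => // y hy.
  have hd : ordered_span [:: d; d'] 1 d by mem_chain.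
  have hd' : ordered_span [:: d; d'] 1 d' by mem_chain.
  have e : d * a 0 1 = (Th' 1 1 * Th 0 0) *: (a 0 1 * d) + 0 * d.
    by rewrite dE Th01 Th'01 !scale0r !mul0r add0r !addr0 scalerA -scalerAl.
  have [] := span_normalising ch1 dd' d'd (mulf_neq0 Th'11 Th00) e (ordered_span_subspace _ _).1 hd hd'.
  by move: hy; rewrite !inE => /orP[]/eqP ->.
have ch3 : almost_normal_chain [:: a 0 0; a 0 1; d; d'].
  apply: almost_normal_cons => // y hy.
  have h1 := ordered_span_subspace [:: a 0 1; d; d'] 1.
  have hd : ordered_span [:: a 0 1; d; d'] 1 d by mem_chain.
  have hd' : ordered_span [:: a 0 1; d; d'] 1 d' by mem_chain.
  have hq : ordered_span [:: a 0 1; d; d'] 1 (a 0 1) by mem_chain.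
  have e : d * a 0 0 = (Th' 0 0 * Th 0 0) *: (a 0 0 * d) + Th' 1 0 *: (Th 0 0 *: a 0 1) * d.
    by rewrite dE Th01 !scale0r !addr0 scalerA -scalerAl.
  have hw : ordered_span [:: a 0 1; d; d'] 1 (Th' 1 0 *: (Th 0 0 *: a 0 1)).
    by do 2?[apply: (subspaceZ _ h1)].
  have [] := span_normalising ch2 dd' d'd (mulf_neq0 Th'00 Th00) e hw hd hd'.
  move: hy; rewrite !inE => /or3P[]/eqP -> //  _ _.
  have hl := left_span_subspace [:: a 0 1; d; d'] (a 0 0).
  have hr := right_span_subspace [:: a 0 1; d; d'] (a 0 0).
  have rel := rowE 0 0; rewrite contract2 E00 !scale0r add0r in rel.
  split; first by apply: (subspace_solve hl E01 rel); span_terms hl.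
  by rewrite addrCA in rel; apply: (subspace_solve hr E10 rel); span_terms hr.
have ch4 : almost_normal_chain [:: a 1 1; a 0 0; a 0 1; d; d'].
  set xs := [:: a 0 0; a 0 1; d; d'].
  apply: almost_normal_cons => // y hy; rewrite -/xs.
  have h1 := ordered_span_subspace xs 1.
  have hd : ordered_span xs 1 d by mem_chain.
  have hd' : ordered_span xs 1 d' by mem_chain.
  have hq : ordered_span xs 1 (a 0 1) by mem_chain.
  have hp : ordered_span xs 1 (a 0 0) by mem_chain.
  have hl := left_span_subspace xs (a 1 1).
  have hr := right_span_subspace xs (a 1 1).
  have e : d * a 1 1 = (Th' 1 1 * Th 1 1) *: (a 1 1 * d) + Th' 1 1 *: (Th 1 0 *: a 0 1) * d.
    by rewrite dE Th'01 !scale0r mul0r add0r scalerDr mulrDl addrC scalerA -scalerAl.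
  have hw : ordered_span xs 1 (Th' 1 1 *: (Th 1 0 *: a 0 1)) by do 2?[apply: (subspaceZ _ h1)].
  have [] := span_normalising ch3 dd' d'd (mulf_neq0 Th'11 Th11) e hw hd hd'.
  have sq := colE 1 1; rewrite contract2 H11 !scale0r addr0 in sq.
  have sp := rowE 1 0; rewrite contract2 E00 scale0r add0r in sp.
  have rq := colE 0 1; rewrite contract2 H11 scale0r addr0 in rq.
  have sqA : H 1 0 *: (a 1 1 * a 0 1) + (H 0 0 *: (a 0 1 * a 0 1) + H 0 1 *: (a 0 1 * a 1 1)) = 0.
    by rewrite addrC.
  have sqB : H 0 1 *: (a 0 1 * a 1 1) + (H 0 0 *: (a 0 1 * a 0 1) + H 1 0 *: (a 1 1 * a 0 1)) = 0.
    by rewrite addrCA addrA.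
  have sqL : left_span xs (a 1 1) (a 1 1 * a 0 1).
    by apply: (subspace_solve hl H10 sqA); span_terms hl.
  move: hy; rewrite !inE => /or4P[]/eqP -> // _ _; split=> //.
  - have rqL : left_span xs (a 1 1) (a 1 0 * a 0 1).
      by rewrite addrC in rq; apply: (subspace_solve hl H10 rq); span_terms hl.
    rewrite addrCA in sp; apply: (subspace_solve hl E10 sp); last by span_terms hl.
    by apply: (subspaceD hl); apply: (subspaceZ _ hl).
  - have rqR : right_span xs (a 1 1) (a 1 0 * a 0 1).
      by apply: (subspace_solve hr E01 sp); span_terms hr.
    rewrite -addrA addrCA in rq; apply: (subspace_solve hr H01 rq); last by span_terms hr.
    by apply: (subspaceD hr); [span_terms hr | apply: (subspaceZ _ hr)].
  - by apply: (subspace_solve hr H01 sqB); span_terms hr.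
set xs := [:: a 1 1; a 0 0; a 0 1; d; d'].
apply: almost_normal_cons => // y hy; rewrite -/xs.
have h1 := ordered_span_subspace xs 1.
have hd : ordered_span xs 1 d by mem_chain.
have hd' : ordered_span xs 1 d' by mem_chain.
have hq : ordered_span xs 1 (a 0 1) by mem_chain.
have hp : ordered_span xs 1 (a 0 0) by mem_chain.
have hs : ordered_span xs 1 (a 1 1) by mem_chain.
have hl := left_span_subspace xs (a 1 0).
have hr := right_span_subspace xs (a 1 0).
pose w := Th' 0 0 *: (Th 1 0 *: a 0 0) + Th' 1 0 *: (Th 1 0 *: a 0 1 + Th 1 1 *: a 1 1).
have e : d * a 1 0 = (Th' 0 0 * Th 1 1) *: (a 1 0 * d) + w * d.
  rewrite dE /w scalerDr !mulrDl scalerA -!scalerAl addrA; congr (_ + _).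
  by rewrite addrC scalerA.
have hw : ordered_span xs 1 w.
  by rewrite /w; do ?[apply: (subspaceD h1) | apply: (subspaceZ _ h1)].
have [] := span_normalising ch4 dd' d'd (mulf_neq0 Th'00 Th11) e hw hd hd'.
have rs := rowE 1 1; rewrite contract2 E00 scale0r add0r in rs.
have rq := colE 0 1; rewrite contract2 H11 scale0r addr0 in rq.
have qr := colE 1 0; rewrite contract2 H11 scale0r addr0 in qr.
have rp := colE 0 0; rewrite contract2 H11 scale0r addr0 in rp.
move: hy; rewrite !inE => /orP[|/or4P[]]/eqP -> // _ _; split.
- by apply: (subspace_solve hl E01 rs); span_terms hl.
- by rewrite addrCA in rs; apply: (subspace_solve hr E10 rs); span_terms hr.
- by rewrite addrC in rp; apply: (subspace_solve hl H10 rp); span_terms hl.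
- by rewrite -addrA addrCA in rp; apply: (subspace_solve hr H01 rp); span_terms hr.
- by rewrite addrC in rq; apply: (subspace_solve hl H10 rq); span_terms hl.
- by rewrite -addrA addrCA in qr; apply: (subspace_solve hr H01 qr); span_terms hr.
Qed.

End GL2.

Lemma chain_bounded (R : realType) (k : fieldType) (T : algType k) (xs : seq T) :
  almost_normal_chain xs -> generated_by [set` xs] -> noetherian T /\ finite_GKdim R T.
Proof.
move=> hch hgen; have hF := ordered_span_filtration hch.
have all_in t : ordered_subring xs t.
  apply: hgen t => [|x xxs|g h|c g h [M hg] [N hh]].
  - by exists 0%N; apply: filtration1.
  - by exists 1%N; apply: ordered_span_mem.
  - by have [_ _] := ordered_subring_is_subring hch; apply.
  - exists (M + N)%N; apply: (ordered_span_subspace xs _).2.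
      exact: (filtration_le hF (leq_addr _ _)).
    exact: (filtration_le hF (leq_addl _ _)).
by split; [apply: ordered_span_noetherian hch all_in | apply: ordered_span_finite_GKdim hch all_in].
Qed.

(** * Change of basis *)

Lemma mulmx2E (k : pzRingType) m p (A : 'M[k]_(m, 2)) (B : 'M[k]_(2, p)) i j :
  (A *m B) i j = A i 0 * B 0 j + A i 1 * B 1 j.
Proof.
have e : lift ord0 ord0 = 1 :> 'I_2 by apply: val_inj.
by rewrite mxE !big_ord_recl big_ord0 addr0 !e.
Qed.

Lemma det2E (k : comPzRingType) (A : 'M[k]_2) : \det A = A 0 0 * A 1 1 - A 0 1 * A 1 0.
Proof.
have e : lift ord0 ord0 = 1 :> 'I_2 by apply: val_inj.
have e' : lift 1 0 = 0 :> 'I_2 by apply: val_inj.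
rewrite (expand_det_row A 0) !big_ord_recl big_ord0 addr0 /cofactor !det_mx11 !mxE !e /=.
by rewrite e' expr0 expr1 mul1r mulN1r mulrN.
Qed.

Section Triangular.
Variables (k : fieldType) (E : 'M[k]_2).
Hypotheses (Eu : E \in unitmx) (E00 : E 0 0 = 0).
Let F := invmx E.

Lemma isotropic_antidiagonal : E 0 1 != 0 /\ E 1 0 != 0.
Proof.
have := Eu; rewrite unitmxE det2E E00 mul0r sub0r unitrN unitfE mulf_eq0 negb_or.
by move/andP.
Qed.

Lemma isotropic_invmx : F 1 1 = 0 /\ (F 0 1 != 0 /\ F 1 0 != 0).
Proof.
have [E01 E10] := isotropic_antidiagonal.
have F11 : F 1 1 = 0.
  have /matrixP /(_ 0 1) := mulmxV Eu; rewrite mulmx2E E00 mul0r add0r mxE /=.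
  by move/eqP; rewrite mulf_eq0 (negPf E01) => /eqP.
split=> //; have : F \in unitmx by rewrite unitmx_inv.
rewrite unitmxE det2E F11 mulr0 sub0r unitrN unitfE mulf_eq0 negb_or.
by move/andP.
Qed.
End Triangular.

(** The first row of [P] is an isotropic vector of [E]. *)
Lemma isotropic_base_change (k : closedFieldType) (E : 'M[k]_2) :
  exists2 P : 'M[k]_2, P \in unitmx & (P *m E *m P^T) 0 0 = 0.
Proof.
have [u u0 uE] := isotropic_vector E (isT : (1 < 2)%N).
pose P : 'M[k]_2 := \matrix_(i, j) (if i == 0 then u 0 j else ((u 0 0 == 0) == (j == 0))%:R).
exists P.
  rewrite unitmxE det2E !mxE /= unitfE.
  case: (eqVneq (u 0 0) 0) => u00 /=; last by rewrite mulr1 mulr0 subr0.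
  rewrite mulr0 sub0r mulr1 oppr_eq0; apply: contraNneq u0 => u01.
  apply/eqP/rowP => j; rewrite mxE; case: (unliftP 0 j) => [i ->|-> //].
  by rewrite ord1; have -> : lift 0 0 = 1 :> 'I_2 by apply: val_inj.
have rP : row 0 P = u by apply/rowP => j; rewrite !mxE.
have /matrixP /(_ 0 0) := uE; rewrite [RHS]mxE => <-; rewrite -rP.
by rewrite !mulmx2E !mxE.
Qed.

Lemma span_scalars (k : fieldType) (T : algType k) (P : T -> Prop) m p q r
  (G : 'M[k]_(m, p)) (a : 'M[T]_(p, q)) (H : 'M[k]_(q, r)) :
  P 1 -> (forall c g h, P g -> P h -> P (c *: g + h)) -> (forall i j, P (a i j)) ->
  forall i j, P ((scalars T G *m a *m scalars T H) i j).
Proof.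
move=> P1 PD Pa.
have P0 : P 0 by rewrite -[0](addNr 1) -scaleN1r; apply: PD.
have PS (I : Type) (s : seq I) (c : I -> k) (f : I -> T) : (forall i, P (f i)) -> P (\sum_(i <- s) c i *: f i).
  move=> Pf; elim: s => [|x s IH]; first by rewrite big_nil.
  by rewrite big_cons; apply: PD.
by move=> i j; rewrite mul_scalarsr; apply: (PS) => t; rewrite mul_scalarsl; apply: (PS).
Qed.

(** In the first case [d] is central, in the second one the square of the
    antipode is the identity on the generators. *)
Definition codeterminant_commutes (k : closedFieldType) (T : algType k) (n : nat) (E : 'M[k]_n)
    (a : 'M[T]_n) (d d' : T) :=
  d%:M *m a = a *m d%:M \/
  a = d'%:M *m scalars T (E *m (invmx E)^T) *m a *m scalars T (E^T *m invmx E) *m d%:M.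

Section BaseChange.
Variables (k : closedFieldType) (T : algType k) (n : nat) (E P : 'M[k]_n) (Eu : E \in unitmx) (Pu : P \in unitmx).
Variables (a : 'M[T]_n) (d d' : T).
Let Q := invmx P.
Let E' := P *m E *m P^T.
Let b := scalars T P *m a *m scalars T Q.

Let QP : Q *m P = 1%:M. Proof. exact: mulVmx. Qed.
Let PQ : P *m Q = 1%:M. Proof. exact: mulmxV. Qed.
Let QPt : P^T *m Q^T = 1%:M. Proof. by rewrite -trmx_mul QP trmx1. Qed.
Lemma base_change_unit : E' \in unitmx.
Proof. by rewrite !unitmx_mul Eu Pu unitmx_tr. Qed.

Lemma base_change_invmx : invmx E' = Q^T *m invmx E *m Q.
Proof.
have e : E' *m (Q^T *m invmx E *m Q) = 1%:M.
  by rewrite /E' !mulmxA -(mulmxA _ P^T) QPt mulmx1 -(mulmxA P) mulmxV // mulmx1.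
by rewrite -[LHS]mulmx1 -e mulmxA mulVmx ?mul1mx // base_change_unit.
Qed.

Lemma base_change_tr : b^T = scalars T Q^T *m a^T *m scalars T P^T.
Proof. by rewrite /b trmx_scalarsr trmx_scalarsl mulmxA. Qed.

Lemma base_change_relations : GL_relations E a d d' -> GL_relations E' b d d'.
Proof.
move=> [dd' d'd row col]; split=> //.
  have bE : b *m scalars T E' = scalars T P *m a *m scalars T E *m scalars T P^T.
    by rewrite /b -mulmxA -scalarsM /E' !mulmxA QP mul1mx !scalarsM !mulmxA.
  rewrite base_change_tr bE -!mulmxA (mulmxA (scalars T P^T)) -scalarsM QPt scalars1 mul1mx.
  have := congr1 (fun M => scalars T P *m M *m scalars T P^T) row; rewrite /= -!mulmxA => ->.
  by rewrite -scalars_comm /E' !scalarsM !mulmxA.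
have Fb : scalars T (invmx E') *m b = scalars T Q^T *m scalars T (invmx E) *m a *m scalars T Q.
  by rewrite /b base_change_invmx !mulmxA -scalarsM -!mulmxA QP mulmx1 !mulmxA !scalarsM.
rewrite -mulmxA Fb base_change_tr -!mulmxA (mulmxA (scalars T P^T)) scalars_comm.
rewrite (mulmxA _ (scalars T Q^T)) -!(mulmxA _ (scalars T P^T)) -scalarsM QPt scalars1 mulmx1.
have := congr1 (fun M => scalars T Q^T *m M *m scalars T Q) col; rewrite /= -!mulmxA => ->.
by rewrite base_change_invmx !scalarsM !mulmxA.
Qed.

Lemma base_change_commutes : codeterminant_commutes E a d d' -> codeterminant_commutes E' b d d'.
Proof.
move=> [e|e]; [left|right].
  by rewrite /b !mulmxA -scalars_comm -(mulmxA _ d%:M) e -!mulmxA scalars_comm.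
have -> : scalars T (E' *m (invmx E')^T) = scalars T P *m scalars T (E *m (invmx E)^T) *m scalars T Q.
  rewrite base_change_invmx !trmx_mul trmxK /E' -!mulmxA (mulmxA P^T) QPt mul1mx.
  by rewrite !scalarsM !mulmxA.
have -> : scalars T (E'^T *m invmx E') = scalars T P *m scalars T (E^T *m invmx E) *m scalars T Q.
  rewrite base_change_invmx !trmx_mul trmxK /E' -!mulmxA (mulmxA P^T) QPt mul1mx.
  by rewrite !scalarsM !mulmxA.
have Qb : scalars T Q *m b = a *m scalars T Q.
  by rewrite /b !mulmxA -scalarsM QP scalars1 mul1mx.
have [c cE] : exists c, c = b by exists b.
rewrite -cE in Qb *; rewrite -!mulmxA (mulmxA _ c) Qb -!mulmxA (mulmxA (scalars T Q) (scalars T P)) -scalarsM QP scalars1 mul1mx.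
by rewrite cE /b {1}e -!mulmxA -(scalars_comm Q) mulmxA (scalars_comm P) -mulmxA.
Qed.

Lemma base_change_generated : generated_by (GL_generator a d d') -> generated_by (GL_generator b d d').
Proof.
move=> gen B B1 BX BM BD; apply: gen => // _ [[i [j ->]]|[->|->]]; last 2 first.
- by apply: BX; right; left.
- by apply: BX; right; right.
have <- : scalars T Q *m b *m scalars T P = a.
  by rewrite /b -!mulmxA -scalarsM QP scalars1 mulmx1 mulmxA -scalarsM QP scalars1 mul1mx.
by apply: span_scalars => // s t; apply: BX; left; exists s, t.
Qed.

End BaseChange.

Section GL2Bounded.
Variables (k : closedFieldType) (T : algType k) (E : 'M[k]_2).
Variables (a : 'M[T]_2) (d d' : T).
Hypotheses (Eu : E \in unitmx) (E00 : E 0 0 = 0).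
Hypothesis rels : GL_relations E a d d'.
Let F := invmx E.
Let FE : F *m E = 1%:M. Proof. exact: mulVmx. Qed.
Let EF : E *m F = 1%:M. Proof. exact: mulmxV. Qed.
Let F11 : F 1 1 = 0. Proof. by have [] := isotropic_invmx Eu E00. Qed.
Let F01 : F 0 1 != 0. Proof. by have [_ []] := isotropic_invmx Eu E00. Qed.
Let F10 : F 1 0 != 0. Proof. by have [_ []] := isotropic_invmx Eu E00. Qed.
Let E01 : E 0 1 != 0. Proof. by have [] := isotropic_antidiagonal Eu E00. Qed.
Let E10 : E 1 0 != 0. Proof. by have [] := isotropic_antidiagonal Eu E00. Qed.

(** Here [d] can be moved to the right end of the column relation, so [H = F]. *)
Lemma GL2_chain_central : d%:M *m a = a *m d%:M ->
  almost_normal_chain [:: a 1 0; a 1 1; a 0 0; a 0 1; d; d'].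
Proof.
have [dd' d'd row col] := rels; move=> da.
have col' : a^T *m scalars T F *m a = scalars T F *m d'%:M.
  have : a^T *m scalars T F *m a *m d%:M = scalars T F.
    by rewrite -mulmxA -da mulmxA -(mulmxA _ (scalars T F)) scalars_comm mulmxA.
  move=> /(congr1 (mulmx^~ d'%:M)) /=.
  by rewrite -(mulmxA _ d%:M) -scalar_mxM dd' mulmx1.
have da' : d%:M *m a = scalars T 1%:M *m a *m scalars T 1%:M *m d%:M.
  by rewrite scalars1 mul1mx mulmx1.
apply: (GL2_chain dd' d'd row col' da') => //; by rewrite mxE ?oner_eq0.
Qed.

(** Moving [d] to the right now conjugates [a] by [Th = E F^T], and [F Th = F^T] turns
    the column relation into the one with [H = F^T]. *)
Lemma GL2_chain_involutive :
  a = d'%:M *m scalars T (E *m (invmx E)^T) *m a *m scalars T (E^T *m invmx E) *m d%:M ->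
  almost_normal_chain [:: a 1 0; a 1 1; a 0 0; a 0 1; d; d'].
Proof.
have [dd' d'd row col] := rels; rewrite -/F; set Th := E *m F^T; set Th' := E^T *m F => da.
have ThTh' : Th' *m Th = 1%:M.
  by rewrite /Th /Th' -!mulmxA (mulmxA F) FE mul1mx -trmx_mul FE trmx1.
have FTh : F *m Th = F^T by rewrite /Th mulmxA FE mul1mx.
have dTh : d%:M *m a = scalars T Th *m a *m scalars T Th' *m d%:M.
  by rewrite {1}da !mulmxA -scalar_mxM dd' mul1mx.
have Tha : scalars T Th *m a = d%:M *m a *m d'%:M *m scalars T Th.
  rewrite dTh -[_ *m d%:M *m d'%:M]mulmxA -scalar_mxM dd' mulmx1.
  by rewrite -[RHS]mulmxA -scalarsM ThTh' scalars1 mulmx1.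
have col' : a^T *m scalars T F^T *m a = scalars T F^T *m d'%:M.
  rewrite -FTh scalarsM -!mulmxA Tha !mulmxA -(mulmxA _ (scalars T F)) scalars_comm mulmxA.
  rewrite col -mulmxA -scalars_comm mulmxA //.
have Ft i j : F^T i j = F j i by rewrite mxE.
have Et i j : E^T i j = E j i by rewrite mxE.
apply: (GL2_chain dd' d'd row col' dTh) => //; rewrite /Th /Th' ?mulmx2E ?Ft ?Et //;
  rewrite ?E00 ?F11 ?(mul0r, mulr0, add0r, addr0) ?mulf_neq0 //.
Qed.

End GL2Bounded.

Lemma GL2_bounded (R : realType) (k : closedFieldType) (T : algType k) (E : 'M[k]_2)
  (a : 'M[T]_2) (d d' : T) : E \in unitmx -> GL_relations E a d d' ->
  codeterminant_commutes E a d d' -> generated_by (GL_generator a d d') ->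
  noetherian T /\ finite_GKdim R T.
Proof.
move=> Eu rels comm gen; have [P Pu P00] := isotropic_base_change E.
have Eu' := base_change_unit Eu Pu; have rels' := base_change_relations Eu Pu rels.
have gen' := base_change_generated Pu gen; set b := (_ *m a *m _) in rels' gen'.
have hch : almost_normal_chain [:: b 1 0; b 1 1; b 0 0; b 0 1; d; d'].
  case: (base_change_commutes Eu Pu comm) => h.
    exact: (GL2_chain_central Eu' P00 rels' h).
  exact: (GL2_chain_involutive Eu' P00 rels' h).
apply: (chain_bounded R hch) => B B1 BX BM BD; apply: gen' => // x [[i [j ->]]|[->|->]].
- have e : lift ord0 ord0 = 1 :> 'I_2 by apply: val_inj.
  case: (unliftP 0 i) => [i' ->|->]; case: (unliftP 0 j) => [j' ->|->];
  by rewrite ?ord1 ?e; apply: BX; rewrite /= !inE eqxx ?orbT.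
- by apply: BX; rewrite /= !inE eqxx ?orbT.
- by apply: BX; rewrite /= !inE eqxx ?orbT.
Qed.

Lemma GL_free_bounded (R : realType) (k : closedFieldType) (E : 'M[k]_2) (C : algType k)
  (f : {lrmorphism GL_free k 2 -> C}) : E \in unitmx -> (forall x, exists b, f b = x) ->
  (forall b, GL_relators E b -> f b = 0) ->
  codeterminant_commutes E (\matrix_(i, j) f (GL_a k i j)) (f (GL_D k 2)) (f (GL_D' k 2)) ->
  noetherian C /\ finite_GKdim R C.
Proof.
move=> Eu fsurj f0 comm; apply: (GL2_bounded R Eu (GL_relations_of_mor f0) comm).
exact: GL_generated_of_mor.
Qed.

Lemma AnE_bounded (R : realType) (k : closedFieldType) (E : 'M[k]_2) (A : algType k)
  (p : {lrmorphism free_alg k 'I_2 -> A}) : E \in unitmx -> is_AnE E p ->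
  noetherian A /\ finite_GKdim R A.
Proof.
move=> Eu [psurj pker]; have [P Pu P00] := isotropic_base_change E.
have [E01 E10] := isotropic_antidiagonal (base_change_unit Eu Pu) P00.
pose v : 'cV[A]_2 := \col_i p (fvar i).
pose w := scalars A (invmx P)^T *m v.
have vE : v = scalars A P^T *m w.
  by rewrite /w mulmxA -scalarsM -trmx_mul mulVmx // trmx1 scalars1 mul1mx.
clearbody w; have e : v^T *m scalars A E *m v = 0.
  apply/matrixP => i j; rewrite scalars_contract !ord1 [RHS]mxE.
  have <- : p (relator E) = 0 by apply/pker; apply: sub_ideal_gen.
  rewrite -[relator E]/(contract E (fun i j => fvar i * fvar j)) (contract_linear E _ (linearP p)).
  by apply: eq_contract => s t; rewrite rmorphM !mxE.
have e' : w^T *m scalars A (P *m E *m P^T) *m w = 0.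
  by rewrite -e vE trmx_scalarsl trmxK !scalarsM !mulmxA.
have /matrixP /(_ 0 0) := e'.
rewrite scalars_contract contract2 P00 scale0r add0r ![w^T _ _]mxE [RHS]mxE addrA => rel.
apply: (chain_bounded R (chain_A E01 E10 rel)) => B B1 BX BM BD x.
have [b <-] := psurj x; move: b; apply: free_alg_ind => [|i|g h Bg Bh|c g h Bg Bh].
- by rewrite rmorph1.
- have -> : p (fvar i) = v i 0 by rewrite mxE.
  rewrite vE -[_ *m w]mulmx1 -scalars1; apply: span_scalars => // s t; rewrite ord1.
  have one : lift ord0 ord0 = 1 :> 'I_2 by apply: val_inj.
  by case: (unliftP 0 s) => [s' ->|->]; rewrite ?ord1 ?one; apply: BX; rewrite /= !inE eqxx ?orbT.
- by rewrite rmorphM; apply: BM.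
- by rewrite linearP; apply: BD.
Qed.

(** * The theorem *)

Section Quotients.
Variables (R : realType) (k : closedFieldType) (n : nat) (E : 'M[k]_n) (Eu : E \in unitmx).
Variables (H : hopfAlgType k) (D : H) (f : {lrmorphism GL_free k n -> H}).
Hypotheses (f_quot : is_quotient (ideal_gen (GL_relators E)) f) (fD : f (GL_D k n) = D).
Variables (Q : hopfAlgType k) (p : {lrmorphism H -> Q}).

(** [O(SL)] is presented by the relations of the envelope together with [D = 1]. *)
Lemma OSL_wild : (2 < n)%N -> is_OSL D p -> ~ noetherian Q /\ ~ finite_GKdim R Q.
Proof.
have [fsurj fker] := f_quot; move=> n3 [_ [psurj pker]].
apply: (SL_wild R n3 Eu (p := p \o f)) => [x|b /=].
  by have [y <-] := psurj x; have [b <-] := fsurj y; exists b.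
set J := ideal_gen _; move=> /pker hb.
have hJ : is_ideal J := ideal_gen_ideal _.
pose I := [set x | exists2 b, f b = x & J b].
have hI : is_ideal I.
  have [[J0 JD Jl] [_ _ Jr]] := hJ.
  have I0 : I 0 by exists 0; rewrite ?rmorph0.
  have ID x y : I x -> I y -> I (x + y).
    by move=> [b' <- Jb'] [c <- Jc]; exists (b' + c); rewrite ?rmorphD //; apply: JD.
  split; split=> // x _ [b' <- Jb']; have [c <-] := fsurj x.
    by exists (c * b'); rewrite ?rmorphM //; apply: Jl.
  by exists (b' * c); rewrite ?rmorphM //; apply: Jr.
have [_ -> |c fc Jc] := hb I hI.
  exists (GL_D k n - 1); first by rewrite rmorphB rmorph1 /= fD.
  by apply: sub_ideal_gen; right.
have bc : J (b - c).
  have : ideal_gen (GL_relators E) (b - c) by apply/fker; rewrite rmorphB /= fc subrr.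
  by apply=> // x hx; apply: sub_ideal_gen; left.
by rewrite -[b](subrK c); have [[_ JD _] _] := hJ; apply: JD.
Qed.

End Quotients.

Section TwoByTwo.
Variables (R : realType) (k : closedFieldType) (E : 'M[k]_2) (Eu : E \in unitmx).
Variables (H : hopfAlgType k) (f : {lrmorphism GL_free k 2 -> H}).
Hypothesis f_quot : is_quotient (ideal_gen (GL_relators E)) f.
Let a : 'M[H]_2 := \matrix_(i, j) f (GL_a k i j).
Let D := f (GL_D k 2).
Let D' := f (GL_D' k 2).

Lemma quotient_bounded (Q : algType k) (p : {lrmorphism H -> Q}) :
  (forall x, exists y, p y = x) ->
  codeterminant_commutes E (map_mx p a) (p D) (p D') -> noetherian Q /\ finite_GKdim R Q.
Proof.
have [fsurj fker] := f_quot; move=> psurj comm.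
apply: (GL_free_bounded R (f := p \o f) Eu) => [x|b hb|] /=.
- by have [y <-] := psurj x; have [b <-] := fsurj y; exists b.
- have /fker -> : ideal_gen (GL_relators E) b by exact: sub_ideal_gen.
  by rewrite rmorph0.
suff -> : \matrix_(i, j) p (f (GL_a k i j)) = map_mx p a by [].
by apply/matrixP => i j; rewrite !mxE.
Qed.

Lemma central_quotient_bounded (Q : algType k) (p : {lrmorphism H -> Q}) :
  (forall x, exists y, p y = x) -> (forall x, p (x * D - D * x) = 0) ->
  noetherian Q /\ finite_GKdim R Q.
Proof.
move=> psurj pD; apply: quotient_bounded psurj _; left.
apply/matrixP => i j; rewrite mul_entry_mx mul_mx_entry mxE.
by apply/esym/eqP; rewrite -subr_eq0 -!rmorphM -rmorphB; apply/eqP/pD.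
Qed.

Lemma involutive_quotient_bounded (Q : algType k) (p : {lrmorphism H -> Q}) :
  (forall i j, antipode (antipode (a i j)) =
        (D'%:M *m scalars H (E *m (invmx E)^T) *m a *m scalars H (E^T *m invmx E) *m D%:M) i j) ->
  (forall x, exists y, p y = x) -> (forall x, p (antipode (antipode x) - x) = 0) ->
  noetherian Q /\ finite_GKdim R Q.
Proof.
move=> aSS psurj pS; apply: quotient_bounded psurj _; right.
rewrite -!(map_scalars p) -(map_scalar_mx p _ D) -(map_scalar_mx p _ D') -!map_mxM; apply/matrixP => i j.
rewrite [LHS]mxE [RHS]mxE -aSS; apply/esym/eqP.
by rewrite -subr_eq0 -rmorphB; apply/eqP/pS.
Qed.

End TwoByTwo.

Lemma hopf_quotient_eq0 (k : fieldType) (H Q : hopfAlgType k) (X : set H)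
  (p : {lrmorphism H -> Q}) : is_hopf_quotient X p ->
  (forall x, exists y, p y = x) /\ forall x, X x -> p x = 0.
Proof. by move=> [_ [I [_ XI _] [psurj pker]]]; split=> // x /XI /pker. Qed.

Theorem theorem0p3 (R : realType) (k : closedFieldType)
  (char_k : [pchar k] =i pred0)
  (n : nat) (n_ge2 : (2 <= n)%N) (E : 'M[k]_n) (E_GL : E \in unitmx)
  (A : algType k) (pA : {lrmorphism free_alg k 'I_n -> A})
  (A_def : is_AnE E pA)
  (OM : bialgType k) (pM : {lrmorphism mx_bialg k n -> OM})
  (OM_def : is_OM E pM)
  (OGL : hopfAlgType k) (iota : {lrmorphism OM -> OGL})
  (OGL_def : is_hopf_envelope iota)
  (D : OGL)
  (D_def : is_codeterminant E (fun i j => iota (pM (mx_gen k i j))) D)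
  (OGLc : hopfAlgType k) (pGLc : {lrmorphism OGL -> OGLc})
  (OGLc_def : is_OGLc D pGLc)
  (OSL : hopfAlgType k) (pSL : {lrmorphism OGL -> OSL})
  (OSL_def : is_OSL D pSL)
  (OGLS2 : hopfAlgType k) (pGLS2 : {lrmorphism OGL -> OGLS2})
  (OGLS2_def : is_mod_S2 pGLS2)
  (OSLS2 : hopfAlgType k) (pSLS2 : {lrmorphism OSL -> OSLS2})
  (OSLS2_def : is_mod_S2 pSLS2) :
  [<-> noetherian A;
       finite_GKdim R A;
       [/\ noetherian OSLS2, noetherian OGLS2, noetherian OSL & noetherian OGLc];
       [/\ finite_GKdim R OSLS2, finite_GKdim R OGLS2, finite_GKdim R OSL
         & finite_GKdim R OGLc];
       n = 2%N].
Proof.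
have [D_grouplike [D' [DD' D'D D_row]]] := D_def.
have [f [f_quot fa fD fD' aSS]] := envelope_presentation (ltnW n_ge2) E_GL OM_def OGL_def
  D_grouplike DD' D'D (codeterminant_row D_row).
have small : noetherian A \/ finite_GKdim R A \/ noetherian OSL \/ finite_GKdim R OSL -> n = 2%N.
  move=> h; apply/eqP; rewrite eqn_leq n_ge2 andbT leqNgt; apply/negP => n_ge3.
  have [A1 A2] := AnE_wild R n_ge3 E_GL A_def.
  have [B1 B2] := OSL_wild R E_GL f_quot fD n_ge3 OSL_def.
  by case: h => [|[|[|]]].
have bounded : n = 2%N -> [/\ noetherian A /\ finite_GKdim R A,
    noetherian OSLS2 /\ finite_GKdim R OSLS2, noetherian OGLS2 /\ finite_GKdim R OGLS2,
    noetherian OSL /\ finite_GKdim R OSL & noetherian OGLc /\ finite_GKdim R OGLc].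
  move=> n2; subst n.
  have aE : \matrix_(i, j) f (GL_a k i j) = \matrix_(i, j) iota (pM (mx_gen k i j)).
    by apply/matrixP => i j; rewrite mxE fa.
  have [pSL_surj pSL0] := OSL_def.2.
  have pSLD : pSL (D - 1) = 0 by apply/pSL0; apply: sub_ideal_gen.
  have pSLc x : pSL (x * f (GL_D k 2) - f (GL_D k 2) * x) = 0.
    have e : pSL D = 1 by apply/eqP; rewrite -subr_eq0 -(rmorph1 pSL) -rmorphB; apply/eqP.
    by rewrite fD rmorphB !rmorphM /= e mulr1 mul1r subrr.
  have [pGLc_surj pGLc0] := hopf_quotient_eq0 OGLc_def.
  have [pGLS2_surj pGLS20] := hopf_quotient_eq0 OGLS2_def.
  have [pSLS2_surj pSLS20] := hopf_quotient_eq0 OSLS2_def.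
  split; first exact: AnE_bounded E_GL A_def.
  - apply: (central_quotient_bounded R E_GL f_quot (p := pSLS2 \o pSL)) => [x|x] /=.
      by have [y <-] := pSLS2_surj x; have [z <-] := pSL_surj y; exists z.
    by rewrite pSLc rmorph0.
  - apply: (involutive_quotient_bounded R E_GL f_quot (p := pGLS2)) => [i j||x] //.
      by rewrite aE fD fD' aSS.
    by apply: pGLS20; exists x.
  - exact: (central_quotient_bounded R E_GL f_quot (p := pSL)).
  - apply: (central_quotient_bounded R E_GL f_quot (p := pGLc)) => // x.
    by apply: pGLc0; rewrite fD; exists x.
tfae.
- by move=> hA; case: bounded => [|[]//]; apply: small; left.
- move=> hA; case: bounded => [|_ [? _] [? _] [? _] [? _]]; last by split.
  by apply: small; right; left.
- case=> _ _ hB _; case: bounded => [|_ [_ ?] [_ ?] [_ ?] [_ ?]]; last by split.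
  by apply: small; right; right; left.
- by case=> _ _ hB _; apply: small; right; right; right.
- by move=> /bounded [[]].
Qed.
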